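(* Let $W$ be of type $B_n$, and let $c=s_ns_{n-1}\cdots s_1$. Let $p$ be an integer such that $1\le p\le 2n-1$ and $\gcd(p,2n)=1$. There exists a positive dual $(c,p)$-conjugator $\mathbf{g}$ such that $$\mathbf{g}\,\mathbf{B}(c)^p\,\mathbf{g}^{-1}\,\mathbf{B}(c)^{-1}=\mathbb{X}_{J_p}=\prod^{\longleftarrow}_{(a,b)\in J_p}\mathbb{P}_c(t_{(b-1)n+a}).$$ If $p<n$, then this conjugator is realizable in the sense that $\mathbb{X}_{J_p}=\mathbf{B}(x_{n,p})\,\mathbf{B}(x_{n,p}^{-1})$.
   Context: Type $B_n$ ($n\ge2$): $W$ has simple reflections $s_1,\ldots,s_n$ with $(s_1s_2)^4=e$, $(s_is_{i+1})^3=e$ for $2\le i\le n-1$, and other pairs commuting. The rank is $r=n$, the Coxeter number is $h=2n$. $T$ is the set of reflections. Realize $W$ as the group of signed permutations in one-line notation, where (acting by right multiplication) $s_1$ changes the sign of the first entry and $s_i$ interchanges the entries in positions $i-1$ and $i$ for $2\le i\le n$. Braid group: $\mathbf{B}_W$ is the (Artin) braid group of $W$, with generators $\mathbf{s}_i$ and the braid relations; $\mathbf{s}_i\mapsto s_i$ defines a surjection $\mathbf{B}_W\to W$, and a lift of $w\in W$ is a preimage of $w$. For $w\in W$ with reduced word $(s_{i_1},\ldots,s_{i_k})$, $\mathbf{B}(w)=\mathbf{s}_{i_1}\cdots\mathbf{s}_{i_k}$. $c$-dual lifts: for a tuple $(g_1,\ldots,g_k)$ in a group, the Hurwitz moves are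 $(g_1,\ldots,g_k)\mapsto(g_1,\ldots,g_{i-1},g_ig_{i+1}g_i^{-1},g_i,g_{i+2},\ldots,g_k)$ and their inverses; the orbit under these moves is the Hurwitz orbit. For each $t\in T$ there is a unique lift $\mathbf{B}_c(t)$ of $t$ appearing as an entry of some tuple in the Hurwitz orbit of $(\mathbf{s}_n,\mathbf{s}_{n-1},\ldots,\mathbf{s}_1)$ (Bessis). Set $\mathbb{P}_c(t)=\mathbf{B}_c(t)^2$. Conjugators: let $\mathbf{g}\in\mathbf{B}_W$ be a lift of an element $g\in W$ with $gc^pg^{-1}=c$. It is a positive dual $(c,p)$-conjugator if $\mathbf{g}\mathbf{B}(c)^p\mathbf{g}^{-1}\mathbf{B}(c)^{-1}$ equals $\mathbb{P}_c(u_1)\cdots\mathbb{P}_c(u_M)$ for some reflections $u_1,\ldots,u_M$, where $M=r(p-1)/2=n(p-1)/2$. Grid: let $(u_1,\ldots,u_{n^2})=(s_n,s_{n-1},\ldots,s_1)^n$ (the word $(s_n,\ldots,s_1)$ repeated $n$ times, a reduced word for the longest element), and $t_k=u_1\cdots u_{k-1}u_ku_{k-1}\cdots u_1$, so $t_1,\ldots,t_{n^2}$ are all the reflections. Let $\mathtt{Grid}_n=\{(a,b):1\le a,b\le n\}$, the cell $(a,b)$ corresponding to $t_{(b-1)n+a}$. For $I\subseteq\mathtt{Grid}_n$, $\mathbb{X}_I=\prod^{\longleftarrow}_{(a,b)\in I}\mathbb{P}_c(t_{(b-1)n+a})$, where the factors are written from left to right in decreasing order of $(b-1)n+a$. Definition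 of $J_p$: if $1\le p<n$, for $1\le j\le(p-1)/2$ set $\eta_j=\lfloor 2nj/p\rfloor$, $I_j^+=\{(a,n-p+2j-a+1):1\le a\le\eta_j\}$, $I_j^-=\{(a,n-2j+1):\eta_j<a\le n\}$, and $J_p=\bigsqcup_{j=1}^{(p-1)/2}(I_j^+\sqcup I_j^-)$. If $n<p<2n$, let $p^*=2n-p$ and $J_p=\mathtt{Grid}_n\setminus(J_{p^*}\sqcup\mathcal{C})$, where $\mathcal{C}=\{(a,1):1\le a\le n\}$. Definition of $x_{n,p}$ (for $1\le p<n$): for $0\le k\le p-1$ set $\lambda_k=\lfloor nk/p\rfloor+1$; $x_{n,p}$ is the signed permutation with $x_{n,p}(\lambda_k)=(-1)^k(p-k)$ for $0\le k\le p-1$ and with the remaining positions filled from left to right by $p+1,p+2,\ldots,n$. *)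

(* Defs.v *)
From HB Require Import structures.
From mathcomp Require Import all_boot all_order all_fingroup all_algebra.
From mathcomp Require Import boolp classical_sets.

Set Implicit Arguments.
Unset Strict Implicit.
Unset Printing Implicit Defensive.

Local Open Scope group_scope.

(** [w = (sigma, eps)] is the signed permutation sending [i] to
    [(-1) ^ eps i * sigma i]; indices are shifted to start from 0.  The product
    is composition of functions, [(u * v) i = u (v i)], hence right
    multiplication acts on positions; MathComp's product of permutations
    composes in the opposite order, whence [v.1 * u.1] below. *)
Definition sperm (n : nat) : Type := ({perm 'I_n} * {ffun 'I_n -> bool})%type.

HB.instance Definition _ n := Finite.on (sperm n).

Definition sperm_one n : sperm n := (1, [ffun=> false]).

Definition sperm_mul n (u v : sperm n) : sperm n :=
  (v.1 * u.1, [ffun i => v.2 i (+) u.2 (v.1 i)]).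

Definition sperm_inv n (u : sperm n) : sperm n :=
  (u.1^-1, [ffun i => u.2 (u.1^-1 i)]).

Lemma sperm_mulA n : associative (@sperm_mul n).
Proof.
move=> u v w; congr pair; first by rewrite /= mulgA.
by apply/ffunP=> i; rewrite !ffunE /= !permM addbA.
Qed.

Lemma sperm_mul1 n : left_id (@sperm_one n) (@sperm_mul n).
Proof.
case=> s e; congr pair; first by rewrite /= mulg1.
by apply/ffunP=> i; rewrite !ffunE addbF.
Qed.

Lemma sperm_mulr1 n : right_id (@sperm_one n) (@sperm_mul n).
Proof.
case=> s e; congr pair; first by rewrite /= mul1g.
by apply/ffunP=> i; rewrite !ffunE /= perm1.
Qed.

Lemma sperm_mulV n : left_inverse (@sperm_one n) (@sperm_inv n) (@sperm_mul n).
Proof.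
case=> s e; congr pair; first by rewrite /= mulgV.
by apply/ffunP=> i; rewrite !ffunE /= permK addbb.
Qed.

Lemma sperm_mulrV n :
  right_inverse (@sperm_one n) (@sperm_inv n) (@sperm_mul n).
Proof.
case=> s e; congr pair; first by rewrite /= mulVg.
by apply/ffunP=> i; rewrite !ffunE /= addbb.
Qed.

HB.instance Definition _ n := isGroup.Build (sperm n)
  (@sperm_mulA n) (@sperm_mul1 n) (@sperm_mulr1 n)
  (@sperm_mulV n) (@sperm_mulrV n).

Definition oneline n (w : sperm n) (i : 'I_n) : int :=
  ((-1) ^+ w.2 i * (w.1 i).+1%:Z)%R.

Definition prev_ord n (i : 'I_n) : 'I_n :=
  Ordinal (leq_ltn_trans (leq_pred i) (ltn_ord i)).

(** [simple i] is [s_(i+1)]; for [i = 0] the transposition is the identity and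
    only the sign of the first entry changes. *)
Definition simple n (i : 'I_n) : sperm n :=
  (tperm (prev_ord i) i,
   [ffun k : 'I_n => (i == 0%N :> nat) && (k == 0%N :> nat)]).

Definition reflection n (t : sperm n) : Prop :=
  exists (w : sperm n) (i : 'I_n), t = w * simple i * w^-1.

Definition reduced_word n (w : sperm n) (s : seq 'I_n) : Prop :=
  \prod_(i <- s) simple i = w /\
  forall s' : seq 'I_n, \prod_(i <- s') simple i = w -> size s <= size s'.

Definition cox_word n : seq 'I_n := rev (enum 'I_n).

Definition cox n : sperm n := \prod_(i <- cox_word n) simple i.

Definition coxeter_matrix n (i j : 'I_n) : nat :=
  if i == j then 1%N
  else if (i.+1 == j :> nat) || (j.+1 == i :> nat) then
    if (i == 0%N :> nat) || (j == 0%N :> nat) then 4%N else 3%N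
  else 2%N.

(** The letter [(b, i)] stands for the generator of index [i] if [b = false],
    and for its inverse if [b = true]. *)
Definition word (n : nat) : Type := seq (bool * 'I_n).

HB.instance Definition _ n := Countable.on (word n).

Fixpoint alternating (T : Type) (x y : T) (m : nat) : seq T :=
  if m is m'.+1 then x :: alternating y x m' else [::].

Inductive braid_eq n : word n -> word n -> Prop :=
| BraidRefl u : braid_eq u u
| BraidSym u v : braid_eq u v -> braid_eq v u
| BraidTrans u v w : braid_eq u v -> braid_eq v w -> braid_eq u w
| BraidCat u u' v v' :
    braid_eq u u' -> braid_eq v v' -> braid_eq (u ++ v) (u' ++ v')
| BraidCancel b i : braid_eq [:: (b, i); (~~ b, i)] [::]
| BraidRelation i j :
    braid_eq (alternating (false, i) (false, j) (coxeter_matrix i j))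
             (alternating (false, j) (false, i) (coxeter_matrix i j)).

Definition braid_rel n : rel (word n) := fun u v => `[< braid_eq u v >].

Lemma braid_rel_refl n : reflexive (@braid_rel n).
Proof. by move=> u; apply/asboolP; apply: BraidRefl. Qed.

Lemma braid_rel_sym n : symmetric (@braid_rel n).
Proof. by move=> u v; apply/asboolP/asboolP; apply: BraidSym. Qed.

Lemma braid_rel_trans n : transitive (@braid_rel n).
Proof.
move=> v u w /asboolP uv /asboolP vw; apply/asboolP.
exact: BraidTrans uv vw.
Qed.

Canonical braid_equiv n :=
  EquivRel (@braid_rel n) (@braid_rel_refl n) (@braid_rel_sym n)
    (@braid_rel_trans n).

Definition braid (n : nat) : Type := {eq_quot (braid_equiv n)}%qT.

HB.instance Definition _ n := EqQuotient.on (braid n).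
HB.instance Definition _ n := Choice.on (braid n).

Definition class_of n (u : word n) : braid n := (\pi_(braid n) u)%qT.

Definition word_of n (x : braid n) : word n := generic_quotient.repr x.

Lemma class_ofP n (u v : word n) : class_of u = class_of v <-> braid_eq u v.
Proof.
split=> [/eqP|uv]; first by rewrite eqmodE => /asboolP.
by apply/eqP; rewrite eqmodE; apply/asboolP.
Qed.

Lemma class_ofK n (x : braid n) : class_of (word_of x) = x.
Proof. exact: reprK. Qed.

Lemma word_of_class n (u : word n) : braid_eq (word_of (class_of u)) u.
Proof. by apply/class_ofP; rewrite class_ofK. Qed.

Definition word_inv n (u : word n) : word n :=
  rev [seq (~~ x.1, x.2) | x <- u].

Lemma word_invK n : involutive (@word_inv n).
Proof.
move=> u; rewrite /word_inv map_rev revK -map_comp -[RHS]map_id.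
by apply: eq_map => -[b i] /=; rewrite negbK.
Qed.

Lemma word_mulV n (u : word n) : braid_eq (u ++ word_inv u) [::].
Proof.
elim: u => [|[b i] u IHu]; first exact: BraidRefl.
have -> : ((b, i) :: u) ++ word_inv ((b, i) :: u)
          = ([:: (b, i)] ++ (u ++ word_inv u)) ++ [:: (~~ b, i)].
  by rewrite /word_inv /= rev_cons -cats1 !catA.
apply: (BraidTrans (v := ([:: (b, i)] ++ [::]) ++ [:: (~~ b, i)])).
  apply: BraidCat; last exact: BraidRefl.
  by apply: BraidCat => //; apply: BraidRefl.
exact: BraidCancel.
Qed.

Definition braid_one n : braid n := class_of [::].
Definition braid_mul n (x y : braid n) : braid n :=
  class_of (word_of x ++ word_of y).
Definition braid_inv n (x : braid n) : braid n :=
  class_of (word_inv (word_of x)).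

Lemma braid_mulE n (u v : word n) :
  braid_mul (class_of u) (class_of v) = class_of (u ++ v).
Proof. by apply/class_ofP; apply: BraidCat; apply: word_of_class. Qed.

Lemma braid_mulA n : associative (@braid_mul n).
Proof.
move=> x y z; rewrite -(class_ofK x) -(class_ofK y) -(class_ofK z).
by rewrite !braid_mulE catA.
Qed.

Lemma braid_mul1 n : left_id (@braid_one n) (@braid_mul n).
Proof. by move=> x; rewrite -(class_ofK x) braid_mulE. Qed.

Lemma braid_mulr1 n : right_id (@braid_one n) (@braid_mul n).
Proof. by move=> x; rewrite -(class_ofK x) braid_mulE cats0. Qed.

Lemma braid_mulrV n :
  right_inverse (@braid_one n) (@braid_inv n) (@braid_mul n).
Proof.
move=> x; rewrite -{1}(class_ofK x) braid_mulE.
by apply/class_ofP; apply: word_mulV.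
Qed.

Lemma braid_mulV n : left_inverse (@braid_one n) (@braid_inv n) (@braid_mul n).
Proof.
move=> x; rewrite -{2}(class_ofK x) braid_mulE; apply/class_ofP.
by rewrite -{2}(word_invK (word_of x)); apply: word_mulV.
Qed.

HB.instance Definition _ n := isGroup.Build (braid n)
  (@braid_mulA n) (@braid_mul1 n) (@braid_mulr1 n)
  (@braid_mulV n) (@braid_mulrV n).

Definition gen n (i : 'I_n) : braid n := class_of [:: (false, i)].

Definition word_eval n (u : word n) : sperm n :=
  \prod_(x <- u) (if x.1 then (simple x.2)^-1 else simple x.2).

Lemma word_eval_cat n (u v : word n) :
  word_eval (u ++ v) = word_eval u * word_eval v.
Proof. by rewrite /word_eval big_cat. Qed.

Definition proj n (x : braid n) : sperm n := word_eval (word_of x).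

Lemma sperm_eq n (u v : sperm n) :
  u.1 = v.1 -> (forall k, u.2 k = v.2 k) -> u = v.
Proof.
by case: u v => [s e] [s' e'] /= -> ee'; congr pair; apply/ffunP.
Qed.

Lemma sperm_mul_sign n (u v : sperm n) k :
  (u * v).2 k = v.2 k (+) u.2 (v.1 k).
Proof. by rewrite ffunE. Qed.

Lemma simple_sign n (i k : 'I_n) :
  (simple i).2 k = (i == 0%N :> nat) && (k == 0%N :> nat).
Proof. by rewrite ffunE. Qed.

Lemma simple0_perm n (i : 'I_n) : i = 0%N :> nat -> (simple i).1 = 1.
Proof.
move=> i0; rewrite /= -[X in _ = X](tperm1 i); congr (tperm _ i).
by apply/val_inj; rewrite /= i0.
Qed.

Lemma simple_far n (i j : 'I_n) : i.+1 < j -> commute (simple i) (simple j).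
Proof.
move=> ij; have ne (k l : 'I_n) : k < l -> k != l.
  by move=> kl; apply: contraTneq kl => ->; rewrite ltnn.
have lt1 : i < j by apply: ltnW.
have lt2 : i < prev_ord j by rewrite /= ltn_predRL.
have lt3 : prev_ord i < j by apply: leq_ltn_trans lt1; apply: leq_pred.
have lt4 : prev_ord i < prev_ord j by apply: leq_ltn_trans lt2; apply: leq_pred.
have j0 : (j == 0%N :> nat) = false by case: (j : nat) lt1.
apply: sperm_eq => [|k].
  rewrite /=; apply/commgP/conjg_fixP.
  by rewrite tpermJ !tpermD //; apply: ne.
rewrite !sperm_mul_sign !simple_sign j0 /= addbF.
rewrite (_ : (tperm _ j k == 0%N :> nat) = (k == 0%N :> nat)) //.
have [pj0 jn0] := (leq_ltn_trans (leq0n i) lt2, leq_ltn_trans (leq0n i) lt1).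
by case: tpermP => // ->; rewrite !gtn_eqF.
Qed.

Lemma simple_braid4 n (i j : 'I_n) : i = 0%N :> nat -> j = 1%N :> nat ->
  simple i * simple j * simple i * simple j =
  simple j * simple i * simple j * simple i.
Proof.
move=> i0 j1; have ji : prev_ord j = i by apply/val_inj; rewrite /= i0 j1.
have s10 := simple0_perm i0.
apply: sperm_eq => [|k].
  by change ((simple j).1 * ((simple i).1 * ((simple j).1 * (simple i).1)) =
             (simple i).1 * ((simple j).1 * ((simple i).1 * (simple j).1)));
     rewrite s10 !(mul1g, mulg1).
rewrite !sperm_mul_sign !simple_sign s10 i0 j1 /= ji !perm1 tpermK.
by rewrite addbC addbF.
Qed.

Lemma simple_braid3 n (i j : 'I_n) : 0 < i -> j = i.+1 :> nat ->
  simple i * simple j * simple i = simple j * simple i * simple j.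
Proof.
move=> i_gt0 ji; have pj : prev_ord j = i by apply/val_inj; rewrite /= ji.
have in0 : (i == 0%N :> nat) = false by rewrite gtn_eqF.
have jn0 : (j == 0%N :> nat) = false by rewrite ji.
apply: sperm_eq => [|k]; last first.
  by rewrite !sperm_mul_sign !simple_sign in0 jn0.
change ((simple i).1 * ((simple j).1 * (simple i).1) =
        (simple j).1 * ((simple i).1 * (simple j).1)).
rewrite /= pj; set k := prev_ord i.
have ki : k != i by rewrite -val_eqE /= neq_ltn prednK ?leqnn.
have ij : i != j by rewrite -val_eqE /= ji neq_ltn ltnSn.
have kj : k != j.
  by rewrite -val_eqE /= ji neq_ltn ltnS leq_pred.
have e1 : tperm i j ^ tperm k i = tperm k j by rewrite tpermJ tpermR tpermD.
have e2 : tperm k i ^ tperm i j = tperm k j.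
  by rewrite tpermJ tpermL tpermD // eq_sym.
by move: e1; rewrite -e2 !conjgE !tpermV.
Qed.

Lemma word_eval_alternating n (i j : 'I_n) m :
  word_eval (alternating (false, i) (false, j) m) =
  \prod_(k <- alternating i j m) simple k.
Proof.
rewrite /word_eval; elim: m i j => [|m IHm] i j; first by rewrite !big_nil.
by rewrite /= !big_cons IHm.
Qed.

Lemma simple_braid n (i j : 'I_n) :
  \prod_(k <- alternating i j (coxeter_matrix i j)) simple k =
  \prod_(k <- alternating j i (coxeter_matrix i j)) simple k.
Proof.
have sym (a b : 'I_n) : coxeter_matrix a b = coxeter_matrix b a.
  by rewrite /coxeter_matrix eq_sym orbC [(a == 0%N :> nat) || _]orbC.
wlog le_ij : i j / i <= j.
  by move=> IH; case: (leqP i j) => [|/ltnW] /IH // E; rewrite sym E.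
rewrite /coxeter_matrix; case: eqVneq => [->|ne_ij] //.
have lt_ij : i < j by rewrite ltn_neqAle le_ij andbT.
rewrite [j.+1 == i :> nat]gtn_eqF ?orbF; last exact: ltnW.
case: eqP => [ji|/eqP ji].
  have -> : (j == 0%N :> nat) = false by rewrite -ji.
  rewrite orbF; case: eqP => [i0|/eqP].
    by rewrite /= !big_cons big_nil !mulg1 !mulgA; apply: simple_braid4;
       rewrite -?ji ?i0.
  rewrite -lt0n => i_gt0.
  by rewrite /= !big_cons big_nil !mulg1 !mulgA; apply: simple_braid3.
rewrite /= !big_cons big_nil !mulg1; apply: simple_far.
by rewrite ltn_neqAle ji.
Qed.

Lemma word_eval_braid_eq n (u v : word n) :
  braid_eq u v -> word_eval u = word_eval v.
Proof.
elim=> // [u' v' w' _ -> _ -> // | u1 u2 v1 v2 _ E1 _ E2 | b i | i j].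
- by rewrite !word_eval_cat E1 E2.
- rewrite /word_eval !big_cons big_nil mulg1.
  by case: b => /=; rewrite ?mulVg ?mulgV.
- by rewrite !word_eval_alternating simple_braid.
Qed.

Lemma proj_class n (u : word n) : proj (class_of u) = word_eval u.
Proof. exact/word_eval_braid_eq/word_of_class. Qed.

Lemma proj_gen n (i : 'I_n) : proj (gen i) = simple i.
Proof. by rewrite proj_class /word_eval big_seq1. Qed.

Lemma projM n : {morph @proj n : x y / x * y}.
Proof. by move=> x y; rewrite [LHS]proj_class word_eval_cat. Qed.

Lemma proj1 n : proj (1 : braid n) = 1.
Proof. by rewrite [LHS]proj_class /word_eval big_nil. Qed.

HB.instance Definition _ n := isUMagmaMorphism.Build (braid n) (sperm n)
  (@proj n) (@proj1 n, @projM n).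

Definition lift_of n (g : braid n) (w : sperm n) : Prop := proj g = w.

(** [B(w)]: by Matsumoto's theorem the product does not depend on the reduced
    word, so that [xget] selects the only element of a singleton. *)
Definition is_positive_lift n (w : sperm n) (g : braid n) : Prop :=
  exists2 s : seq 'I_n, reduced_word w s & g = \prod_(i <- s) gen i.

Definition positive_lift n (w : sperm n) : braid n :=
  xget 1 (is_positive_lift w).

Inductive hurwitz_move (G : groupType) : seq G -> seq G -> Prop :=
| HurwitzMove (s1 s2 : seq G) (x y : G) :
    hurwitz_move (s1 ++ x :: y :: s2) (s1 ++ x * y * x^-1 :: x :: s2).

Inductive hurwitz_orbit (G : groupType) (s : seq G) : seq G -> Prop :=
| HurwitzRefl : hurwitz_orbit s s
| HurwitzStep u v :
    hurwitz_orbit s u -> hurwitz_move u v -> hurwitz_orbit s v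
| HurwitzStepV u v :
    hurwitz_orbit s u -> hurwitz_move v u -> hurwitz_orbit s v.

(** [B_c(t)], for [t] a reflection: by a theorem of Bessis there is exactly one
    such lift. *)
Definition is_dual_lift n (t : sperm n) (g : braid n) : Prop :=
  lift_of g t /\
  exists2 s, hurwitz_orbit [seq gen i | i <- cox_word n] s & g \in s.

Definition dual_lift n (t : sperm n) : braid n := xget 1 (is_dual_lift t).

Definition pure_gen n (t : sperm n) : braid n := dual_lift t ^+ 2.

Definition positive_dual_conjugator n (p : nat) (g : braid n) : Prop :=
  (exists2 w : sperm n, lift_of g w & w * cox n ^+ p * w^-1 = cox n) /\
  exists us : seq (sperm n),
    [/\ size us = (n * (p - 1)) %/ 2,
        forall u, u \in us -> reflection u &
        g * positive_lift (cox n) ^+ p * g^-1 * (positive_lift (cox n))^-1 =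
        \prod_(u <- us) pure_gen u].

Definition long_word n : seq 'I_n := flatten (nseq n (cox_word n)).

(** [t_k = u_1 ... u_k u_(k-1) ... u_1], for [1 <= k <= n ^ 2] *)
Definition grid_reflection n (k : nat) : sperm n :=
  \prod_(i <- take k (long_word n) ++ rev (take k.-1 (long_word n))) simple i.

(** The pair [x] stands for the cell [(a, b) = (x.1 + 1, x.2 + 1)]. *)
Definition cell (n : nat) : Type := ('I_n * 'I_n)%type.

HB.instance Definition _ n := Finite.on (cell n).

Definition cell_a n (x : cell n) : nat := x.1.+1.
Definition cell_b n (x : cell n) : nat := x.2.+1.

Definition cell_index n (x : cell n) : nat := ((cell_b x - 1) * n + cell_a x)%N.

Definition decreasing_cells n (I : {set cell n}) : seq (cell n) :=
  sort (fun x y => cell_index y <= cell_index x) (enum I).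

Definition grid_product n (I : {set cell n}) : braid n :=
  \prod_(x <- decreasing_cells I) pure_gen (grid_reflection n (cell_index x)).

Definition eta_ (n p j : nat) : nat := ((2 * n * j) %/ p)%N.

(** [b = n - p + 2 * j - a + 1], written without truncated subtraction of
    [a] *)
Definition I_plus (n p j : nat) : {set cell n} :=
  [set x | (1 <= cell_a x <= eta_ n p j)%N &&
           (cell_b x + cell_a x == n - p + 2 * j + 1)%N]%SET.

Definition I_minus (n p j : nat) : {set cell n} :=
  [set x | (eta_ n p j < cell_a x <= n)%N &&
           (cell_b x == n - 2 * j + 1)%N]%SET.

Definition J_small (n p : nat) : {set cell n} :=
  (\bigcup_(1 <= j < ((p - 1) %/ 2).+1) (I_plus n p j :|: I_minus n p j))%SET.

Definition first_column n : {set cell n} := [set x | cell_b x == 1%N]%SET.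

Definition J_set (n p : nat) : {set cell n} :=
  if (p < n)%N then J_small n p
  else (~: (J_small n (2 * n - p) :|: first_column n))%SET.

Definition lambda (n p k : nat) : nat := ((n * k) %/ p).+1.

Definition lambdas (n p : nat) : seq nat := [seq lambda n p k | k <- iota 0 p].

(** Entry at the position [a >= 1]: if [a] is not some [lambda_k], it is [p + m]
    where [a] is the [m]-th position not of this form. *)
Definition x_entry (n p a : nat) : int :=
  if a \in lambdas n p then
    let k := index a (lambdas n p) in ((-1) ^+ k * (p - k)%N%:Z)%R
  else Posz (p + count [predC lambdas n p] (iota 1 a)).

Definition x_perm (n p : nat) : sperm n :=
  odflt 1 [pick w : sperm n | [forall i, oneline w i == x_entry n p i.+1]].

Lemma oneline_inj n (v w : sperm n) :
  (forall i, oneline v i = oneline w i) -> v = w.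
Proof.
move=> E.
have E1 i : v.1 i = w.1 i.
  move/(congr1 absz): (E i).
  by rewrite /oneline !abszM !absz_sign !mul1n => -[] /val_inj.
apply: sperm_eq => [|i]; first exact/permP.
move: (E i); rewrite /oneline E1 => /GRing.mulIf => /(_ isT).
by case: (v.2 i) (w.2 i) => [] [].
Qed.

Lemma lambda_lt n p k l :
  (0 < p <= n)%N -> (k < l)%N -> (lambda n p k < lambda n p l)%N.
Proof.
move=> /andP[p0 pn] kl; rewrite /lambda ltnS.
have -> : ((n * k) %/ p).+1 = ((p + n * k) %/ p)%N.
  by rewrite divnDl // divnn p0 add1n.
apply: leq_div2r; apply: leq_trans (leq_mul (leqnn n) kl).
by rewrite mulnS leq_add2r.
Qed.

Lemma lambdas_uniq n p : (0 < p <= n)%N -> uniq (lambdas n p).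
Proof.
move=> pn; rewrite map_inj_uniq ?iota_uniq // => k l E.
by case: (ltngtP k l) => // /(lambda_lt pn); rewrite E ltnn.
Qed.

Lemma lambdas_range n p a :
  (0 < p <= n)%N -> a \in lambdas n p -> a \in iota 1 n.
Proof.
move=> /andP[p0 pn] /mapP[k]; rewrite !mem_iota add0n => /andP[_ kp] ->.
rewrite add1n !ltnS /= ltn_divLR // ltn_pmul2l //.
exact: leq_trans pn.
Qed.

Lemma size_lambdas n p : size (lambdas n p) = p.
Proof. by rewrite size_map size_iota. Qed.

Lemma abs_x_entry n p a : absz (x_entry n p a) =
  if a \in lambdas n p then (p - index a (lambdas n p))%N
  else (p + count [predC lambdas n p] (iota 1 a))%N.
Proof.
by rewrite /x_entry; case: ifP => // _; rewrite abszM abszX abszN1 exp1n mul1n.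
Qed.

Lemma count_free n p : (0 < p <= n)%N ->
  (p + count [predC lambdas n p] (iota 1 n))%N = n.
Proof.
move=> pn; rewrite -[RHS](size_iota 1 n) -(count_predC [in lambdas n p]).
congr (_ + _)%N; rewrite -size_filter -{1}(size_lambdas n p).
apply/perm_size/uniq_perm;
  rewrite ?lambdas_uniq ?filter_uniq ?iota_uniq // => a.
rewrite mem_filter /=.
by case: (boolP (a \in lambdas n p)) => //= /lambdas_range ->.
Qed.

Lemma abs_x_entry_range n p a : (0 < p <= n)%N -> (0 < a <= n)%N ->
  (0 < absz (x_entry n p a) <= n)%N.
Proof.
move=> pn /andP[a0 an]; have /andP[p0 pn'] := pn.
rewrite abs_x_entry; case: ifP => aL.
  have : (index a (lambdas n p) < p)%N.
    by rewrite -{2}(size_lambdas n p) index_mem.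
  by move=> kp; rewrite subn_gt0 kp /= (leq_trans (leq_subr _ _)).
rewrite addn_gt0 p0 /= -[X in (_ <= X)%N](count_free pn) leq_add2l.
have -> : iota 1 n = iota 1 a ++ iota (1 + a) (n - a).
  by rewrite -iotaD subnKC.
by rewrite count_cat leq_addr.
Qed.

Lemma count_free_lt n p a b : (a < b)%N -> b \notin lambdas n p ->
  (count [predC lambdas n p] (iota 1 a) <
   count [predC lambdas n p] (iota 1 b))%N.
Proof.
case: b => // b; rewrite ltnS => ab bL.
rewrite -[b.+1]addn1 iotaD count_cat /= add1n bL addn1 ltnS.
have -> : iota 1 b = iota 1 a ++ iota (1 + a) (b - a).
  by rewrite -iotaD subnKC.
by rewrite count_cat leq_addr.
Qed.

Lemma abs_x_entry_inj n p a b :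
  (0 < p <= n)%N -> (0 < a)%N -> (0 < b)%N ->
  absz (x_entry n p a) = absz (x_entry n p b) -> a = b.
Proof.
move=> pn a0 b0; rewrite !abs_x_entry.
have idx c : c \in lambdas n p -> (p - index c (lambdas n p) <= p)%N.
  by move=> _; apply: leq_subr.
have pos c : c \notin lambdas n p -> (0 < c)%N ->
    (p < p + count [predC lambdas n p] (iota 1 c))%N.
  move=> cL c0; rewrite -[X in (X < _)%N]addn0 ltn_add2l.
  exact: leq_ltn_trans (count_free_lt c0 cL).
case: ifPn => aL; case: ifPn => bL.
- move=> E; rewrite -(nth_index 0%N aL) -(nth_index 0%N bL); congr nth.
  have [la lb] : (index a (lambdas n p) < p /\ index b (lambdas n p) < p)%N.
    by split; rewrite -[X in (_ < X)%N](size_lambdas n p) index_mem.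
  rewrite -(subKn (ltnW la)) E subKn //; exact: ltnW.
- by move=> E; move: (idx a aL); rewrite E leqNgt pos.
- by move=> E; move: (idx b bL); rewrite -E leqNgt pos.
move=> /addnI E; case: (ltngtP a b) => //.
  by move=> /count_free_lt/(_ bL); rewrite E ltnn.
by move=> /count_free_lt/(_ aL); rewrite E ltnn.
Qed.

Lemma oneline_x n p (i : 'I_n) :
  (0 < p <= n)%N -> oneline (x_perm n p) i = x_entry n p i.+1.
Proof.
move=> pn.
have lt_abs (k : 'I_n) : ((absz (x_entry n p k.+1)).-1 < n)%N.
  have /(abs_x_entry_range pn) /andP[e0 en] : (0 < k.+1 <= n)%N
    by rewrite ltn_ord.
  by rewrite prednK.
pose f k := Ordinal (lt_abs k).
have f_inj : injective f.
  move=> k l [] E; apply/val_inj; apply: succn_inj.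
  apply: (abs_x_entry_inj pn) => //.
  have /(abs_x_entry_range pn) /andP[k0 _] : (0 < k.+1 <= n)%N
    by rewrite ltn_ord.
  have /(abs_x_entry_range pn) /andP[l0 _] : (0 < l.+1 <= n)%N
    by rewrite ltn_ord.
  by rewrite -(prednK k0) E prednK.
pose w : sperm n := (perm f_inj, [ffun k : 'I_n => (x_entry n p k.+1 < 0)%R]).
have wP : [forall k, oneline w k == x_entry n p k.+1].
  apply/forallP=> k; rewrite /oneline ffunE permE /=.
  have /(abs_x_entry_range pn) /andP[k0 _] : (0 < k.+1 <= n)%N
    by rewrite ltn_ord.
  by rewrite prednK // -intEsign.
rewrite /x_perm; case: pickP => [v /forallP/(_ i)/eqP //|/(_ w)].
by rewrite wP.
Qed.

(* Main.v *)
Require Import Defs.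
From mathcomp Require Import all_boot all_order all_fingroup all_algebra.
From mathcomp Require Import boolp classical_sets zify.

Set Implicit Arguments.
Unset Strict Implicit.
Unset Printing Implicit Defensive.

Import Order.TTheory GRing.Theory Num.Theory.
Local Open Scope nat_scope.
Local Open Scope group_scope.

(** Write [delta = B(c)]; its power [delta ^+ n] is the lift of the longest
    element, hence central.  Two facts make the products [X_I] computable.

    First, the dual lifts of the reflections of the grid are the conjugates of
    the generators by the prefixes of the word of [delta ^+ n].  Uniqueness of
    dual lifts comes from an invariant of the Hurwitz orbit of
    [(s_n, ..., s_1)]: all its tuples are made of such conjugates, and are
    triangular for the Euler form of [c].

    Hence [X_I] is [delta ^+ n] times the reversed word of [delta ^+ n] in which
    the letters of the cells outside [I] are inverted.  If [I] is the set of the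
    positions where this word descends from [w^-1], the inverted word telescopes
    and [X_I = B(w) B(w^-1)].  For [w = x_(n,p)], the descents are the cells of
    [J_p].

    For [p < n], let [Y_l] be the lift of the sign change of the entry [l] and
    let [w_j] be the permutation [k |-> p k - j] of the residues modulo [n].
    Then [delta B(w_j) = B(w_(j+1)) Y_k] where [w_j k = 1], so that [delta ^+ p]
    is conjugate to [delta] times the product of the commuting elements
    [Y_(lambda_k)], for [0 < k < p].  Successive conjugations by lifts of the
    longest elements of smaller groups of type [B] nest the two halves of each
    [Y_(lambda_k)] around [delta], which gives [B(x^-1) delta B(x)].

    For [n < p], the case of [2 n - p] is transported by the automorphism that
    inverts the generators: it sends [delta] to a conjugate of [delta^-1] and,
    outside the first column, exchanges the cells of [I] with the others. *)

(** * Signed permutations and their length *)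

(** The tuples of a Hurwitz orbit cannot be listed, so uniqueness of dual lifts needs a condition on
    pairs that survives every move and ensures that the conjugate created by a move is again one of
    the [n ^ 2] known elements. Vanishing of the Euler form does both; its invariance under [delta]
    reduces the check to pairs whose first generator moves the entry [n].

    [Y l] splits as [dn 0 l * up 1 l] and as [dn 1 l * up 0 l], and consecutive halves of the nest
    join only if the two splittings alternate. The halves with [s_1] produce the signs [(-1) ^ k] of
    [x_(n,p)]; oddness of [p] leaves all of [delta], not [s_n ... s_2], in the middle.

    For [n < p] the nesting is out of reach, as the [lambda_k] are then no longer distinct. The
    first column is set apart there because its letters, all inverted, form the [delta^-1] that
    cancels the last factor of [X_I * delta].

    The number [M] of factors is not found by counting cells: the braid relations are homogeneous,
    and degrees are compared. *)

(** Indices start from 1, as in [s_1, ..., s_n]; the value is [1] outside this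
    range. *)
Definition letter (G : groupType) n (f : 'I_n -> G) (k : nat) : G :=
  if k is j.+1 then oapp f 1 (insub j) else 1.

Lemma letterE (G : groupType) n (f : 'I_n -> G) (i : 'I_n) :
  letter f i.+1 = f i.
Proof. by rewrite /letter valK. Qed.

Lemma letter_out (G : groupType) n (f : 'I_n -> G) k :
  n < k -> letter f k = 1.
Proof. by case: k => // k; rewrite ltnS /letter => nk; rewrite insubN // -leqNgt. Qed.

Lemma ord_of n k : 0 < k <= n -> exists i : 'I_n, k = i.+1.
Proof. by case: k => // k kn; exists (Ordinal (kn : k < n)). Qed.

Section Action.
Variable n : nat.
Implicit Types (u v w : sperm n) (z : int) (k : nat).

(** [w] acts as an odd map on all the integers, and fixes those beyond [n]. *)
Definition act w z : int :=
  match z with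
  | Posz j.+1 => oapp (oneline w) z (insub j)
  | Posz 0 => 0%R
  | Negz j => (- oapp (oneline w) (Posz j.+1) (insub j))%R
  end.

Arguments act : simpl never.

Lemma act_ord w (i : 'I_n) : act w (Posz i.+1) = oneline w i.
Proof. by rewrite /act valK. Qed.

Lemma act_out w k : n < k -> act w (Posz k) = (Posz k).
Proof. by case: k => // k; rewrite ltnS /act => nk; rewrite insubN // -leqNgt. Qed.

Lemma act0 w : act w 0 = 0%R.
Proof. by []. Qed.

Lemma actN w z : act w (- z) = (- act w z)%R.
Proof. by case: z => [[|j]|j] //=; rewrite opprK. Qed.

Lemma act_sign w (b : bool) z :
  act w ((-1) ^+ b * z)%R = ((-1) ^+ b * act w z)%R.
Proof. by case: b; rewrite ?expr0 ?mul1r // expr1 !mulN1r actN. Qed.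

Lemma int_abs_cases (P : int -> Prop) :
  (forall z, P z -> P (- z)%R) -> P 0%R ->
  (forall i : 'I_n, P (Posz i.+1)) -> (forall k, n < k -> P (Posz k)) ->
  forall z, P z.
Proof.
move=> PN P0 Pi Pout.
have Ppos (k : nat) : P (Posz k).
  have [/Pout //|] := ltnP n k; case: k => // k kn.
  exact: (Pi (Ordinal (kn : k < n))).
by case=> k; [apply: Ppos | rewrite NegzE; apply/PN/Ppos].
Qed.

Lemma actM u v z : act (u * v) z = act u (act v z).
Proof.
elim/int_abs_cases: z => [z IH|//|i|k nk]; first by rewrite !actN IH.
  rewrite !act_ord /oneline act_sign act_ord sperm_mul_sign /= permM /oneline.
  by rewrite signr_addb -mulrA.
by rewrite !act_out.
Qed.

Lemma act1 z : act 1 z = z.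
Proof.
elim/int_abs_cases: z => [z IH|//|i|k nk]; first by rewrite !actN IH.
  by rewrite act_ord /oneline /= perm1 ffunE mul1r.
by rewrite !act_out.
Qed.

Lemma actK w z : act w^-1 (act w z) = z.
Proof. by rewrite -actM mulVg act1. Qed.

Lemma actKV w z : act w (act w^-1 z) = z.
Proof. by rewrite -actM mulgV act1. Qed.

Lemma act_inj w : injective (act w).
Proof. exact: can_inj (actK w). Qed.

Lemma act_eq u v : (forall k, 0 < k <= n -> act u (Posz k) = act v (Posz k)) -> u = v.
Proof. by move=> E; apply: oneline_inj => i; rewrite -!act_ord E /=. Qed.

Lemma act_range w k : 0 < k <= n -> 0 < absz (act w (Posz k)) <= n.
Proof.
case/ord_of=> i ->; rewrite act_ord /oneline abszM abszX abszN1 exp1n mul1n.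
exact: ltn_ord.
Qed.

Lemma act_neq0 w k : 0 < k -> act w (Posz k) <> 0%R.
Proof. by move=> k0 E; have /act_inj[] : act w (Posz k) = act w 0; [|lia]. Qed.

Definition sg k : sperm n := letter (@simple n) k.

Lemma simpleK (i : 'I_n) : simple i * simple i = 1.
Proof.
apply: sperm_eq => [|k]; first by rewrite /= tperm2.
rewrite sperm_mul_sign !simple_sign [RHS]ffunE.
by case: eqP => //= i0; rewrite -[(tperm _ _)]/((simple i).1) simple0_perm // perm1 addbb.
Qed.

Lemma sgK k : sg k * sg k = 1.
Proof.
by rewrite /sg /letter; case: k => [|k]; rewrite ?mulg1 //; case: insubP => *;
  rewrite /= ?simpleK ?mulg1.
Qed.

Lemma sgV k : (sg k)^-1 = sg k.
Proof. by apply/esym/eqP; rewrite -[_ == _]divg_eq1 invgK sgK. Qed.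

Lemma act_sg1 z : 0 < n -> act (sg 1) z = if absz z == 1%N then (- z)%R else z.
Proof.
move=> n0; elim/int_abs_cases: z => [z IH|//|i|k nk].
- by rewrite actN IH abszN; case: ifP; rewrite // opprK.
- rewrite act_ord /sg (letterE _ (Ordinal n0)) /oneline simple0_perm // perm1.
  by rewrite simple_sign /=; case: (i : nat) => [|j]; rewrite ?mulN1r // mul1r.
rewrite act_out //; case: eqP => //; lia.
Qed.

Lemma act_sg k (m : nat) : 1 < k <= n -> act (sg k) (Posz m) =
  Posz (if m == k then k.-1 else if m == k.-1 then k else m).
Proof.
case: k => // k; rewrite ltnS => /andP[k0 kn].
have [nm|] := ltnP n m; first by rewrite act_out //; rewrite !ifF //; lia.
case: m => [|m] mn; first by rewrite !ifF //; lia.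
rewrite (act_ord _ (Ordinal (mn : m < n))) /sg (letterE _ (Ordinal (kn : k < n))).
rewrite /oneline simple_sign /= (negPf (lt0n_neq0 k0)) mul1r.
case: tpermP => [[->]|[->]|] /=.
- by case: eqP; [lia|]; case: eqP => //; lia.
- by rewrite eqxx prednK.
move=> /eqP; rewrite -val_eqE /= => h1 /eqP; rewrite -val_eqE /= => h2.
do 2![case: eqP => [|_]; first lia]; done.
Qed.

Definition desc w k :=
  if k == 1%N then (act w (Posz 1) < 0)%R else (act w (Posz k) < act w (Posz k.-1))%R.

End Action.

Arguments act : simpl never.
Arguments sg : simpl never.
Arguments letter : simpl never.

Section Length.
Variable n : nat.
Implicit Types (w : sperm n) (k : nat).

Lemma act_mul_sg w k m : 1 < k <= n -> act (w * sg n k) (Posz m) =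
  act w (Posz (if m == k then k.-1 else if m == k.-1 then k else m)).
Proof. by move=> kn; rewrite actM act_sg. Qed.

Lemma act_mul_sg1 w m : 0 < n -> act (w * sg n 1) (Posz m) =
  if m == 1%N then (- act w (Posz m))%R else act w (Posz m).
Proof. by move=> n0; rewrite actM act_sg1 //=; case: ifP; rewrite ?actN. Qed.

Lemma desc_mul_sg w k : 0 < k <= n -> desc (w * sg n k) k = ~~ desc w k.
Proof.
move=> kn; rewrite /desc; case: eqP => [->|k1].
  rewrite act_mul_sg1 ?eqxx /=; last lia.
  by have := @act_neq0 n w 1 isT; lia.
rewrite !act_mul_sg ?eqxx; try lia.
rewrite (_ : k.-1 == k = false); last lia.
have : act w (Posz k) <> act w (Posz k.-1) by move/act_inj; lia.
lia.
Qed.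

(** The roots [e_j - e_i] with [i < j], and [e_i + e_j] with [i <= j], made
    negative by [w]. *)
Definition inv_pair w (i j : nat) : nat :=
  ((i < j) && (act w (Posz j) < act w (Posz i))%R) +
  ((i <= j) && (act w (Posz i) + act w (Posz j) < 0)%R).

Definition ell w : nat := \sum_(p : 'I_n * 'I_n) inv_pair w p.1.+1 p.2.+1.

(** The sign change of the first entry negates [2 e_1] and exchanges [e_j - e_1] with [e_1 + e_j],
    that is, the two terms of each [inv_pair] with [1 = i < j]. *)
Lemma ell_desc1 w : 0 < n -> desc w 1 -> ell w = (ell (w * sg n 1)).+1.
Proof.
move=> n0 d; rewrite /ell.
pose o := Ordinal n0; rewrite (bigD1 (o, o)) // [in RHS](bigD1 (o, o)) //=.
rewrite -addSn; congr (_ + _).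
  rewrite /inv_pair !act_mul_sg1 // eqxx /=; move: d; rewrite /desc /=; lia.
apply: eq_bigr => -[i j] /= ne; rewrite /inv_pair !act_mul_sg1 //.
have {ne} : ~ (i = 0 :> nat /\ j = 0 :> nat).
  by move=> [i0 j0]; case/eqP: ne; congr pair; apply: val_inj.
do 2!case: eqP => ? /=; lia.
Qed.

(** For [k > 1], exchanging the positions [k - 1] and [k] permutes the positive roots other than
    [e_k - e_(k-1)]; after reindexing, only the pairs formed by these two positions differ. *)
Lemma ell_desc w k : 0 < k <= n -> desc w k -> ell w = (ell (w * sg n k)).+1.
Proof.
move=> kn; have [->|k1] := eqVneq k 1%N; first by apply: ell_desc1; lia.
have {}kn : 1 < k <= n by lia.
move=> d.
have [b bk] : exists b : 'I_n, k = b.+1 by apply: ord_of; lia.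
have [a ak] : exists a : 'I_n, k.-1 = a.+1 by apply: ord_of; lia.
rewrite /ell; set t := tperm a b.
have t_inj : injective (fun p : 'I_n * 'I_n => (t p.1, t p.2)).
  by move=> [i j] [i' j'] [] /perm_inj -> /perm_inj ->.
rewrite [in RHS](reindex_inj t_inj) /=.
have tE (i : 'I_n) : act (w * sg n k) (Posz (t i).+1) = act w (Posz i.+1).
  rewrite act_mul_sg // /t; congr (act w (Posz _)).
  case: tpermP => [->|->|]; rewrite -?ak -?bk ?eqxx //.
    by rewrite ifF //; lia.
  by move=> /eqP; rewrite -val_eqE /= => h /eqP; rewrite -val_eqE /= => h'; rewrite !ifF; lia.
have nab : a != b by rewrite -val_eqE /=; lia.
rewrite (bigD1 (a, b)) // [in RHS](bigD1 (a, b)) //=.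
rewrite (bigD1 (b, a)) /=; last by rewrite xpair_eqE negb_and eq_sym nab.
rewrite [in RHS](bigD1 (b, a)) /=; last by rewrite xpair_eqE negb_and eq_sym nab.
rewrite !addnA -addSn; congr (_ + _).
  rewrite /inv_pair !tE /t tpermL tpermR -ak -bk; move: d.
  by rewrite /desc (negPf k1); lia.
apply: eq_bigr => -[i j] /=; rewrite !xpair_eqE => /andP[h1 h2].
rewrite /inv_pair !tE; congr (nat_of_bool (_ && _) + nat_of_bool (_ && _));
  move: h1 h2; rewrite /t -!val_eqE /=;
  do 2!case: tpermP => [->|->|/eqP + /eqP]; rewrite -?val_eqE /=; lia.
Qed.

Lemma ell_asc w k : 0 < k <= n -> ~~ desc w k -> ell (w * sg n k) = (ell w).+1.
Proof.
move=> kn d; rewrite (@ell_desc (w * sg n k) k) ?desc_mul_sg //.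
by rewrite -mulgA sgK mulg1.
Qed.

Lemma ell1 : ell 1 = 0.
Proof. by apply: big1 => -[i j] _; rewrite /inv_pair !act1 /=; lia. Qed.

(** Without descents [0 < w 1 < ... < w n <= n], which leaves no choice: [up] bounds the values from
    below and [dn] from above. *)
Lemma no_desc_eq1 w : (forall k, 0 < k <= n -> ~~ desc w k) -> w = 1.
Proof.
move=> nd; apply: act_eq => k /andP[k0 kn]; rewrite act1.
have inc m : m < n -> (act w (Posz m) < act w (Posz m.+1))%R.
  move=> mn; have := nd m.+1 mn; rewrite /desc; case: m mn => [|m] mn /=.
    by rewrite act0; have := @act_neq0 n w 1 isT; lia.
  have : act w (Posz m.+2) <> act w (Posz m.+1) by move/act_inj; lia.
  lia.
have up m : m <= n -> (Posz m <= act w (Posz m))%R.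
  by elim: m => [|m IH] mn; [rewrite act0 | have := inc m mn; have := IH (ltnW mn); lia].
have dn m : m <= n -> (act w (Posz (n - m)) <= Posz (n - m))%R.
  elim: m => [|m IH] mn.
    rewrite subn0; have := @act_range n w n; lia.
  have := inc (n - m.+1); rewrite -subSn // subSS => /(_ ltac:(lia)); have := IH (ltnW mn); lia.
have := dn (n - k) ltac:(lia); have := up k kn; rewrite subKn //; lia.
Qed.

Lemma ex_desc w : w != 1 -> exists2 k, 0 < k <= n & desc w k.
Proof.
move=> w1; apply: contrapT => H; case/eqP: w1; apply: no_desc_eq1 => k kn.
by apply/negP => d; apply: H; exists k.
Qed.

Lemma sg_ord (i : 'I_n) : sg n i.+1 = simple i.
Proof. exact: letterE. Qed.

Lemma ell_le_size (s : seq 'I_n) : ell (\prod_(i <- s) simple i) <= size s.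
Proof.
elim/last_ind: s => [|s i IH]; first by rewrite big_nil ell1.
rewrite -cats1 big_cat big_seq1 size_cat addn1 -sg_ord /=.
set w := \prod_(i <- s) _ in IH *.
have [d|d] := boolP (desc w i.+1).
  by rewrite (ell_desc (k := i.+1) (ltn_ord i) d) in IH; apply/leqW/ltnW.
by rewrite (ell_asc (k := i.+1) (ltn_ord i) d) ltnS.
Qed.

Lemma ex_word w : exists2 s : seq 'I_n, \prod_(i <- s) simple i = w & size s = ell w.
Proof.
move: {2}(ell w) (erefl (ell w)) => m; elim: m w => [|m IH] w Em.
  exists [::]; rewrite ?Em // big_nil; apply/esym/eqP; apply: contraT => /ex_desc[k kn d].
  by rewrite (ell_desc kn d) in Em.
have /ex_desc[k kn d] : w != 1 by apply: contra_eq_neq Em => ->; rewrite ell1.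
have [i ki] := ord_of kn.
have [|s Es Ess] := IH (w * sg n k); first by have := ell_desc kn d; lia.
exists (rcons s i); last by rewrite size_rcons Ess -(ell_desc kn d).
by rewrite -cats1 big_cat big_seq1 /= Es -sg_ord -ki -mulgA sgK mulg1.
Qed.

Lemma reduced_wordP w (s : seq 'I_n) :
  reduced_word w s <-> \prod_(i <- s) simple i = w /\ size s = ell w.
Proof.
split=> [[E min]|[E Es]]; split=> //.
  apply/eqP; rewrite eqn_leq -{2}E ell_le_size andbT.
  by have [t Et <-] := ex_word w; apply: min.
by move=> t Et; rewrite Es -Et ell_le_size.
Qed.

End Length.

(** * Positive lifts *)

Section Matsumoto.
Variable n : nat.
Implicit Types (w : sperm n) (k l : nat).

Lemma desc_sg_far w k l : 0 < k -> k.+1 < l <= n -> desc w l -> desc (w * sg n k) l.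
Proof.
move=> k0 ln; rewrite /desc !ifN; try lia.
have [->|k1] := eqVneq k 1%N; last first.
  by rewrite !act_mul_sg; try lia; rewrite !ifF //; lia.
by rewrite !act_mul_sg1 ?ifF //; lia.
Qed.

Lemma ell_braid2 w k l : 0 < k -> k.+1 < l <= n -> desc w k -> desc w l ->
  ell w = (ell (w * sg n k * sg n l)).+2.
Proof.
move=> k0 ln dk dl; rewrite (ell_desc (k := k) _ dk); last lia.
rewrite (ell_desc (k := l) (w := w * sg n k)) //; last exact: desc_sg_far.
lia.
Qed.

Lemma ell_braid3 w k : 1 < k < n -> desc w k -> desc w k.+1 ->
  ell w = (ell (w * sg n k * sg n k.+1 * sg n k)).+3.
Proof.
move=> kn dk dl; have [kn1 kn2] : 1 < k <= n /\ 1 < k.+1 <= n by lia.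
have ifE (x : sperm n) (a b : nat) : a = b -> act x (Posz a) = act x (Posz b) by move->.
have E1 x : act (x * sg n k) (Posz k) = act x (Posz k.-1).
  by rewrite act_mul_sg //; apply: ifE; do 2?case: eqP; lia.
have E2 x : act (x * sg n k) (Posz k.-1) = act x (Posz k).
  by rewrite act_mul_sg //; apply: ifE; do 2?case: eqP; lia.
have E3 x : act (x * sg n k) (Posz k.+1) = act x (Posz k.+1).
  by rewrite act_mul_sg //; apply: ifE; do 2?case: eqP; lia.
have E4 x : act (x * sg n k.+1) (Posz k) = act x (Posz k.+1).
  by rewrite act_mul_sg //; apply: ifE; do 2?case: eqP; lia.
have E5 x : act (x * sg n k.+1) (Posz k.-1) = act x (Posz k.-1).
  by rewrite act_mul_sg //; apply: ifE; do 2?case: eqP; lia.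
have dE x : desc x k = (act x (Posz k) < act x (Posz k.-1))%R.
  by rewrite /desc ifF //; lia.
have dSE x : desc x k.+1 = (act x (Posz k.+1) < act x (Posz k))%R.
  by rewrite /desc ifF //; lia.
rewrite (ell_desc (k := k) _ dk); last lia.
move: dk dl; rewrite dE dSE => dk dl.
rewrite (ell_desc (k := k.+1) (w := w * sg n k)); last 2 first.
- lia.
- by rewrite dSE E3 E1; lia.
rewrite (ell_desc (k := k) (w := w * sg n k * sg n k.+1)) //; first lia.
by rewrite dE E4 E5 E3 E2.
Qed.

Lemma ell_braid4 w : 1 < n -> desc w 1 -> desc w 2 ->
  ell w = (ell (w * sg n 1 * sg n 2 * sg n 1 * sg n 2)).+4.
Proof.
move=> n1 d1 d2; have n0 : 0 < n by lia.
have n12 : 1 < 2 <= n by lia.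
have := d1; rewrite /desc /= => d1'; have := d2; rewrite /desc /= => d2'.
rewrite (ell_desc (k := 1) _ d1) // (ell_desc (k := 2) (w := w * sg n 1)) //; last first.
  by rewrite /desc /= !act_mul_sg1 //=; lia.
rewrite (ell_desc (k := 1) (w := w * sg n 1 * sg n 2)) //; last first.
  by rewrite /desc /= (@act_mul_sg n _ 2) //= act_mul_sg1 //=; lia.
rewrite (ell_desc (k := 2) (w := w * sg n 1 * sg n 2 * sg n 1)) //.
by rewrite /desc /= !act_mul_sg1 //= !(@act_mul_sg n _ 2) //= !act_mul_sg1 //=; lia.
Qed.

Lemma prod_gen_class (s : seq 'I_n) :
  \prod_(i <- s) gen i = class_of [seq (false, i) | i <- s].
Proof.
elim: s => [|i s IH]; first by rewrite big_nil.
by rewrite big_cons IH /gen -[LHS]/(braid_mul _ _) braid_mulE.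
Qed.

Lemma map_alternating (T U : Type) (f : T -> U) x y m :
  map f (alternating x y m) = alternating (f x) (f y) m.
Proof. by elim: m x y => //= m IH x y; rewrite IH. Qed.

Lemma size_alternating (T : Type) (x y : T) m : size (alternating x y m) = m.
Proof. by elim: m x y => //= m IH x y; rewrite IH. Qed.

Lemma gen_braid (i j : 'I_n) :
  \prod_(k <- alternating i j (coxeter_matrix i j)) gen k =
  \prod_(k <- alternating j i (coxeter_matrix i j)) gen k.
Proof.
by rewrite !prod_gen_class !map_alternating; apply/class_ofP/BraidRelation.
Qed.

(** An element with both descents ends with the longest element of the dihedral group of [s_i] and
    [s_j]: the lemmas [ell_braid2], [ell_braid3] and [ell_braid4] remove its letters one by one,
    each being a descent. *)
Lemma ex_braid_suffix w (i j : 'I_n) : i < j -> desc w i.+1 -> desc w j.+1 ->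
  exists2 r : seq 'I_n, size r + coxeter_matrix i j = ell w &
    \prod_(k <- r) simple k *
      \prod_(k <- alternating i j (coxeter_matrix i j)) simple k = w.
Proof.
move=> ij di dj; set m := coxeter_matrix i j; set a := alternating i j m.
have E : ell w = ell (w * (\prod_(k <- a) simple k)^-1) + m; last first.
  by case: (ex_word (w * (\prod_(k <- a) simple k)^-1)) => r Er Es;
    exists r; rewrite ?Es -?E // Er mulgVK.
rewrite /a /m /coxeter_matrix; have jn := ltn_ord j.
rewrite ifN; last by rewrite -val_eqE /=; lia.
rewrite [j.+1 == i :> nat]gtn_eqF ?orbF; last exact: ltnW.
have sv (k : 'I_n) : (simple k)^-1 = sg n k.+1 by rewrite -sg_ord sgV.
case: eqP => [ji|/eqP ji].
  have -> : (j == 0%N :> nat) = false by rewrite -ji.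
  rewrite orbF; case: eqP => [i0|/eqP i0] /=.
    rewrite !big_cons big_nil !mulg1 !invgM !sv !mulgA -ji i0 addn4.
    rewrite (ell_braid4 _ (w := w)) ?i0 //; try by [move: di dj; rewrite -ji i0 | lia].
    congr (ell _).+4; rewrite -!mulgA; congr (w * _).
    by have := simple_braid4 i0 (esym (etrans _ ji)); rewrite i0 => /(_ erefl);
      rewrite -!sg_ord -ji i0 -!mulgA.
  rewrite !big_cons big_nil !mulg1 !invgM !sv !mulgA -ji addn3.
  rewrite -ji in dj jn; rewrite (ell_braid3 (k := i.+1) (w := w)) //; lia.
rewrite /= !big_cons big_nil !mulg1 !invgM !sv addn2 !mulgA.
rewrite (ell_braid2 (k := i.+1) (l := j.+1) (w := w)) //; last lia.
have := simple_far (i := i) (j := j); rewrite -!sg_ord => h.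
by rewrite -!mulgA h //; lia.
Qed.

Lemma coxeter_matrix_gt0 (i j : 'I_n) : 0 < coxeter_matrix i j.
Proof. by rewrite /coxeter_matrix; do 3?case: ifP. Qed.

Lemma alternating_rcons (T : Type) (x y : T) m :
  alternating x y m.+1 = rcons (alternating x y m) (if odd m then y else x).
Proof. by elim: m x y => // m IH x y; rewrite -[LHS]/(x :: alternating y x m.+1) IH /=;
  case: odd. Qed.

Lemma prod_rcons (G : groupType) (I : Type) (f : I -> G) s x :
  \prod_(i <- rcons s x) f i = \prod_(i <- s) f i * f x.
Proof. by rewrite -cats1 big_cat big_seq1. Qed.

(** Both words are compared with the reduced words of [w] ending with the two
    sides of the braid relation between their last letters. *)
Lemma matsumoto w (s t : seq 'I_n) :
  \prod_(i <- s) simple i = w -> \prod_(i <- t) simple i = w ->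
  size s = ell w -> size t = ell w ->
  \prod_(i <- s) gen i = \prod_(i <- t) gen i.
Proof.
move: {2}(ell w) (erefl (ell w)) => m; elim: m w s t => [|m IH] w s t Em.
  by rewrite Em => _ _ /size0nil-> /size0nil->.
have last_desc (r : seq 'I_n) (i : 'I_n) : \prod_(k <- rcons r i) simple k = w ->
    size (rcons r i) = m.+1 ->
    [/\ \prod_(k <- r) simple k = w * sg n i.+1, size r = m, desc w i.+1
      & ell (w * sg n i.+1) = m].
  rewrite prod_rcons size_rcons => Er [sr].
  have Ew : \prod_(k <- r) simple k = w * sg n i.+1.
    by rewrite -Er -sg_ord -mulgA sgK mulg1.
  have := ell_le_size r; rewrite Ew sr => le.
  have d : desc w i.+1.
    by apply: contraT => /(ell_asc (k := i.+1) (ltn_ord i)); lia.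
  by split=> //; have := ell_desc (k := i.+1) (ltn_ord i) d; lia.
rewrite Em; case/lastP: s => // s i; case/lastP: t => // t j Es Et ss st.
have [Es' ss' di ei] := last_desc _ _ Es ss.
have [Et' st' dj ej] := last_desc _ _ Et st.
rewrite !prod_rcons; have [eij|nij] := eqVneq i j.
  by rewrite -eij in Et' *; congr (_ * _); apply: (IH (w * sg n i.+1)); rewrite ?ei.
wlog ij : i j s t Es Et ss st Es' ss' di ei Et' st' dj ej nij / i < j.
  move=> H; have [|ji] := ltnP i j; first exact: H.
  apply/esym; apply: H; rewrite 1?eq_sym //.
  by rewrite ltn_neqAle ji andbT; rewrite -val_eqE /= eq_sym in nij.
have [r sr Er] := ex_braid_suffix ij di dj.
(* [c] is the last letter of the alternating word that starts with [a]. Once it is removed, [q] and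
   [r] followed by the rest of that word are both reduced words of [w * s_c], and the induction
   hypothesis compares them. *)
have mid (a b : 'I_n) (q : seq 'I_n) : (a == i) && (b == j) || (a == j) && (b == i) ->
    let c := if odd (coxeter_matrix i j).-1 then b else a in
    \prod_(k <- q) simple k = w * sg n c.+1 -> size q = m ->
    ell (w * sg n c.+1) = m ->
    \prod_(k <- q) gen k * gen c =
    \prod_(k <- r) gen k * \prod_(k <- alternating a b (coxeter_matrix i j)) gen k.
  move=> ab c Eq sq ec.
  have := coxeter_matrix_gt0 i j; case Ecox: (coxeter_matrix i j) => [//|x] _.
  rewrite alternating_rcons -[odd x]/(odd x.+1.-1) -Ecox -/c prod_rcons mulgA; congr (_ * _).
  rewrite -big_cat; apply: (IH (w * sg n c.+1)); rewrite ?ec //.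
    rewrite big_cat /= -Er -mulgA; congr (_ * _).
    have -> : \prod_(k <- alternating i j (coxeter_matrix i j)) simple k =
              \prod_(k <- alternating a b (coxeter_matrix i j)) simple k.
      by case/orP: ab => /andP[/eqP-> /eqP->] //; rewrite simple_braid.
    rewrite Ecox alternating_rcons -[odd x]/(odd x.+1.-1) -Ecox -/c prod_rcons.
    by rewrite -sg_ord -mulgA sgK mulg1.
  by rewrite size_cat size_alternating; move: sr; rewrite Ecox; lia.
have := mid i j; have := mid j i; rewrite !eqxx /= orbT /=.
case: (odd _) => /= h1 h2.
  by rewrite (h1 s) ?(h2 t) // gen_braid.
by rewrite (h2 s) ?(h1 t) // gen_braid.
Qed.

End Matsumoto.

Section PositiveLift.
Variable n : nat.
Implicit Types (u v w : sperm n) (k l : nat).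

Definition bg k : braid n := letter (@gen n) k.

Lemma proj_prod_gen (s : seq 'I_n) :
  proj (\prod_(i <- s) gen i) = \prod_(i <- s) simple i.
Proof. by rewrite gmulf_prod; apply: eq_bigr => i _; apply: proj_gen. Qed.

Lemma proj_bg k : proj (bg k) = sg n k.
Proof.
rewrite /bg /sg /letter; case: k => [|k]; first exact: proj1.
by case: insubP => [i _ _|_] /=; [apply: proj_gen | apply: proj1].
Qed.

Lemma bg_far k l : k.+1 < l -> commute (bg k) (bg l).
Proof.
move=> kl; have [nl|ln] := ltnP n l.
  by rewrite {2}/bg letter_out // /commute mulg1 mul1g.
case: k kl => [|k] kl; first by rewrite /commute mulg1 mul1g.
have [i ki] : exists i : 'I_n, k.+1 = i.+1 by apply: ord_of; lia.
have [j lj] : exists j : 'I_n, l = j.+1 by apply: ord_of; lia.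
rewrite ki lj in kl *; rewrite /bg !letterE.
have := gen_braid i j; rewrite /coxeter_matrix ifN; last by rewrite -val_eqE /=; lia.
rewrite ifN; last lia.
by rewrite /= !big_cons !big_nil !mulg1.
Qed.

Lemma bg_braid3 k : 1 < k < n ->
  bg k * bg k.+1 * bg k = bg k.+1 * bg k * bg k.+1.
Proof.
move=> kn.
have [i ki] : exists i : 'I_n, k = i.+1 by apply: ord_of; lia.
have [j lj] : exists j : 'I_n, k.+1 = j.+1 by apply: ord_of; lia.
rewrite lj ki /bg !letterE.
have := gen_braid i j; rewrite /coxeter_matrix ifN; last by rewrite -val_eqE /=; lia.
rewrite ifT; last lia.
rewrite ifN; last lia.
by rewrite /= !big_cons !big_nil !mulg1 !mulgA.
Qed.

Lemma bg_braid4 : 1 < n ->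
  bg 1 * bg 2 * bg 1 * bg 2 = bg 2 * bg 1 * bg 2 * bg 1.
Proof.
move=> n1.
have [i ki] : exists i : 'I_n, 1%N = i.+1 by apply: ord_of; lia.
have [j lj] : exists j : 'I_n, 2%N = j.+1 by apply: ord_of; lia.
rewrite lj ki /bg !letterE.
have := gen_braid i j; rewrite /coxeter_matrix ifN; last by rewrite -val_eqE /=; lia.
rewrite ifT; last lia.
rewrite ifT; last lia.
by rewrite /= !big_cons !big_nil !mulg1 !mulgA.
Qed.

Lemma lift_word (s : seq 'I_n) : size s = ell (\prod_(i <- s) simple i) ->
  positive_lift (\prod_(i <- s) simple i) = \prod_(i <- s) gen i.
Proof.
move=> Es; have P : is_positive_lift (\prod_(i <- s) simple i) (\prod_(i <- s) gen i).
  by exists s => //; apply/reduced_wordP.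
rewrite /positive_lift; case: (xgetPex 1 (ex_intro _ _ P)) => t /reduced_wordP[Et st] ->.
by apply: matsumoto st Es.
Qed.

Lemma lift_mul u v : ell (u * v) = ell u + ell v ->
  positive_lift (u * v) = positive_lift u * positive_lift v.
Proof.
have [s Eu Es] := ex_word u; have [t Ev Et] := ex_word v.
rewrite -Eu -Ev in Es Et * => E.
have Est : size (s ++ t) = ell (\prod_(i <- s ++ t) simple i).
  by rewrite size_cat big_cat Es Et -E.
by have := lift_word Est; rewrite !big_cat (lift_word Es) (lift_word Et).
Qed.

Lemma lift1 : positive_lift (1 : sperm n) = 1.
Proof.
by have := lift_word (s := [::]); rewrite !big_nil ell1 => /(_ erefl).
Qed.

Lemma lift_sg k : 0 < k <= n -> positive_lift (sg n k) = bg k.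
Proof.
case/ord_of => i ->; rewrite sg_ord /bg letterE.
have := lift_word (s := [:: i]); rewrite !big_seq1 => -> //=.
have [d|d] := boolP (desc (1 : sperm n) i.+1).
  by have := ell_desc (k := i.+1) (ltn_ord i) d; rewrite ell1.
by have := ell_asc (k := i.+1) (ltn_ord i) d; rewrite ell1 mul1g sg_ord.
Qed.

Lemma ell_sg k : 0 < k <= n -> ell (sg n k) = 1%N.
Proof.
move=> kn; have [d|d] := boolP (desc (1 : sperm n) k).
  by have := ell_desc kn d; rewrite ell1.
by have := ell_asc kn d; rewrite ell1 mul1g.
Qed.

Lemma lift_asc w k : 0 < k <= n -> ~~ desc w k ->
  positive_lift (w * sg n k) = positive_lift w * bg k.
Proof.
by move=> kn d; rewrite lift_mul ?lift_sg // (ell_asc kn d) ell_sg // addn1.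
Qed.

Lemma lift_desc w k : 0 < k <= n -> desc w k ->
  positive_lift w = positive_lift (w * sg n k) * bg k.
Proof.
move=> kn d; rewrite -lift_asc ?desc_mul_sg ?d //.
by rewrite -mulgA sgK mulg1.
Qed.

Definition longest : sperm n := (1, [ffun=> true]).

Lemma act_longest k : 0 < k <= n -> act longest (Posz k) = (- Posz k)%R.
Proof. by case/ord_of => i ->; rewrite act_ord /oneline ffunE perm1 expr1 mulN1r. Qed.

Lemma act_mul_longest u k : 0 < k <= n -> act (u * longest) (Posz k) = (- act u (Posz k))%R.
Proof. by move=> kn; rewrite actM act_longest // actN. Qed.

Lemma act_longest_mul u k : 0 < k <= n -> act (longest * u) (Posz k) = (- act u (Posz k))%R.
Proof.
move=> kn; rewrite actM; have := act_range u kn.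
by case: (act u _) => m /=; [apply: act_longest|rewrite NegzE actN => h; rewrite act_longest].
Qed.

Lemma longestC u : longest * u = u * longest.
Proof. by apply: act_eq => k kn; rewrite act_mul_longest // act_longest_mul. Qed.

(** Multiplication by [-1] exchanges the positive roots made negative by [u] with the others; in all
    there are [n (n - 1) / 2 + n (n + 1) / 2 = n ^ 2]. *)
Lemma ell_mul_longest u : ell (u * longest) + ell u = (n * n)%N.
Proof.
rewrite /ell -big_split /=.
have -> : (n * n)%N = \sum_(p : 'I_n * 'I_n) (p.1 < p.2) + \sum_(p : 'I_n * 'I_n) (p.1 <= p.2).
  have -> : \sum_(p : 'I_n * 'I_n) (p.1 < p.2) = \sum_(p : 'I_n * 'I_n) (p.2 < p.1).
    rewrite (reindex_inj (h := fun p => (p.2, p.1))) //=.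
    by move=> [a b] [c d] [-> ->].
  rewrite -big_split /= (eq_bigr (fun _ => 1%N)); last by move=> p _; lia.
  by rewrite sum1_card card_prod card_ord.
rewrite -big_split; apply: eq_bigr => -[i j] _ /=.
rewrite /inv_pair !act_mul_longest; try exact: ltn_ord.
rewrite !ltnS.
case: (ltnP i j) => ij.
  have : act u (Posz i.+1) <> act u (Posz j.+1) by move/act_inj; lia.
  have : act u (Posz i.+1) <> act u (- Posz j.+1)%R by move/act_inj; lia.
  rewrite actN (ltnW ij); lia.
have [eij|nij] := eqVneq (i : nat) j; last by lia.
rewrite eij; have := @act_neq0 n u j.+1 isT; lia.
Qed.

Lemma ell_longest : ell longest = (n * n)%N.
Proof. by have := ell_mul_longest 1; rewrite mul1g ell1 addn0. Qed.

Lemma ell_inv u : ell u^-1 = ell u.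
Proof.
suff le v : ell v^-1 <= ell v by apply/eqP; rewrite eqn_leq le -{1}(invgK u) le.
have [s <- <-] := ex_word v; rewrite -{1}(revK s) -prodgV -size_rev.
rewrite (eq_bigr (@simple n)) ?ell_le_size // => i _.
by rewrite -sg_ord sgV.
Qed.

Lemma lift_mul_longest u :
  positive_lift u * positive_lift (u^-1 * longest) = positive_lift longest.
Proof.
rewrite -lift_mul mulKVg // ell_longest.
by have := ell_mul_longest u^-1; rewrite ell_inv addnC.
Qed.

Lemma class_of_inv (i : 'I_n) : class_of [:: (true, i)] = (gen i)^-1.
Proof.
apply: (mulgI (gen i)); rewrite mulgV -[LHS]/(braid_mul _ _) /gen braid_mulE.
exact/class_ofP/BraidCancel.
Qed.

Lemma braid_ind (P : braid n -> Prop) : P 1 ->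
  (forall i g, P g -> P (gen i * g)) ->
  (forall i g, P g -> P ((gen i)^-1 * g)) -> forall g, P g.
Proof.
move=> P1 Pg PV g; rewrite -(class_ofK g); elim: (word_of g) => [//|[b i] u IH].
have -> : class_of ((b, i) :: u) = class_of [:: (b, i)] * class_of u.
  by rewrite -[RHS]/(braid_mul _ _) braid_mulE.
by case: b; rewrite ?class_of_inv; [apply: PV | apply: Pg].
Qed.

(** As [longest] is central in the group, removing [s_i] on the left or on the right leaves the same
    element, so that the lift is both [s_i X] and [X s_i]. *)
Lemma lift_longestC (g : braid n) : commute (positive_lift longest) g.
Proof.
have C (i : 'I_n) : commute (positive_lift longest) (gen i).
  have kn : 0 < i.+1 <= n by exact: ltn_ord.
  have E := lift_mul_longest (sg n i.+1); rewrite sgV lift_sg // in E.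
  have d : ~~ desc (sg n i.+1 * longest) i.+1.
    have [d|//] := boolP (desc _ _); have := ell_desc kn d.
    have := ell_mul_longest (sg n i.+1); rewrite ell_sg //.
    by rewrite -mulgA longestC mulgA sgK mul1g ell_longest; lia.
  have := lift_asc kn d; rewrite -mulgA longestC mulgA sgK mul1g => E'.
  by rewrite /commute -(letterE (@gen n)) -/(bg _) -{1}E E' mulgA.
elim/braid_ind: g => [|i g IH|i g IH]; first exact: commute1.
  exact: commuteM.
by apply: commuteM => //; apply: commuteV.
Qed.

End PositiveLift.

(** * The conjugacy class of [delta ^+ p] for [p < n] *)

Section Words.
Variables (G : groupType) (s : nat -> G).
Implicit Types (a b c i : nat).

(** [dn a b = s_b ... s_(a+1)] and [up a b = s_(a+1) ... s_b]. *)
Definition dn a b := \prod_(i <- rev (iota a.+1 (b - a))) s i.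
Definition up a b := \prod_(i <- iota a.+1 (b - a)) s i.

Lemma dn_nil a b : b <= a -> dn a b = 1.
Proof. by rewrite /dn -subn_eq0 => /eqP->; rewrite big_nil. Qed.

Lemma up_nil a b : b <= a -> up a b = 1.
Proof. by rewrite /up -subn_eq0 => /eqP->; rewrite big_nil. Qed.

Lemma up_cat a b c : a <= b <= c -> up a c = up a b * up b c.
Proof.
move=> /andP[ab bc]; rewrite /up -big_cat /=.
by rewrite (_ : c - a = (b - a) + (c - b)); [rewrite iotaD addSn subnKC|lia].
Qed.

Lemma dn_cat a b c : a <= b <= c -> dn a c = dn b c * dn a b.
Proof.
move=> /andP[ab bc]; rewrite /dn -big_cat -rev_cat /=.
by rewrite (_ : c - a = (b - a) + (c - b)); [rewrite iotaD addSn subnKC|lia].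
Qed.

Lemma dn1 a : dn a a.+1 = s a.+1.
Proof. by rewrite /dn subSnn big_seq1. Qed.

Lemma up1 a : up a a.+1 = s a.+1.
Proof. by rewrite /up subSnn big_seq1. Qed.

Lemma dnS a b : a <= b -> dn a b.+1 = s b.+1 * dn a b.
Proof. by move=> ab; rewrite (@dn_cat a b) ?ab ?leqnSn // dn1. Qed.

Lemma upS a b : a <= b -> up a b.+1 = up a b * s b.+1.
Proof. by move=> ab; rewrite (@up_cat a b) ?ab ?leqnSn // up1. Qed.

Lemma dn_first a b : a < b -> dn a b = dn a.+1 b * s a.+1.
Proof. by move=> ab; rewrite (@dn_cat a a.+1) ?leqnSn // dn1. Qed.

Lemma up_first a b : a < b -> up a b = s a.+1 * up a.+1 b.
Proof. by move=> ab; rewrite (@up_cat a a.+1) ?leqnSn // up1. Qed.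

Lemma commute_dn x a b :
  (forall i, a < i <= b -> commute x (s i)) -> commute x (dn a b).
Proof.
move=> H; rewrite /dn big_seq; apply: commute_prod => i.
by rewrite mem_rev mem_iota => /andP[ai ib]; apply: H; lia.
Qed.

Lemma commute_up x a b :
  (forall i, a < i <= b -> commute x (s i)) -> commute x (up a b).
Proof.
move=> H; rewrite /up big_seq; apply: commute_prod => i.
by rewrite mem_iota => /andP[ai ib]; apply: H; lia.
Qed.

End Words.

(** * Commuting lifts of the sign changes *)

Section TypeB.
Variable n : nat.
Local Notation s := (bg n).
Local Notation dn := (dn (bg n)).
Local Notation up := (up (bg n)).
Implicit Types (a b i k l : nat).

Lemma commute_s_dn i a b : i < a \/ b.+1 < i -> commute (s i) (dn a b).
Proof.
move=> H; apply: commute_dn => j /andP[aj jb]; case: H => H.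
  by apply: bg_far; lia.
by apply/commute_sym/bg_far; lia.
Qed.

Lemma commute_s_up i a b : i < a \/ b.+1 < i -> commute (s i) (up a b).
Proof.
move=> H; apply: commute_up => j /andP[aj jb]; case: H => H.
  by apply: bg_far; lia.
by apply/commute_sym/bg_far; lia.
Qed.

(** The letters of [dn a b] far from [i] commute with what passes them, and the middle is
    [s_i s_(i-1) s_i = s_(i-1) s_i s_(i-1)]; the condition [2 < i] avoids the relation of length
    4. *)
Lemma dn_shift i a b : a.+1 < i <= b -> 2 < i -> b <= n ->
  dn a b * s i = s i.-1 * dn a b.
Proof.
move=> /andP[ai ib] i2 bn.
rewrite (@dn_cat _ _ a i b) ?ib ?andbT; last lia.
rewrite -!mulgA.
have -> : s i.-1 * (dn i b * dn a i) = dn i b * (s i.-1 * dn a i).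
  by rewrite !mulgA; congr (_ * _); apply: commute_s_dn; lia.
congr (_ * _).
case: i ai ib i2 => // -[|i] // ai ib i2.
rewrite !dnS; try lia; rewrite /= !mulgA bg_braid3; last lia.
rewrite -!mulgA; do 2!congr (_ * _).
by apply/esym/commute_s_dn; lia.
Qed.

Lemma up_shift i a b : a.+1 < i <= b -> 2 < i -> b <= n ->
  s i * up a b = up a b * s i.-1.
Proof.
move=> /andP[ai ib] i2 bn.
rewrite (@up_cat _ _ a i b) ?ib ?andbT; last lia.
rewrite -[RHS]mulgA -(@commute_s_up i.-1 i b) ?[RHS]mulgA ?[LHS]mulgA; last lia.
congr (_ * _).
case: i ai ib i2 => // -[|i] // ai ib i2.
rewrite !upS; try lia; rewrite /= -!mulgA (mulgA (s i.+1)) bg_braid3; last lia.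
rewrite !mulgA; congr (_ * _ * _ ).
by apply/commute_s_up; lia.
Qed.

(** Lift of the sign change of the entry [l]; these lifts commute. *)
Definition Y l : braid n := locked (dn 0 l * up 1 l).

Lemma YE l : Y l = dn 0 l * up 1 l.
Proof. by rewrite /Y -lock. Qed.

Lemma Y1 : Y 1 = s 1.
Proof. by rewrite YE dn1 up_nil ?mulg1. Qed.

Lemma YS l : 0 < l -> Y l.+1 = s l.+1 * Y l * s l.+1.
Proof. by move=> l0; rewrite !YE dnS // upS // !mulgA. Qed.

Lemma commute_s_Y_far i l : l.+1 < i -> commute (s i) (Y l).
Proof. by move=> li; rewrite YE; apply: commuteM;
  [apply: commute_s_dn|apply: commute_s_up]; right. Qed.

(** For [i > 1], [s_i] crosses [dn 0 l] as [s_(i+1)] and comes back to [s_i] across [up 1 l]. For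
    [i = 1], induction on [l] starts at [Y 2 = s_2 s_1 s_2], where the claim is the relation of
    length 4. *)
Lemma commute_s_Y i l : 0 < i < l -> l <= n -> commute (s i) (Y l).
Proof.
move=> /andP[i0 il] ln; have [ei|i1] := eqVneq i 1%N; last first.
  have := @dn_shift i.+1 0 l; have := @up_shift i.+1 1 l => /= h1 h2.
  by rewrite /commute YE mulgA -h2 ?[in LHS]mulgA -?[in LHS]mulgA ?h1 ?mulgA //; lia.
rewrite {i}ei in il {i0} *; elim: l ln il => // l IH ln l1; move: IH ln l1;
  case: l => [|[|l]] // IH ln _.
  by rewrite YS // Y1 /commute !mulgA bg_braid4 //.
rewrite YS //; have c : commute (s 1) (s l.+3) by apply: bg_far.
by do 2?apply: commuteM => //; apply: IH => //; lia.
Qed.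

Lemma commute_YY k l : k <= n -> l <= n -> commute (Y k) (Y l).
Proof.
wlog kl : k l / k <= l.
  by move=> H kn ln; have [/H|/ltnW/H h] := leqP k l; [apply|apply/commute_sym/h].
move=> kn ln; have [->|nkl] := eqVneq k l; first exact: commute_refl.
by rewrite {1}YE; apply/commute_sym/commuteM; [apply: commute_dn | apply: commute_up] => i ik;
  apply/commute_sym/commute_s_Y; lia.
Qed.

(** Lift of the longest element of the subgroup of type [B_l]. *)
Definition Del l : braid n := \prod_(1 <= i < l.+1) Y i.

Lemma DelS l : Del l.+1 = Del l * Y l.+1.
Proof. by rewrite /Del big_nat_recr. Qed.

Lemma commute_s_Del_far i l : l.+1 < i -> commute (s i) (Del l).
Proof.
move=> li; rewrite /Del big_seq; apply: commute_prod => j.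
by rewrite mem_index_iota => jl; apply: commute_s_Y_far; lia.
Qed.

(** The new case is [i = l]: since [Y l = s_l (Y l.-1) s_l] commutes with [Y l.-1], both
    [s_l (Y l.-1) (Y l)] and [(Y l.-1) (Y l) s_l] equal [s_l (Y l.-1) s_l (Y l.-1) s_l]. *)
Lemma commute_s_Del i l : 0 < i <= l -> l <= n -> commute (s i) (Del l).
Proof.
elim: l => [|l IH] il ln; first lia.
have [il'|li] := leqP i l.
  by rewrite DelS; apply: commuteM; [apply: IH|apply: commute_s_Y]; lia.
have {il li} -> : i = l.+1 by lia.
case: l IH ln => [|l] _ ln; first by rewrite /Del big_nat1 Y1; apply: commute_refl.
rewrite 2!DelS -mulgA; apply: commuteM; first exact: commute_s_Del_far.
have c : commute (Y l.+1) (Y l.+2) by apply: commute_YY; lia.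
transitivity (s l.+2 * Y l.+1 * s l.+2 * Y l.+1 * s l.+2); last by rewrite c (@YS l.+1).
by rewrite (@YS l.+1) // !mulgA.
Qed.

End TypeB.

Section Conjugacy.
Variable G : groupType.
Implicit Types x y z g : G.

Definition conjugate x y := exists g, g * x * g^-1 = y.

Lemma conjugate_refl x : conjugate x x.
Proof. by exists 1; rewrite mul1g invg1 mulg1. Qed.

Lemma conjugate_trans y x z : conjugate x y -> conjugate y z -> conjugate x z.
Proof. by case=> g <- [h <-]; exists (h * g); rewrite invgM !mulgA. Qed.

Lemma conjugate_mulC x y : conjugate (x * y) (y * x).
Proof. by exists x^-1; rewrite invgK mulKg. Qed.

End Conjugacy.

(** * Nesting the factors [Y (l j)] around [delta] *)

Section Nest.
Variables (n q : nat) (l : nat -> nat).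
Hypothesis l_gt0 : 0 < l 1.
Hypothesis l_lt : forall j, 0 < j <= q -> l j < l j.+1.
Hypothesis l_last : l q.+1 = n.
Local Notation s := (bg n).
Local Notation dn := (dn (bg n)).
Local Notation up := (up (bg n)).
Local Notation Y := (Y n).
Local Notation Del := (Del n).

Lemma l_ltn j k : 0 < j < k -> k <= q.+1 -> l j < l k.
Proof.
case/andP => j0; elim: k => // k IH; rewrite ltnS leq_eqVlt => /orP[/eqP<-|jk] kq.
  by apply: l_lt; lia.
by apply: ltn_trans (IH jk _) (l_lt _); lia.
Qed.

Lemma l_leq j k : 0 < j <= k -> k <= q.+1 -> l j <= l k.
Proof.
move=> jk kq; have [->//|njk] := eqVneq j k.
by apply/ltnW/l_ltn; lia.
Qed.

Lemma l_pos j : 0 < j <= q.+1 -> 0 < l j.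
Proof. by move=> jq; apply: leq_trans l_gt0 (l_leq _ _); lia. Qed.

Lemma l_le_n j : 0 < j <= q.+1 -> l j <= n.
Proof. by move=> jq; rewrite -l_last; apply: l_leq; lia. Qed.

(** What one step of the nesting leaves behind: the segment of [delta] between two consecutive
    [l j], followed by the factor that stood at its lower end. *)
Definition block j := dn (l j) (l j.+1) * Y (l j).
Definition Yprod m : braid n := \prod_(1 <= j < m.+1) Y (l j).
Definition blocks a b : braid n := \prod_(a.+1 <= j < b.+1) block j.

Lemma commute_Y_Del k m : k <= n -> m <= n -> commute (Y k) (Del m).
Proof.
move=> kn mn; rewrite /Del big_seq; apply: commute_prod => i.
by rewrite mem_index_iota => im; apply: commute_YY => //; lia.
Qed.

Lemma commute_Yprod x m : (forall j, 0 < j <= m -> commute x (Y (l j))) -> commute x (Yprod m).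
Proof.
by move=> H; rewrite /Yprod big_seq; apply: commute_prod => i;
  rewrite mem_index_iota => im; apply: H; lia.
Qed.

Lemma commute_blocks x a b :
  (forall j, a < j <= b -> commute x (block j)) -> commute x (blocks a b).
Proof.
by move=> H; rewrite /blocks big_seq; apply: commute_prod => i;
  rewrite mem_index_iota => im; apply: H; lia.
Qed.

Lemma commute_s_block i j : 0 < j <= q -> 0 < i < l j -> commute (s i) (block j).
Proof.
move=> jq il; apply: commuteM; first by apply: commute_s_dn; lia.
by apply: commute_s_Y => //; apply: l_le_n; lia.
Qed.

(** [dn 0 m] commutes with [Del m], which is [Del m.-1 * Y m]. *)
Lemma dn_conj_Del m : 0 < m <= n -> (Del m.-1)^-1 * dn 0 m * Del m.-1 = Y m * dn 0 m * (Y m)^-1.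
Proof.
case: m => // m mn /=.
have c : commute (dn 0 m.+1) (Del m.+1).
  by apply/commute_sym/commute_dn => i im; apply/commute_sym/commute_s_Del; lia.
rewrite DelS in c; apply: (mulgI (Del m)); apply: (mulIg (Y m.+1)).
by rewrite -!mulgA c mulVg mulg1 !mulgA mulgV mul1g.
Qed.

(** Conjugation by [Del (l m).-1] moves [Y (l m)] to the left of [dn 0 (l m)]
    and fixes the other factors. *)
Lemma nest_step m : 0 < m <= q ->
  conjugate (dn 0 (l m.+1) * Yprod m * blocks m q)
            (dn 0 (l m) * Yprod m.-1 * blocks m.-1 q).
Proof.
case: m => // m mq /=; set L := l m.+1; set E := Del L.-1.
have L0 : 0 < L by apply: l_pos; lia.
have Ln : L <= n by apply: l_le_n; lia.
have sE i : L < i -> commute E (s i).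
  by move=> Li; apply/commute_sym/commute_s_Del_far; lia.
have cED j : m < j -> j <= q -> commute E (dn (l j) (l j.+1)).
  move=> mj jq; apply: commute_dn => i ij; apply: sE; apply: leq_ltn_trans (_ : l j < i); last lia.
  by apply: l_leq; lia.
have cEY j : 0 < j <= q -> commute E (Y (l j)).
  by move=> jq; apply/commute_sym/commute_Y_Del; [apply: l_le_n|]; lia.
have cEB : commute E (blocks m.+1 q).
  apply: commute_blocks => j jq; apply: commuteM; [apply: cED|apply: cEY]; lia.
have cEP : commute E (Yprod m.+1).
  by apply: commute_Yprod => j jm; apply: cEY; lia.
have YprodS : Yprod m.+1 = Yprod m * Y L by rewrite /Yprod big_nat_recr.
have cYP : commute (Y L) (Yprod m).
  by apply: commute_Yprod => j jm; apply: commute_YY => //; apply: l_le_n; lia.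
set T := dn 0 L * Yprod m; set D := dn L (l m.+2).
have cTB : commute T (blocks m.+1 q).
  apply: commute_blocks => j jq; have lj : L < l j by apply: l_ltn; lia.
  apply/commute_sym/commuteM.
    by apply: commute_dn => i iL; apply/commute_sym/commute_s_block; lia.
  apply: commute_Yprod => k km; have lk : l k < L by apply: l_ltn; lia.
  by rewrite YE; apply: commuteM; [apply: commute_dn | apply: commute_up] => i ik;
    apply/commute_sym/commute_s_block; lia.
have E1 : E^-1 * (dn 0 (l m.+2) * Yprod m.+1 * blocks m.+1 q) * E^-1^-1 =
          D * Y L * (T * blocks m.+1 q).
  have -> : dn 0 (l m.+2) = D * dn 0 L.
    by apply: dn_cat; apply: ltnW; apply: l_lt; lia.
  rewrite invgK -!mulgA -cEB (mulgA (Yprod _)) -cEP.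
  have := commuteV (commute_sym (cED m.+1 (ltnSn m) _)) => /(_ ltac:(lia)) cD.
  rewrite !mulgA -cD -!mulgA; congr (_ * _).
  rewrite (mulgA _ E) (mulgA (dn 0 L)) (mulgA E^-1) (mulgA E^-1) dn_conj_Del ?L0 //.
  by rewrite -!mulgA; congr (_ * _); rewrite YprodS -cYP !mulgA /T mulgVK.
apply: (@conjugate_trans _ (D * Y L * (T * blocks m.+1 q))); first by exists E^-1.
(* [T] commutes with the later blocks, so a cyclic rotation brings it to the front; the factor
   [D * Y L] that stays is the new block. *)
rewrite cTB mulgA; apply: conjugate_trans (conjugate_mulC _ _) _.
rewrite /blocks (big_ltn (m := m.+1)); last lia.
exact: conjugate_refl.
Qed.

Lemma nest_conj m : m <= q ->
  conjugate (dn 0 (l m.+1) * Yprod m * blocks m q) (dn 0 (l 1) * blocks 0 q).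
Proof.
elim: m => [|m IH] mq.
  by rewrite /Yprod big_geq // mulg1; apply: conjugate_refl.
by apply: conjugate_trans (nest_step _) (IH _); lia.
Qed.

(** The two halves of the [Y (l j)], split before or after [s_1] according to the parity of [j].
    They will turn out to be the lifts of [x^-1] and [x]. *)
Definition nest_dn m : braid n := \prod_(1 <= j < m.+1) dn (~~ odd j) (l j).
Definition nest_up m : braid n := \prod_(j <- rev (index_iota 1 m.+1)) up (~~ odd j) (l j).

Lemma dn_up_Y (b : bool) k : 0 < k -> dn b k * up (~~ b) k = Y k.
Proof.
case: b => //= k0; rewrite YE (@dn_first _ _ 0 k) // (@up_first _ _ 0 k) //.
by rewrite mulgA.
Qed.

Lemma nest_up_recr m : nest_up m.+1 = up (odd m) (l m.+1) * nest_up m.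
Proof.
have E : index_iota 1 m.+2 = rcons (index_iota 1 m.+1) m.+1.
  by rewrite /index_iota !subn1 -[m.+2.-1]addn1 iotaD cats1.
by rewrite /nest_up E rev_rcons big_cons /= negbK.
Qed.

(** The middle word splits at [l m.+1]. Its lower part and the new half [up (odd m) (l m.+1)] form
    [Y (l m.+1)], and the resulting block commutes with [nest_up m], whose letters are all smaller
    than [l m.+1]. *)
Lemma nest_dnup m : m <= q ->
  nest_dn m * dn (odd m) (l m.+1) * nest_up m = dn 0 (l 1) * blocks 0 m.
Proof.
elim: m => [|m IH] mq.
  by rewrite /nest_dn /nest_up /blocks !big_geq // big_nil mul1g mulg1.
rewrite nest_up_recr.
have L0 : 0 < l m.+1 by apply: l_pos; lia.
have -> : nest_dn m.+1 = nest_dn m * dn (odd m) (l m.+1).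
  by rewrite /nest_dn big_nat_recr //= negbK.
have -> : dn (odd m.+1) (l m.+2) = dn (l m.+1) (l m.+2) * dn (odd m.+1) (l m.+1).
  by apply: dn_cat; have := l_lt (j := m.+1); case: (odd _) => /=; lia.
have cU : commute (nest_up m) (block m.+1).
  apply/commute_sym; rewrite /nest_up big_seq; apply: commute_prod => j.
  rewrite mem_rev mem_index_iota => jm; apply: commute_up => i ij.
  apply/commute_sym/commute_s_block; first lia.
  have := l_ltn (j := j) (k := m.+1); lia.
have -> : blocks 0 m.+1 = blocks 0 m * block m.+1 by rewrite /blocks big_nat_recr.
rewrite [RHS]mulgA -IH; last lia.
rewrite -[RHS]mulgA cU /block -(@dn_up_Y (odd m.+1)) //= negbK.
by rewrite !mulgA.
Qed.

Lemma conjugate_nest : ~~ odd q ->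
  conjugate (dn 0 n * Yprod q) (nest_dn q * dn 0 n * nest_up q).
Proof.
move=> oq; have := nest_dnup (leqnn q); rewrite (negPf oq) l_last => ->.
by have := nest_conj (leqnn q); rewrite l_last /blocks big_geq // mulg1.
Qed.

End Nest.

Section WordAction.
Variable n : nat.
Local Notation s := (sg n).
Implicit Types (a b m : nat).

Lemma act_dn a b m : 0 < a <= b -> b <= n ->
  act (dn s a b) (Posz m) = Posz (if m == a then b else if a < m <= b then m.-1 else m).
Proof.
move=> /andP[a0 ab] bn; elim: b ab bn => [|b IH] ab bn; first lia.
have [eab|nab] := eqVneq a b.+1.
  by rewrite -eab dn_nil // act1; congr Posz; do !(case: ifP); lia.
have {nab} ab' : a <= b by lia.
rewrite dnS // actM IH ?act_sg; try lia.
by congr Posz; do !(case: ifP); lia.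
Qed.

Lemma act_dn0 b m : 0 < b <= n ->
  act (dn s 0 b) (Posz m) =
  if m == 1%N then (- Posz b)%R else Posz (if 1 < m <= b then m.-1 else m).
Proof.
move=> bn; rewrite (@dn_first _ _ 0 b); last lia.
rewrite actM act_sg1; last lia.
rewrite absz_nat; case: ifP => m1; first by rewrite actN act_dn ?m1; lia.
by rewrite act_dn ?m1; lia.
Qed.

Lemma up_dn_inv a b : up s a b = (dn s a b)^-1.
Proof.
rewrite /up /dn -[in RHS](revK (iota _ _)) -prodgV revK; apply: eq_bigr => i _.
by rewrite sgV.
Qed.

Lemma act_up a b m : 0 < a <= b -> b <= n ->
  act (up s a b) (Posz m) = Posz (if m == b then a else if a <= m < b then m.+1 else m).
Proof.
move=> ab bn; apply: (@act_inj _ (dn s a b)); rewrite -actM up_dn_inv mulgV act1.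
by rewrite act_dn //; congr Posz; do !(case: ifP); lia.
Qed.

Lemma act_up0 b m : 0 < b <= n ->
  act (up s 0 b) (Posz m) =
  if m == b then (- 1)%R else Posz (if 1 <= m < b then m.+1 else m).
Proof.
move=> bn; apply: (@act_inj _ (dn s 0 b)); rewrite -actM up_dn_inv mulgV act1.
case: eqP => [->|mb]; first by rewrite -[(-1)%R]/(- Posz 1)%R actN act_dn0 // eqxx opprK.
by rewrite act_dn0 //; do !(case: ifP); lia.
Qed.

Lemma proj_dn a b : proj (dn (bg n) a b) = dn s a b.
Proof. by rewrite /dn gmulf_prod; apply: eq_bigr => i _; apply: proj_bg. Qed.

End WordAction.

(** * Positive lifts along the words [dn] and [up] *)

Section Slide.
Variable n : nat.
Local Notation s := (sg n).
Local Notation B := (@positive_lift n).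
Implicit Types (w z : sperm n) (a b j k m : nat).

Lemma lift_asc_left w k : 0 < k <= n -> ~~ desc w^-1 k -> B (s k * w) = bg n k * B w.
Proof.
move=> kn d; rewrite lift_mul ?lift_sg // ell_sg // -ell_inv invgM sgV.
by rewrite (ell_asc kn d) ell_inv add1n.
Qed.

Lemma lift_dn_desc z a b : a <= b <= n ->
  (forall j, a < j <= b -> desc (z * dn s j b) j) ->
  B z = B (z * dn s a b) * up (bg n) a b.
Proof.
move=> /andP[ab bn] H; suff E k : k <= b - a -> B z = B (z * dn s (b - k) b) * up (bg n) (b - k) b.
  by have := E _ (leqnn _); rewrite subKn.
elim: k => [|k IH] kba; first by rewrite subn0 dn_nil // up_nil // !mulg1.
have [j jE] : exists j, b - k = j.+1 by exists (b - k.+1); lia.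
have -> : b - k.+1 = j by lia.
rewrite IH ?jE; last lia.
rewrite (lift_desc (k := j.+1) (w := z * dn s j.+1 b)); last first.
- by apply: H; lia.
- lia.
have jb : j < b by lia.
by rewrite (dn_first _ jb) (up_first _ jb) !mulgA.
Qed.

Lemma lift_dn_asc z a b : a <= b <= n ->
  (forall j, a < j <= b -> ~~ desc (z * dn s j b) j) ->
  B (z * dn s a b) = B z * dn (bg n) a b.
Proof.
move=> /andP[ab bn] H; suff E k : k <= b - a -> B (z * dn s (b - k) b) = B z * dn (bg n) (b - k) b.
  by have := E _ (leqnn _); rewrite subKn.
elim: k => [|k IH] kba; first by rewrite subn0 !dn_nil // !mulg1.
have [j jE] : exists j, b - k = j.+1 by exists (b - k.+1); lia.
have -> : b - k.+1 = j by lia.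
rewrite !(@dn_first _ _ j); try lia.
rewrite mulgA lift_asc; last first.
- by apply: H; lia.
- lia.
by rewrite -jE IH ?mulgA //; lia.
Qed.

Lemma lift_up_desc z a b : a <= b <= n ->
  (forall j, a <= j < b -> desc (z * up s a j) j.+1) ->
  B z = B (z * up s a b) * dn (bg n) a b.
Proof.
move=> /andP[ab bn]; elim: b ab bn => [|b IH] ab bn H.
  by rewrite up_nil // dn_nil // !mulg1.
have [eab|nab] := eqVneq a b.+1; first by rewrite eab up_nil // dn_nil // !mulg1.
have ab' : a <= b by lia.
rewrite IH ?(ltnW bn) //; last by move=> j aj; apply: H; lia.
rewrite (lift_desc (k := b.+1) (w := z * up s a b)); last first.
- by apply: H; lia.
- lia.
by rewrite dnS // upS // !mulgA.
Qed.

(** If [w] has no signs and [w' i = w i - 1], where [0] is read as [n], then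
    both [delta * B w] and [B w' * Y k] are the lift of [c * w]. *)
Lemma delta_lift w w' k : 0 < k <= n -> act w (Posz k) = Posz 1 ->
  (forall m, 0 < m <= n -> (0 < act w (Posz m))%R) ->
  (forall m, 0 < m <= n -> m <> k -> act w' (Posz m) = (act w (Posz m) - 1)%R) ->
  act w' (Posz k) = Posz n ->
  dn (bg n) 0 n * B w = B w' * Y n k.
Proof.
move=> kn wk wpos w'E w'k.
have [v vE] : exists v, v = w^-1 by exists w^-1.
have winv m : 0 < m <= n -> (0 < act v (Posz m))%R.
  rewrite vE.
  move=> mn; have [x [xn xE]] : exists x : int, (0 < `|x| <= n)%N /\ act w^-1 (Posz m) = x.
    by exists (act w^-1 (Posz m)); split => //; apply: act_range.
  have := actKV w (Posz m); rewrite xE.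
  case: x xn {xE} => x xn; first by move=> _; lia.
  by rewrite NegzE actN => E; have := wpos x.+1; lia.
(* After [s_b ... s_1], the inverse has a negative value at [b] and a positive one at [b + 1], so
   that [s_(b+1)] on the left increases the length. *)
have left b : b <= n -> B (dn s 0 b * w) = dn (bg n) 0 b * B w.
  elim: b => [|b IH] bn; first by rewrite !dn_nil // !mul1g.
  rewrite !dnS // -!mulgA lift_asc_left ?IH ?(ltnW bn) //.
  rewrite invgM -up_dn_inv -vE /desc.
  have w1 := winv b.+1 ltac:(lia); have w2 := winv 1%N ltac:(lia).
  case: ifP => [/eqP[b0]|b1]; first by rewrite b0 up_nil // mulg1; lia.
  rewrite !actM /= !act_up0; try lia.
  rewrite eqxx [b.+1 == b]gtn_eqF // ifF; last lia.
  by rewrite -[(-1)%R]/(- Posz 1)%R actN; lia.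
rewrite -left //; set z := dn s 0 n * w.
have zE m : 0 < m <= n -> act z (Posz m) = if m == k then (- Posz n)%R else (act w (Posz m) - 1)%R.
  move=> mn; rewrite /z actM; have := wpos m mn; have := act_range w mn.
  case: eqP => [->|mk]; first by rewrite wk act_dn0 //; lia.
  have : act w (Posz m) <> Posz 1 by rewrite -wk => /act_inj[].
  case: (act w _) => [x|] x1 xn x0; last lia.
  by rewrite act_dn0; [rewrite ifF; [case: ifP|] |]; lia.
clearbody z; have zbig m : 0 < m <= n -> m <> k -> (0 <= act z (Posz m) < Posz n)%R.
  move=> mn mk; rewrite zE // ifF; last lia.
  have := wpos m mn; have := act_range w mn; lia.
have zk : act z (Posz k) = (- Posz n)%R by rewrite zE // eqxx.
(* The entry [-n] at the position [k] is the least one: descents carry it to the position 1 and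
   remove its sign. The entry [n] is then the largest, and descents carry it back to [k]. The
   letters removed compose [Y k]. *)
have d1 : B z = B (z * dn s 0 k) * up (bg n) 0 k.
  apply: lift_dn_desc => [|j jk]; first lia.
  rewrite /desc; case: ifP => [/eqP->|j1].
    by rewrite actM act_dn ?eqxx ?zk; lia.
  rewrite !actM !act_dn; try lia.
  rewrite eqxx zk ifF; last lia.
  rewrite ifF; last lia.
  by have := zbig j.-1; lia.
have d2 : B (z * dn s 0 k) = B (z * dn s 0 k * up s 1 k) * dn (bg n) 1 k.
  apply: lift_up_desc => [|j jk]; first lia.
  rewrite /desc ifF; last lia.
  rewrite /= !actM !act_up; try lia.
  rewrite eqxx [j.+1 == j]gtn_eqF // ifF; last lia.
  rewrite !act_dn0 // eqxx actN zk ifF; last lia.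
  rewrite ifT; last lia.
  by have := zbig j; rewrite /=; lia.
rewrite d1 d2 -mulgA (@dn_up_Y n true); last lia.
congr (B _ * _); apply: act_eq => m mn.
rewrite !actM act_up; try lia.
have [->|mk] := eqVneq m k.
  by rewrite w'k act_dn0 // eqxx actN zk opprK.
rewrite w'E //; last exact/eqP.
rewrite act_dn0 // ifF; last by case: ifP; lia.
have -> : (if 1 < (if 1 <= m < k then m.+1 else m) <= k
   then (if 1 <= m < k then m.+1 else m).-1 else if 1 <= m < k then m.+1 else m) = m.
  by do !(case: ifP); lia.
by rewrite zE // (negPf mk).
Qed.

End Slide.

(** * Arithmetic progressions modulo [n] *)

Section Progression.
Variables n p : nat.
Hypothesis n_gt0 : 0 < n.
Hypothesis pn : coprime p n.
Local Notation B := (@positive_lift n).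
Implicit Types (i j k : nat).

(** [residue j k + 1] is congruent to [p * k - j] modulo [n]. *)
Definition residue j k := (p * k + (n - 1) * j.+1) %% n.

Lemma residue_inj j i k : 0 < i <= n -> 0 < k <= n -> residue j i = residue j k -> i = k.
Proof.
wlog ik : i k / i <= k.
  move=> H i0 k0 E; have [ik|/ltnW ki] := leqP i k; first exact: H.
  by apply/esym/H.
move=> i0 k0 /eqP; rewrite /residue eqn_modDr eq_sym eqn_mod_dvd; last by rewrite leq_mul2l ik orbT.
rewrite -mulnBr Gauss_dvdr 1?coprime_sym // => /dvdnP[[|q] E]; first lia.
have : n <= k - i by rewrite E leq_pmull.
lia.
Qed.

Lemma modn_pred (x : nat) : (x + (n - 1)) %% n = if x %% n == 0 then n.-1 else (x %% n).-1.
Proof.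
rewrite {1}(divn_eq x n) -addnA modnMDl; have := ltn_pmod x n_gt0.
case: eqP => [->|] rn; first by rewrite add0n subn1 modn_small //; lia.
move=> h; have -> : x %% n + (n - 1) = (x %% n).-1 + n by lia.
by rewrite modnDr modn_small; lia.
Qed.

Lemma residueS j k : residue j.+1 k = if residue j k == 0 then n.-1 else (residue j k).-1.
Proof. by rewrite /residue -modn_pred -addnA -mulnSr. Qed.

Lemma ex_progression : exists P : nat -> sperm n,
  forall j k, 0 < k <= n -> act (P j) (Posz k) = Posz (residue j k).+1.
Proof.
have rn j k : residue j k < n by rewrite ltn_pmod.
have f_inj j : injective (fun i : 'I_n => Ordinal (rn j i.+1)).
  move=> i k [] E; apply/val_inj/succn_inj.
  by apply: residue_inj E; rewrite ltn_ord.
exists (fun j => (perm (f_inj j), [ffun=> false])) => j k /ord_of[i ->].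
by rewrite act_ord /oneline ffunE permE mul1r.
Qed.

Lemma prod_perm_commute (G : groupType) (I : eqType) (F : I -> G) (r t : seq I) :
  (forall i j : I, i \in r -> j \in r -> commute (F i) (F j)) -> perm_eq r t ->
  \prod_(i <- r) F i = \prod_(i <- t) F i.
Proof.
elim: r t => [|x r IH] t C.
  by move/perm_size/esym/size0nil->.
move=> E; have xt : x \in t by rewrite -(perm_mem E) mem_head.
case/splitPr: xt E => t1 t2 E.
have E' : perm_eq r (t1 ++ t2).
  by rewrite -(perm_cons x); apply: perm_trans E _; rewrite -cat1s perm_catCA.
rewrite big_cons (IH (t1 ++ t2)) //; last first.
  by move=> i j ir jr; apply: C; rewrite inE ?ir ?jr orbT.
have c : commute (F x) (\prod_(i <- t1) F i).
  rewrite big_seq; apply: commute_prod => i it; apply: C; rewrite ?mem_head //.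
  by rewrite inE (perm_mem E') mem_cat it orbT.
by rewrite !big_cat big_cons /= !mulgA c.
Qed.

(** Step [j] emits [Y n k] for the position [k] where the current value is 1. Values drop by one at
    each step until they reach 1, so a position with [residue 0 k = j] is met exactly at step [j],
    if not before the end [q]. *)
Lemma delta_power (q : nat) : exists (x : sperm n) (r : seq nat),
  [/\ size r = q,
      forall k, 0 < k <= n -> residue 0 k < q -> k \in r,
      forall k, k \in r -> 0 < k <= n,
      forall k, 0 < k <= n -> act x (Posz k) = Posz (residue 0 k).+1 &
      exists y : sperm n, (forall k, 0 < k <= n -> act y (Posz k) = Posz (residue q k).+1) /\
        dn (bg n) 0 n ^+ q * B x = B y * \prod_(k <- r) Y n k].
Proof.
have [P PE] := ex_progression; exists (P 0).
have rn j k : residue j k < n by rewrite ltn_pmod.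
have surj j : exists2 k, 0 < k <= n & residue j k = 0.
  have := @act_range n (P j)^-1 1 ltac:(lia); case E : (act _ _) => [k|k] kn.
    by have := actKV (P j) (Posz 1); rewrite E PE // => -[]; exists k.
  by have := actKV (P j) (Posz 1); rewrite E NegzE actN PE.
suff: exists r : seq nat, [/\ size r = q,
      forall k, 0 < k <= n -> residue 0 k < q -> k \in r,
      forall k, k \in r -> 0 < k <= n &
      dn (bg n) 0 n ^+ q * B (P 0) = B (P q) * \prod_(k <- r) Y n k].
  by case=> r [r1 r2 r3 r4]; exists r; split=> //; [apply: PE | exists (P q);
    split=> //; apply: PE].
have resE j k : j <= residue 0 k -> residue j k = residue 0 k - j.
  elim: j => [|j IH] jk; first by rewrite subn0.
  by rewrite residueS IH ?(ltnW jk) // ifF; lia.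
elim: q => [|q [r [r1 r2 r3 r4]]].
  by exists [::]; split=> //; rewrite expg0 big_nil mul1g mulg1.
have [k kn k0] := surj q; exists (k :: r); split=> [|m mn mq|m|].
- by rewrite /= r1.
- rewrite inE; have [mq'|qm] := ltnP (residue 0 m) q; first by rewrite r2 ?orbT.
  by rewrite (@residue_inj q m k) ?eqxx // k0 resE //; lia.
- by rewrite inE => /orP[/eqP->|/r3].
rewrite expgS -mulgA r4 mulgA big_cons mulgA; congr (_ * _).
apply: (delta_lift (k := k)) => //; first by rewrite PE // k0.
- by move=> m mn; rewrite PE.
- move=> m mn mk; have m0 : residue q m <> 0.
    by move=> m0; apply: mk; apply: (@residue_inj q) => //; rewrite m0.
  by rewrite !PE // residueS ifF; lia.
by rewrite PE // residueS k0 eqxx prednK.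
Qed.

End Progression.

Section Slopes.
Variables n p : nat.
Hypothesis p_gt0 : 0 < p.
Hypothesis p_lt : p < n.
Local Notation B := (@positive_lift n).
Implicit Types (j k : nat).

(** At [j = p] the value is [n], while the formula for [lambda_p] would give [n + 1]: the last
    segment has to end with [delta] itself. *)
Definition slope j := if j < p then lambda n p j else n.

Let pn : 0 < p <= n. Proof. by lia. Qed.

Lemma slope0 : slope 0 = 1%N.
Proof. by rewrite /slope p_gt0 /lambda muln0 div0n. Qed.

Lemma lambda_le k : k < p -> lambda n p k <= n.
Proof.
move=> kp; have : lambda n p k \in lambdas n p by apply: map_f; rewrite mem_iota.
by move/(lambdas_range pn); rewrite mem_iota; lia.
Qed.

Lemma slope_last : slope p.-1.+1 = n.
Proof. by rewrite prednK // /slope ltnn. Qed.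

Lemma lambda_lt_n k : k < p -> lambda n p k < n.
Proof.
move=> kp; rewrite /lambda; suff : (n * k) %/ p < n.-1 by lia.
rewrite ltn_divLR //; suff : n * k.+1 < n.-1 * p + n by rewrite mulnS; lia.
apply: (@leq_ltn_trans (n * p)); first by rewrite leq_mul2l; lia.
rewrite -{1}(prednK (n := n)) 1?mulSn; lia.
Qed.

Lemma slope_lt j : 0 < j <= p.-1 -> slope j < slope j.+1.
Proof.
move=> jp; rewrite /slope ifT; last lia.
by case: ifP => jp'; [apply: lambda_lt; lia | apply: lambda_lt_n; lia].
Qed.

Lemma slope_gt0 j : 0 < slope j.
Proof. by rewrite /slope; case: ifP => // _; lia. Qed.

Lemma slope_leq j : j <= p -> slope j <= n.
Proof. by rewrite leq_eqVlt /slope; case: ifP => // jp _; apply: lambda_le. Qed.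

Lemma slope_strict j k : j < k <= p -> slope j < slope k.
Proof.
move=> /andP[jk kp]; rewrite /slope ifT; last lia.
by case: ifP => kp'; [apply: lambda_lt | apply: lambda_lt_n]; lia.
Qed.

(** [p * lambda_k - 1 = k * n + (p - 1 - (n * k) %% p)]. *)
Lemma residue_lambda k : k < p -> residue n p 0 (lambda n p k) < p.
Proof.
move=> kp; have rp : (n * k) %% p < p by rewrite ltn_mod.
have E : p * lambda n p k + (n - 1) * 1 = (k.+1 * n) + (p - 1 - (n * k) %% p).
  have := divn_eq (n * k) p; rewrite /lambda mulnS (mulnC p) muln1 mulSn (mulnC k).
  by lia.
by rewrite /residue E modnMDl modn_small; lia.
Qed.

(** The [p] distinct [lambda_k] fill the list of the [p] emitted positions. After [p] steps,
    [w_p k = p (k - 1)] is [w_0] moved by one position, whence [B(w_p) = B(w_0) s_n ... s_2]; the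
    factor [Y 1 = s_1] of [lambda_0 = 1] completes [delta]. *)
Lemma delta_power_slopes : coprime p n ->
  conjugate (dn (bg n) 0 n ^+ p) (dn (bg n) 0 n * Yprod n slope p.-1).
Proof.
move=> cpn; have n0 : 0 < n by lia.
have [x [r [rp rin rrange xE [y [yE E]]]]] := delta_power n0 cpn p.
have perm : perm_eq (lambdas n p) r.
  have sub : {subset lambdas n p <= r}.
    move=> a al; have /mapP[k] := al; rewrite mem_iota => kp ak.
    have := lambdas_range pn al; rewrite mem_iota => an.
    by apply: rin; rewrite ?ak ?residue_lambda //; lia.
  have sz : size r <= size (lambdas n p) by rewrite rp size_lambdas.
  have [_ eqi] := uniq_min_size (lambdas_uniq pn) sub sz.
  apply: uniq_perm => //; first exact: lambdas_uniq.
  exact: leq_size_uniq (lambdas_uniq pn) sub sz.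
have -> : dn (bg n) 0 n * Yprod n slope p.-1 = dn (bg n) 1 n * \prod_(k <- r) Y n k.
  rewrite -(prod_perm_commute _ perm); last first.
    move=> i j /(lambdas_range pn) + /(lambdas_range pn); rewrite !mem_iota => il jl.
    by apply: commute_YY; lia.
  rewrite /lambdas big_map (_ : iota 0 p = 0 :: iota 1 p.-1); last by case: (p) p_gt0.
  rewrite big_cons (_ : lambda n p 0 = 1%N); last by rewrite /lambda muln0 div0n.
  rewrite Y1 (dn_first _ n0) mulgA /Yprod /index_iota subSS subn0; congr (_ * _).
  apply: eq_big_seq => i; rewrite mem_iota => ip; rewrite /slope ifT //; lia.
have yx : y = x * dn (sg n) 1 n.
  apply: act_eq => k kn; rewrite yE // actM act_dn; try lia.
  have res a : 0 < a <= n -> residue n p 0 a = (p * a + (n - 1)) %% n by rewrite /residue muln1.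
  have resp : residue n p p k = (p * k + (n - 1) + (n - 1) * p) %% n.
    by rewrite /residue mulnSr addnAC addnA.
  have pnE : (p + (n - 1) * p = p * n)%N by rewrite -mulSn subn1 prednK // mulnC.
  case: ifP => [/eqP k1|k1].
    rewrite xE ?res; try lia.
    by rewrite resp k1 muln1 addnAC pnE.
  rewrite ifT ?xE ?res; try lia.
  rewrite resp.
  have -> : (p * k = p + p * k.-1)%N by rewrite -mulnS prednK; lia.
  by rewrite addnAC (addnAC p) pnE -addnA modnMDl.
(* [x n = n] is the largest entry, so the letters of [dn 1 n], which move it to the left, are
   ascents. *)
have By : B y = B x * dn (bg n) 1 n.
  rewrite yx lift_dn_asc // => [|j jn]; first lia.
  rewrite /desc ifF; last lia.
  rewrite !actM !act_dn; try lia.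
  rewrite eqxx ifF; last lia.
  rewrite ifF; last lia.
  rewrite !xE; try lia.
  suff -> : residue n p 0 n = n.-1.
    by have : residue n p 0 j.-1 < n by [rewrite ltn_pmod]; lia.
  by rewrite /residue muln1 modnMDl modn_small; lia.
exists (B x)^-1; rewrite invgK -!mulgA E By -!mulgA mulKg //.
Qed.

End Slopes.

(** * The nest as the lift of [x_(n,p)] *)

Section SlopePermutation.
Variables n p : nat.
Hypothesis p_gt0 : 0 < p.
Hypothesis p_lt : p < n.
Local Notation B := (@positive_lift n).
Local Notation slope := (slope n p).
Implicit Types (j k m a : nat).

Let pn : 0 < p <= n. Proof. by lia. Qed.

Definition slope_perm m : sperm n :=
  \prod_(j <- rev (index_iota 1 m.+1)) up (sg n) (~~ odd j) (slope j).

Lemma slope_permS m : slope_perm m.+1 = up (sg n) (odd m) (slope m.+1) * slope_perm m.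
Proof.
have E : index_iota 1 m.+2 = rcons (index_iota 1 m.+1) m.+1.
  by rewrite /index_iota !subn1 -[m.+2.-1]addn1 iotaD cats1.
by rewrite /slope_perm E rev_rcons big_cons /= negbK.
Qed.

Definition larger m a := count (fun k => a < slope k) (iota 0 m.+1).

Lemma largerS m a : larger m.+1 a = larger m a + (a < slope m.+1).
Proof. by rewrite /larger -(addn1 m.+1) iotaD count_cat /= addn0. Qed.

Lemma larger_eq0 m a : m < p -> slope m <= a -> larger m a = 0.
Proof.
move=> mp ma; apply/eqP; rewrite -leqn0 leqNgt -has_count; apply/hasPn => k.
rewrite mem_iota => km; have [<-|nkm] := eqVneq m k; first lia.
have := @slope_strict n p p_gt0 p_lt k m; lia.
Qed.

Lemma larger_lt m a : m < p -> 0 < a -> (forall k, k <= m -> a <> slope k) -> a < slope m.+1 ->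
  a + larger m a < slope m.+1.
Proof.
elim: m => [|m IH] mp a0 na am.
  by have := na 0 (leqnn _); rewrite larger_eq0 ?addn0 // slope0 //; lia.
have [sa|as_] := leqP (slope m.+1) a; first by rewrite larger_eq0 ?addn0.
have := IH (ltnW mp) a0 (fun k km => na k (leqW km)) as_.
by rewrite largerS as_; have := @slope_strict n p p_gt0 p_lt m.+1 m.+2; lia.
Qed.

(** The factor of index [m.+1] raises by one the values between 1 and [slope m.+1 - 1], fixes the
    larger ones, and sends [slope m.+1], fixed so far, to 1 or -1 according to the parity. [larger]
    counts how often a free position is raised. *)
Lemma slope_permE m : m < p ->
  (forall k, k <= m -> act (slope_perm m) (Posz (slope k)) = ((-1) ^+ k * Posz (m.+1 - k))%R) /\
  (forall a, 0 < a <= n -> (forall k, k <= m -> a <> slope k) ->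
    act (slope_perm m) (Posz a) = Posz (a + larger m a)).
Proof.
elim: m => [|m IH] mp.
  rewrite /slope_perm /index_iota subnn big_nil; split=> [k|a an na]; rewrite act1.
    by rewrite leqn0 => /eqP->; rewrite (slope0 n p_gt0) mul1r.
  rewrite larger_eq0 ?addn0 // (slope0 n p_gt0); lia.
have [IHs IHf] := IH (ltnW mp).
have big k : k <= m -> m.+1 - k < slope m.+1.
  move=> km; suff: m.+1 < slope m.+1 by lia.
  elim: (m.+1) mp => [|j IHj] jp; first exact: slope_gt0.
  by have := IHj (ltnW jp); have := @slope_strict n p p_gt0 p_lt j j.+1; lia.
have sn : slope m.+1 <= n by apply: slope_leq => //; lia.
have odd_sign : ((-1) ^+ m.+1 = if odd m then 1 else -1 :> int)%R.
  by rewrite exprS -signr_odd; case: (odd m); rewrite ?expr1 ?mulrNN ?mulr1.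
have step v : 0 < v < slope m.+1 ->
    act (up (sg n) (odd m) (slope m.+1)) (Posz v) = Posz v.+1.
  by move=> vs; case: (odd m); [rewrite act_up|rewrite act_up0]; try lia;
    rewrite ifF ?ifT //; lia.
have nin : forall k, k <= m -> slope m.+1 <> slope k.
  by move=> k km; have := @slope_strict n p p_gt0 p_lt k m.+1; lia.
have top : act (slope_perm m) (Posz (slope m.+1)) = Posz (slope m.+1).
  rewrite IHf ?larger_eq0 ?addn0 //; try lia.
    by apply/ltnW/slope_strict => //; lia.
  by have := slope_gt0 p_gt0 p_lt m.+1; lia.
split=> [k|a an na]; rewrite slope_permS actM.
  rewrite leq_eqVlt => /orP[/eqP->|]; last rewrite ltnS => km.
    rewrite top odd_sign subSnn mulr1.
    by case: (odd m); [rewrite act_up|rewrite act_up0]; rewrite ?eqxx //; have := big 0; lia.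
  rewrite IHs // -signr_odd act_sign step; last by have := big k km; lia.
  by rewrite signr_odd; congr (_ * Posz _)%R; lia.
have na' k : k <= m -> a <> slope k by move=> km; apply: na; lia.
rewrite (IHf a) // largerS.
have [sa|] := ltnP a (slope m.+1).
  by rewrite step ?addn1 ?addnS //; have := larger_lt (ltnW mp) _ na' sa; lia.
rewrite leq_eqVlt => /orP[/eqP E|sa]; first by have := na m.+1 (leqnn _); rewrite E.
rewrite larger_eq0 ?addn0 ?(ltnW mp) //; last first.
  by have := @slope_strict n p p_gt0 p_lt m m.+1; lia.
have s1 := slope_gt0 p_gt0 p_lt m.+1.
by case: (odd m); [rewrite act_up|rewrite act_up0]; rewrite ?addn0 /=; try lia;
  do !(case: ifP); lia.
Qed.

Lemma slope_perm_x : slope_perm p.-1 = x_perm n p.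
Proof.
apply: oneline_inj => i; rewrite oneline_x // -act_ord /x_entry.
have pp : p.-1 < p by lia.
have [Es Ef] := slope_permE pp.
have slopeE k : k < p -> slope k = lambda n p k by rewrite /slope => ->.
case: ifPn => [al|al].
  have ip : index i.+1 (lambdas n p) < p by rewrite -{2}(size_lambdas n p) index_mem.
  have E := nth_index 0 al; rewrite (nth_map 0) ?size_iota // nth_iota // add0n in E.
  by rewrite -{1}E -slopeE // Es; [rewrite prednK | lia].
rewrite Ef ?ltn_ord //; last first.
  move=> k kp E; case/negP: al; rewrite E slopeE; last lia.
  by apply: map_f; rewrite mem_iota; lia.
(* Both sides count: a free position [a] is the number of free positions up to [a] plus the number
   of [lambda_k] below it, and adding the [lambda_k] above it completes these to [p]. *)
congr Posz; rewrite /larger prednK //.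
set A := iota 1 i.+1; have sA : size A = i.+1 by rewrite size_iota.
rewrite -{1}sA -(count_predC [in lambdas n p] A) -addnA [RHS]addnC addnCA; congr (_ + _).
have -> : count (fun k => i.+1 < slope k) (iota 0 p) = count (fun a => i.+1 < a) (lambdas n p).
  rewrite /lambdas count_map; apply: eq_in_count => k; rewrite mem_iota => kp /=.
  by rewrite slopeE //; lia.
rewrite -[RHS](size_lambdas n p) -(count_predC (fun a => i.+1 < a) (lambdas n p))
  addnC; congr (_ + _).
rewrite -!size_filter; apply/perm_size/uniq_perm;
  rewrite ?filter_uniq ?iota_uniq ?lambdas_uniq // => a.
rewrite !mem_filter mem_iota /=; case: (boolP (a \in _)) => [/(lambdas_range pn)|];
  rewrite ?andbF //.
rewrite mem_iota; lia.
Qed.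

Lemma lift_up_asc_left w a b : a <= b <= n ->
  (forall j, a < j <= b -> ~~ desc (w^-1 * dn (sg n) j b) j) ->
  B (up (sg n) a b * w) = up (bg n) a b * B w.
Proof.
move=> /andP[ab bn] H;
  suff E k : k <= b - a -> B (up (sg n) (b - k) b * w) = up (bg n) (b - k) b * B w.
  by have := E _ (leqnn _); rewrite subKn.
elim: k => [|k IH] kba; first by rewrite subn0 !up_nil // !mul1g.
have [j jE] : exists j, b - k = j.+1 by exists (b - k.+1); lia.
have -> : b - k.+1 = j by lia.
have jb : j < b by lia.
rewrite !(up_first _ jb) -!mulgA lift_asc_left; last first.
- by rewrite invgM up_dn_inv invgK; apply: H; lia.
- lia.
by rewrite -jE IH //; lia.
Qed.

(** The inverse permutation fixes [slope m.+1] and takes smaller values at the positive positions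
    before it. Carrying this entry to the left, and through [s_1] if needed, therefore uses ascents
    only. *)
Lemma lift_slope_perm m : m < p ->
  B (slope_perm m) = nest_up n slope m /\ B (slope_perm m)^-1 = nest_dn n slope m.
Proof.
elim: m => [|m IH] mp.
  by rewrite /slope_perm /nest_up /nest_dn /index_iota subnn !big_nil invg1 lift1.
have [IHu IHd] := IH (ltnW mp).
have [_ Ef] := slope_permE (ltnW mp).
have s0 := slope_gt0 p_gt0 p_lt m.+1.
have sn : slope m.+1 <= n by apply: slope_leq => //; lia.
have fixed a : slope m.+1 <= a <= n -> act (slope_perm m) (Posz a) = Posz a.
  move=> an; have sm : slope m < slope m.+1 by apply: slope_strict => //; lia.
  rewrite Ef ?larger_eq0 ?addn0 //; try lia.
  move=> k km; have [->|nkm] := eqVneq k m; first lia.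
  have := @slope_strict n p p_gt0 p_lt k m; lia.
have om : odd m <= slope m.+1 <= n by case: (odd m); lia.
have [v vE] : exists v, v = (slope_perm m)^-1 by exists (slope_perm m)^-1.
have vfix : act v (Posz (slope m.+1)) = Posz (slope m.+1).
  by rewrite vE; apply: (@act_inj _ (slope_perm m)); rewrite actKV fixed // leqnn sn.
have vlt a : 0 < a < slope m.+1 -> (act v (Posz a) < Posz (slope m.+1))%R.
  move=> al; have := @act_range n v a; have := actKV (slope_perm m) (Posz a).
  rewrite -vE; case: (act v _) => [b|b] Eb bn; last lia.
  have [//|sb] := ltnP b (slope m.+1).
  by rewrite fixed in Eb; lia.
have asc j : odd m < j <= slope m.+1 -> ~~ desc (v * dn (sg n) j (slope m.+1)) j.
  move=> js; rewrite /desc; case: ifP => [/eqP j1|j1].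
    by rewrite actM act_dn; [rewrite j1 eqxx vfix | |]; lia.
  rewrite !actM !act_dn; try lia.
  rewrite eqxx vfix ifF; last lia.
  rewrite ifF; last lia.
  by have := vlt j.-1; lia.
rewrite slope_permS invgM up_dn_inv invgK -up_dn_inv -vE; split.
  by rewrite lift_up_asc_left // -?vE // IHu nest_up_recr.
rewrite lift_dn_asc // vE IHd /nest_dn [in RHS]big_nat_recr //= negbK.
by [].
Qed.

Lemma lift_x : B (x_perm n p) = nest_up n slope p.-1 /\
  B (x_perm n p)^-1 = nest_dn n slope p.-1.
Proof. by rewrite -slope_perm_x; apply: lift_slope_perm; lia. Qed.

Lemma delta_power_x : coprime p n -> odd p ->
  conjugate (dn (bg n) 0 n ^+ p) (B (x_perm n p) * B (x_perm n p)^-1 * dn (bg n) 0 n).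
Proof.
move=> cpn op; have [-> ->] := lift_x.
apply: conjugate_trans (delta_power_slopes p_gt0 p_lt cpn) _.
have oq : ~~ odd p.-1 by case: (p) p_gt0 op.
apply: conjugate_trans (conjugate_nest _ _ _ oq) _.
- exact: slope_gt0.
- by move=> j jp; apply: slope_lt.
- exact: slope_last.
by rewrite -(mulgA (nest_up _ _ _)); apply: conjugate_mulC.
Qed.

End SlopePermutation.

(** * Dual lifts *)

Lemma prod_cox_word n (G : groupType) (f : 'I_n -> G) :
  \prod_(i <- cox_word n) f i = dn (letter f) 0 n.
Proof.
rewrite /cox_word /dn subn0.
have -> : iota 1 n = [seq i.+1 | i <- map val (enum 'I_n)].
  by rewrite val_enum_ord -[1%N]/(1 + 0)%N iotaDl.
by rewrite -!map_rev !big_map; apply: eq_bigr => i _; rewrite letterE.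
Qed.

Lemma size_cox_word n : size (cox_word n) = n.
Proof. by rewrite size_rev size_enum_ord. Qed.

Lemma prod_long_word n (G : groupType) (f : 'I_n -> G) :
  \prod_(i <- long_word n) f i = dn (letter f) 0 n ^+ n.
Proof.
suff E m : \prod_(i <- flatten (nseq m (cox_word n))) f i = dn (letter f) 0 n ^+ m by exact: E.
elim: m => [|m IH]; first by rewrite big_nil expg0.
by rewrite big_cat /= IH prod_cox_word expgS.
Qed.

Lemma size_long_word n : size (long_word n) = (n * n)%N.
Proof.
by rewrite /long_word size_flatten /shape map_nseq size_cox_word sumn_nseq.
Qed.

Lemma cox_dn n : cox n = dn (sg n) 0 n.
Proof. exact: prod_cox_word. Qed.

(** * Dual generators and their relations *)

Section Delta.
Variable n : nat.
Hypothesis n_gt1 : 1 < n.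
Local Notation s := (bg n).
Local Notation B := (@positive_lift n).
Local Notation dn := (dn (bg n)).
Implicit Types (i j k l m r : nat).

Definition delta : braid n := dn 0 n.

Lemma proj_delta : proj delta = cox n.
Proof. by rewrite proj_dn cox_dn. Qed.

Lemma lift_cox : B (cox n) = delta.
Proof.
have nn : 0 <= n <= n by rewrite leqnn.
rewrite cox_dn -[X in B X]mul1g lift_dn_asc ?lift1 ?mul1g // => j jn;
  rewrite mul1g /desc; case: ifP => [/eqP->|j1].
  by rewrite act_dn ?eqxx //; lia.
rewrite !act_dn; try lia.
rewrite eqxx ifF; last lia.
by rewrite ifF; lia.
Qed.

Lemma act_cox_pow m j : m <= n -> 0 < j <= n ->
  act (cox n ^+ m) (Posz j) = if m < j then Posz (j - m) else (- Posz (j + n - m))%R.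
Proof.
elim: m => [|m IH] mn jn; first by rewrite expg0 act1 subn0 ifT //; lia.
rewrite expgS actM IH ?(ltnW mn) // cox_dn; case: ifP => mj.
  rewrite act_dn0; last lia.
  by case: ifP => E; [rewrite ifF; lia | rewrite !ifT; lia].
rewrite actN act_dn0; last lia.
by rewrite ifF 1?ifT 1?ifF; lia.
Qed.

Lemma cox_pow_n : cox n ^+ n = longest n.
Proof.
apply: act_eq => j jn; rewrite act_cox_pow // act_longest // ifF; last lia.
by rewrite addnK.
Qed.

Lemma lift_longest : B (longest n) = delta ^+ n.
Proof.
have E : \prod_(i <- long_word n) simple i = longest n.
  by rewrite prod_long_word -cox_pow_n cox_dn.
have := lift_word (s := long_word n); rewrite E => ->; first exact: prod_long_word.
by rewrite ell_longest size_long_word.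
Qed.

Lemma delta_nC (g : braid n) : commute (delta ^+ n) g.
Proof. by rewrite -lift_longest; apply: lift_longestC. Qed.

Lemma s_delta i : 1 < i < n -> s i ^ delta = s i.+1.
Proof.
move=> ni; rewrite conjgE; apply: (mulgI delta); rewrite mulKVg.
by rewrite /delta dn_shift //; lia.
Qed.

Lemma dn_delta i r : 0 < i <= r -> r < n -> dn i r ^ delta = dn i.+1 r.+1.
Proof.
move=> /andP[i0 ir] rn; elim: r ir rn => [|r IH] ir rn; first lia.
have [->|ni] := eqVneq i r.+1; first by rewrite !dn_nil // conj1g.
rewrite (@dnS _ _ i r) ?(@dnS _ _ i.+1 r.+1); try lia.
by rewrite conjMg IH ?s_delta //; lia.
Qed.

(** [bd r i] is the dual generator of the reflection that exchanges [i - 1] and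
    [r], or, for [i = 1], changes the sign of [r]. *)
Definition bd r i : braid n := locked (s i ^ (dn i r)^-1).

Lemma bdE r i : bd r i = s i ^ (dn i r)^-1.
Proof. by rewrite /bd -lock. Qed.

Lemma bd_delta r i : 1 < i <= r -> r < n -> bd r i ^ delta = bd r.+1 i.+1.
Proof.
move=> /andP[i1 ir] rn.
have i0 : 0 < i <= r by lia.
by rewrite !bdE conjJg conjVg dn_delta // s_delta //; lia.
Qed.

(** The essential case is [s_1 ^ delta = s_2 s_1 s_2^-1], which is the relation of length 4. *)
Lemma bd1_delta r : 0 < r < n -> bd r 1 ^ delta = bd r.+1 1.
Proof.
move=> rn; rewrite !bdE (@dn_first _ _ 1 r.+1); last lia.
rewrite conjJg conjVg dn_delta; try lia.
rewrite invgM conjgM; congr (_ ^ _).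
rewrite /delta (@dn_first _ _ 0 n) ?(@dn_first _ _ 1 n); try lia.
have cs : s 1 ^ dn 2 n = s 1.
  apply/conjg_fixP/commgP; apply: commute_dn => i ni; apply: bg_far; lia.
rewrite !conjgM cs !conjgE; apply: (mulgI (s 2 * s 1)); apply: (mulIg (s 2)).
by rewrite !gnorm bg_braid4.
Qed.

Lemma bd_delta_pow r i m : 1 < i <= r -> r + m <= n ->
  bd r i ^ (delta ^+ m) = bd (r + m) (i + m).
Proof.
move=> ir; elim: m => [|m IH] rm; first by rewrite conjg1 !addn0.
by rewrite expgSr conjgM IH ?bd_delta ?addnS //; lia.
Qed.

Lemma bd1_delta_pow r m : 0 < r -> r + m <= n -> bd r 1 ^ (delta ^+ m) = bd (r + m) 1.
Proof.
move=> r0; elim: m => [|m IH] rm; first by rewrite conjg1 addn0.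
by rewrite expgSr conjgM IH ?bd1_delta ?addnS //; lia.
Qed.

(** Conjugation by [delta] has period [n], since [delta ^+ n] is central. The index [i] names an
    orbit and [r], modulo [n], the place in it. *)
Definition dual r i : braid n := locked (bd n i ^ (delta ^+ r)).

Lemma dualE r i : dual r i = bd n i ^ (delta ^+ r).
Proof. by rewrite /dual -lock. Qed.

Lemma conj_delta_n (g : braid n) : g ^ (delta ^+ n) = g.
Proof. by apply/conjg_fixP/commgP/commute_sym/delta_nC. Qed.

Lemma dual_n i : dual n i = bd n i.
Proof. by rewrite dualE conj_delta_n. Qed.

Lemma dual_add r i m : dual (r + m) i = dual r i ^ (delta ^+ m).
Proof. by rewrite !dualE expgnDr conjgM. Qed.

Lemma dual_periodic r i : dual (r + n) i = dual r i.
Proof. by rewrite dual_add conj_delta_n. Qed.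

Lemma dual_bd r i : 1 < i <= r -> r <= n -> dual r (i + (n - r)) = bd r i.
Proof.
move=> ir rn; rewrite dualE; have := @bd_delta_pow r i (n - r) ir.
rewrite subnKC // => <- //.
by rewrite -conjgM -expgnDr subnK // conj_delta_n.
Qed.

Lemma dual_bd1 r : 0 < r <= n -> dual r 1 = bd r 1.
Proof.
move=> /andP[r0 rn]; rewrite dualE; have := @bd1_delta_pow r (n - r) r0.
rewrite subnKC // => <- //.
by rewrite -conjgM -expgnDr subnK // conj_delta_n.
Qed.

Lemma commute_bd x r i : i <= r -> (forall j, i <= j <= r -> commute x (s j)) -> commute x (bd r i).
Proof.
move=> ir H; have c : commute x (dn i r) by apply: commute_dn => j ij; apply: H; lia.
rewrite !bdE conjgE invgK; apply: commuteM => //; apply: commuteM; first by apply: H; lia.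
exact: commuteV.
Qed.

Lemma bd_far i k l : i < l -> l < k -> k < n -> commute (bd n i.+1) (bd k l.+1).
Proof.
move=> il lk kn; apply: commute_bd => // j /andP[lj jk].
have sd : s j * dn i.+1 n = dn i.+1 n * s j.+1.
  by rewrite (@dn_shift _ j.+1) //; lia.
have {}sd : s j ^ dn i.+1 n = s j.+1 by rewrite conjgE sd mulKg.
apply/commute_sym/commgP/conjg_fixP.
apply: (@conjg_inj _ (dn i.+1 n)).
rewrite conjJg sd !bdE conjgKV; apply/conjg_fixP/commgP/commute_sym/bg_far; lia.
Qed.

Lemma bd_low i k l : l < k -> k < i -> i < n -> commute (bd n i.+1) (bd k l.+1).
Proof.
move=> lk ki im; apply: commute_bd => // j ij.
by apply/commute_sym/commute_bd => // m mi; apply: bg_far; lia.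
Qed.

Lemma bd_split i l : l < i < n -> bd n i.+1 * bd i l.+1 = bd n l.+1 * bd n i.+1.
Proof.
move=> li; have c : bd i l.+1 ^ (dn i.+1 n)^-1 = bd i l.+1.
  apply/conjg_fixP/commgP/commuteV/commute_dn => k kn.
  by apply/commute_sym/commute_bd => [|j ji]; [lia | apply/commute_sym/bg_far; lia].
suff -> : bd n l.+1 = bd i l.+1 ^ (bd n i.+1)^-1 by rewrite conjgE invgK -!mulgA mulVg mulg1.
have E : bd n i.+1 * dn i.+1 n = dn i n.
  by rewrite (@dn_first _ _ i n) ?bdE ?conjgE ?gnorm //; lia.
rewrite -c -conjgM -invgM E !bdE -conjgM -invgM.
by rewrite (@dn_cat _ _ l.+1 i n) //; lia.
Qed.

(** The same exchange reached from its upper end: [X = s_r ... s_i] begins with [s_r] and ends with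
    [s_i], and moving a word across it shifts the letters by one. *)
Lemma bd_alt r i : 1 < i <= r -> r <= n -> bd r i = s r ^ dn i.-1 r.-1.
Proof.
move=> /andP[i1 ir] rn; set X := dn i.-1 r.
have E q : i <= q <= r -> dn i.-1 q.-1 * X = X * dn i q.
  elim: q => [|q IH] iq; first lia.
  have [<-|niq] := eqVneq i q.+1; first by rewrite !dn_nil // mulg1 mul1g.
  rewrite /= (_ : dn i.-1 q = s q * dn i.-1 q.-1); last first.
    by rewrite -{1}(prednK (n := q)) ?dnS ?prednK //; lia.
  rewrite -mulgA IH; last lia.
  rewrite mulgA -[s q]/(s q.+1.-1) -dn_shift; try lia.
  by rewrite -mulgA dnS //; lia.
have X1 : X = s r * dn i.-1 r.-1.
  by rewrite /X -{1}(prednK (n := r)) ?dnS ?prednK //; lia.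
have X2 : X = dn i r * s i.
  by rewrite /X (@dn_first _ _ i.-1) ?prednK //; lia.
rewrite !conjgE -X1 !bdE conjgE invgK; apply: (mulgI (dn i.-1 r.-1)).
rewrite mulKVg (mulgA _ (s i)) -X2 mulgA E ?mulgK //; lia.
Qed.

Lemma bd_braid b a : 0 < a < b -> b < n ->
  bd b a.+1 * bd n b.+1 * bd b a.+1 = bd n b.+1 * bd b a.+1 * bd n b.+1.
Proof.
move=> ab bn; have cs : s b.+1 ^ dn a b.-1 = s b.+1.
  apply/conjg_fixP/commgP/commute_dn => i ib; apply/commute_sym/bg_far; lia.
have cb : bd b a.+1 ^ (dn b.+1 n)^-1 = bd b a.+1.
  apply/conjg_fixP/commgP/commuteV/commute_dn => k kn.
  by apply/commute_sym/commute_bd => [|j ji]; [lia | apply/commute_sym/bg_far; lia].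
rewrite (bdE n b.+1).
rewrite -cb -!conjMg; congr (_ ^ _).
rewrite bd_alt; try lia.
by rewrite -cs -!conjMg bg_braid3 //; lia.
Qed.

Lemma bd_turn b a : 0 < a < b -> b < n ->
  bd b a.+1 * bd n a.+1 = bd n b.+1 * bd b a.+1.
Proof.
move=> ab bn; apply: (mulIg (bd n b.+1)).
by rewrite -!mulgA -bd_split ?mulgA ?bd_braid //; lia.
Qed.

Lemma bd_close i l : 0 < i < l -> l < n ->
  bd n i.+1 * bd n l.+1 = bd l i.+1 * bd n i.+1.
Proof. by move=> il ln; rewrite bd_turn // bd_split //; lia. Qed.

Lemma bd1_turn k : 1 < k <= n -> bd k 1 * bd k 2 = bd n k ^ delta * bd k 1.
Proof.
move=> kn; have cs : s 1 ^ dn 2 k = s 1.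
  by apply/conjg_fixP/commgP/commute_dn => i ik; apply: bg_far; lia.
have E : bd k 1 * bd k 2 * (bd k 1)^-1 = bd k 2 ^ s 1.
  rewrite !bdE (@dn_first _ _ 1 k); last lia.
  rewrite invgM conjgM -conjMg -conjVg -conjMg -conjgM.
  have -> : (dn 2 k)^-1 * s 1 = s 1 * (dn 2 k)^-1.
    by rewrite -{2}cs conjgE !mulgA mulgK.
  rewrite conjgM; congr (_ ^ _); rewrite !conjgE invgK.
  apply: (mulgI (s 1)); rewrite mulKVg; apply: (mulIg (s 2)).
  by have := bg_braid4 n_gt1; rewrite !gnorm => ->; rewrite !gnorm.
apply: (mulIg (bd k 1)^-1); rewrite E mulgK.
rewrite /delta (@dn_first _ _ 0 n); last lia.
rewrite conjgM; congr (_ ^ _); rewrite (@bd_alt k 2); try lia.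
rewrite (@dn_cat _ (bg n) 1 k.-1 n); last lia.
rewrite conjgM; congr (_ ^ _).
rewrite (@dn_first _ _ k.-1) ?prednK; try lia.
by rewrite !bdE conjgM conjgKV conjgE mulKg.
Qed.

End Delta.

(** * The Euler form and Hurwitz moves *)

Section EulerForm.
Variable n : nat.
Hypothesis n_gt1 : 1 < n.
Local Notation delta := (delta n).
Local Notation bd := (bd n).
Local Notation dual := (dual n).
Implicit Types (r i k m : nat) (t e : int) (f : int -> int).

Definition antiperiodic f := forall e, f (e + Posz n)%R = (- f e)%R.

(** The root of [dual r i] is [E_r + E_(r + i - 1)], where the basis vectors are
    extended to all integer indices by [E_(k + n) = - E_k]. *)
Definition on_root f r i : int := (f (Posz r) + f (Posz (r + i).-1))%R.

(** The antiperiodic extension of the sign that is [1] on [0 <= t < n]. *)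
Definition step_sign t : int :=
  (if ((t %/ Posz n)%Z %% 2)%Z == 0 then 1 else - 1)%R.

(** On [E_1, ..., E_n] the matrix has 1 on and below the diagonal and -1 above, so that its
    symmetrization is twice the scalar product. Invariance under a shift of the indices is
    invariance under [c]. *)
Definition euler r i r' i' : int :=
  on_root (fun e => on_root (fun e' => step_sign (e - e')%R) r' i') r i.

Lemma step_sign_antiperiodic : antiperiodic step_sign.
Proof.
move=> t; rewrite /step_sign divzDr ?dvdzz // divzz.
have -> : (Posz n != 0)%R by lia.
by case: eqP; case: eqP; lia.
Qed.

Lemma step_sign_small t : (0 <= t < Posz n)%R -> step_sign t = 1%R.
Proof. by move=> tn; rewrite /step_sign divz_small //; lia. Qed.

Lemma step_sign_neg t : (- Posz n <= t < 0)%R -> step_sign t = (- 1)%R.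
Proof.
move=> tn; have := step_sign_antiperiodic t; rewrite (@step_sign_small (t + Posz n)%R); lia.
Qed.

Lemma step_sign_big t : (Posz n <= t < Posz n + Posz n)%R -> step_sign t = (- 1)%R.
Proof.
move=> tn; have := step_sign_antiperiodic (t - Posz n)%R.
rewrite subrK (@step_sign_small (t - Posz n)%R); lia.
Qed.

Lemma step_sign_neg_big t : (- (Posz n + Posz n) <= t < - Posz n)%R -> step_sign t = 1%R.
Proof.
move=> tn; have := step_sign_antiperiodic t; rewrite (@step_sign_neg (t + Posz n)%R); lia.
Qed.

Lemma on_root_add_n f r i : antiperiodic f -> 0 < i -> on_root f (r + n) i = (- on_root f r i)%R.
Proof.
move=> fA i0; rewrite /on_root opprD -!fA; congr (f _ + f _)%R; lia.
Qed.

Lemma on_root_shift f r i m : 0 < i ->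
  on_root (fun e => f (e + Posz m)%R) r i = on_root f (r + m) i.
Proof. by move=> i0; rewrite /on_root; congr (f _ + f _)%R; lia. Qed.

Lemma antiperiodic_shift f m : antiperiodic f -> antiperiodic (fun e => f (e + Posz m)%R).
Proof. by move=> fA e; rewrite -fA addrAC. Qed.

Lemma euler_left r' i' : antiperiodic (fun e => on_root (fun e' => step_sign (e - e')%R) r' i').
Proof.
move=> e; rewrite /on_root opprD -!step_sign_antiperiodic.
by congr (step_sign _ + step_sign _)%R; lia.
Qed.

Lemma step_sign_right e : antiperiodic (fun e' => step_sign (e - e')%R).
Proof.
move=> e'; have := step_sign_antiperiodic (e - (e' + Posz n))%R.
rewrite (_ : e - (e' + Posz n) + Posz n = e - e')%R; lia.
Qed.

Lemma euler_add_left r i r' i' : 0 < i -> euler (r + n) i r' i' = (- euler r i r' i')%R.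
Proof. by move=> i0; apply: on_root_add_n => //; apply: euler_left. Qed.

Lemma euler_add_right r i r' i' : 0 < i' -> euler r i (r' + n) i' = (- euler r i r' i')%R.
Proof.
move=> i0; have E e := on_root_add_n r' (step_sign_right e) i0.
by rewrite /euler {1}/on_root !E -opprD.
Qed.

Lemma euler_shift r i r' i' m : 0 < i -> 0 < i' ->
  euler (r + m) i (r' + m) i' = euler r i r' i'.
Proof.
move=> i0 i0'; rewrite /euler /on_root.
by congr (step_sign _ + step_sign _ + (step_sign _ + step_sign _))%R; lia.
Qed.

(** [dual r' i'] may follow [dual r i] in a tuple; [r'' i''] is the label of the
    conjugate that a Hurwitz move puts in front. *)
Definition hurwitz_label r i r' i' r'' i'' :=
  [/\ dual r i * dual r' i' = dual r'' i'' * dual r i,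
      forall f, antiperiodic f -> on_root f r i = 0%R ->
        (on_root f r' i' = 0%R <-> on_root f r'' i'' = 0%R) &
      euler r'' i'' r i = 0%R].

Lemma step_sign_sub (a b : nat) : a < n + n -> b < n + n ->
  step_sign (Posz a - Posz b)%R =
  (if (b <= a)%N then if (a < n + b)%N then 1 else - 1 else if (b <= n + a)%N then - 1 else 1)%R.
Proof.
move=> an bn; case: (leqP b a) => ba.
  by case: ltnP => abn; [apply: step_sign_small | apply: step_sign_big]; lia.
by case: leqP => abn; [apply: step_sign_neg | apply: step_sign_neg_big]; lia.
Qed.

Lemma hurwitz_label_n i k i' : 0 < i <= n -> 0 < k <= n -> 0 < i' <= n ->
  euler n i k i' = 0%R ->
  exists r'' i'', [/\ 0 < r'' <= n, 0 < i'' <= n & hurwitz_label n i k i' r'' i''].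
Proof.
case: i => // I In kn i'n.
have [e eE] : exists e : nat, e = (k + i').-1 by exists (k + i').-1.
rewrite /euler /on_root addnS /= -eE.
have en : e < n + n by lia.
rewrite !step_sign_sub; try lia.
move=> E0.
(* The roots are [E_n - E_I] and [E_k + E_e]. If the form vanishes, either [k] and [e] are at most
   [I], or the second root is [E_k - E_(e-n)] with both indices above [I] or both at most [I]. Pairs
   sharing no index commute; a common index [I] or [n] gives a relation between three generators. *)
have cases : [\/ k <= e <= I, [/\ n < e, I < e - n & e - n < k] | [/\ n < e, e - n < k & k <= I]].
{ have [Ik|kI] := leqP k I; have [Ie|eI] := leqP e I; have [ne|ne] := leqP e n;
  have [Ie2|eI2] := leqP e (n + I).
  all: try by [constructor 1; lia|constructor 2; split; lia|constructor 3; split; lia].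
  all: exfalso; move: E0; do !(case: ifP); lia. }
have euler0 a b : 0 < a <= n -> 0 < b <= n ->
    ((if (n <= a)%N then 1 else -1) + (if (n + I <= a)%N then 1 else if (I <= a)%N then
      - 1 else 1) +
     ((if (n <= (a + b).-1)%N then 1 else -1) + (if (n + I <= (a + b).-1)%N then 1 else
         if (I <= (a + b).-1)%N then - 1 else 1)) = 0 :> int)%R ->
    euler a b n I.+1 = 0%R.
  move=> an bn E; apply: etrans E; rewrite /euler /on_root addnS /= !step_sign_sub; try lia.
  by congr (_ + _ + (_ + _))%R; do !(case: ifP => //); lia.
have fn f : antiperiodic f -> forall m, f (Posz (n + m)) = (- f (Posz m))%R.
  by move=> fA m; rewrite -fA; congr (f _); lia.
have same : commute (dual n I.+1) (dual k i') -> euler k i' n I.+1 = 0%R ->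
    exists r'' i'', [/\ 0 < r'' <= n, 0 < i'' <= n & hurwitz_label n I.+1 k i' r'' i''].
  by move=> c eu; exists k, i'; split=> //; split.
have onx f : on_root f n I.+1 = (f (Posz n) + f (Posz (n + I)))%R by rewrite /on_root addnS.
have ony f : on_root f k i' = (f (Posz k) + f (Posz e))%R by rewrite eE.
have dual_k l : 0 < l < k -> i' = l.+1 + (n - k) -> dual k i' = bd k l.+1.
  by move=> lk ->; rewrite dual_bd //; lia.
case: cases => [ke|[ne Il lk]|[ne lk kI]].
(* Conjugation by [delta ^+ (n - k)] turns the second generator into [bd n i'] and, for [k < I], the
   first into a [bd] of lower index: the relations above apply with the roles exchanged. *)
- have conj_x : dual n I.+1 ^ delta ^+ (n - k) = dual (n - k) I.+1.
    by rewrite -dual_add addnC dual_periodic.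
  have conj_y : dual k i' ^ delta ^+ (n - k) = dual n i'.
    by rewrite -dual_add subnKC //; lia.
  have xE : k < I -> dual (n - k) I.+1 = bd (n - k) (I - k).+1.
    by move=> kI; rewrite -(dual_bd n_gt1); [congr (dual _ _)| |]; lia.
  have [eI|Ie] := ltnP e I.
    apply: same; last by apply: euler0; rewrite -?eE; do ?(case: ifP => //); lia.
    apply/commgP/conjg_fixP; apply: (@conjg_inj _ (delta ^+ (n - k))).
    rewrite conjJg conj_x conj_y; apply/conjg_fixP/commgP.
    rewrite xE ?(dual_n n_gt1); last lia.
    apply/commute_sym; rewrite (_ : i' = (e - k).+1); last lia.
    apply: bd_far => //; lia.
  have [kI|Ik] := ltnP k I.
    exists k; exists (n - k).+1; split; [lia|lia|split].
    + apply: (@conjg_inj _ (delta ^+ (n - k))); rewrite !conjMg conj_x conj_y.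
      rewrite -dual_add subnKC ?(dual_n n_gt1) ?xE //; last lia.
      by rewrite (_ : i' = (I - k).+1) ?bd_turn //; lia.
    + move=> f fA; rewrite onx ony (_ : e = I); last lia.
      rewrite /on_root (_ : (k + (n - k).+1).-1 = n) ?fn //; lia.
    + by apply: euler0; [lia|lia|]; rewrite (_ : (k + (n - k).+1).-1 = n);
      [do !(case: ifP => //); lia|lia].
  have kI : k = I by lia.
  have i'1 : i' = 1%N by lia.
  exists n; exists 1%N; split; [lia|lia|split].
  + by rewrite i'1 kI !(dual_n n_gt1) dual_bd1 ?bd_split //; lia.
  + move=> f fA; rewrite onx ony (_ : e = I) ?kI; last lia.
    rewrite /on_root addn1 /= fn //; lia.
  + by apply: euler0; [lia|lia|]; rewrite addn1 /=; do !(case: ifP => //); lia.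
- have [kn'|nk] := ltnP k n.
    apply: same; last by apply: euler0; rewrite -?eE; do ?(case: ifP => //); lia.
    rewrite (dual_n n_gt1) (@dual_k (e - n)); try lia.
    by apply: bd_far; lia.
  have kE : k = n by lia.
  have [l lE] : exists l, e = n + l by exists (e - n); lia.
  have i'E : i' = l.+1 by lia.
  exists l; exists (I.+1 + (n - l)); split; [lia|lia|split].
  + rewrite kE i'E; case: (posnP I) => [I0|I0].
      (* For [I = 0] the first generator is a sign change; this shift turns the pair into [bd m 1]
         and [bd m 2], as required by [bd1_turn]. *)
      have [m mE] : exists m, m = (n - l).+1 by exists (n - l).+1.
      apply: (@conjg_inj _ (delta ^+ m)); rewrite !conjMg -!dual_add I0.
      have -> : 1 + (n - l) = m by lia.
      rewrite (addnC n m) (_ : l + m = 1 + n); last lia.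
      rewrite !(dual_periodic n_gt1) (dual_bd1 n_gt1); last lia.
      have -> : l.+1 = 2 + (n - m) by lia.
      rewrite (dual_bd n_gt1); try lia.
      by rewrite (bd1_turn n_gt1) ?dualE ?expg1 //; lia.
    rewrite !(dual_n n_gt1) dual_bd; try lia.
    by rewrite bd_close //; lia.
  + move=> f fA; rewrite onx ony lE fn // kE.
    rewrite /on_root (_ : (l + (I.+1 + (n - l))).-1 = n + I) ?fn //; lia.
  + apply: euler0; [lia|lia|]; rewrite (_ : (l + (I.+1 + (n - l))).-1 = n + I); last lia.
    by do !(case: ifP => //); lia.
have [l lE] : exists l, e = n + l by exists (e - n); lia.
have [kI'|Ik] := ltnP k I.
  apply: same; last by apply: euler0; rewrite -?eE; do ?(case: ifP => //); lia.
  rewrite (dual_n n_gt1) (@dual_k l); try lia.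
  by apply: bd_low; lia.
have kE : k = I by lia.
exists n; exists l.+1; split; [lia|lia|split].
+ by rewrite (@dual_k l) ?kE ?(dual_n n_gt1) ?bd_split //; lia.
+ move=> f fA; rewrite onx ony lE fn // kE.
  rewrite /on_root addnS /= fn //; lia.
+ by apply: euler0; [lia|lia|]; rewrite addnS /=; do !(case: ifP => //); lia.
Qed.

(** Conjugation by [delta ^+ r] reduces to a first label [n]. Bringing indices back to [1, ..., n]
    may change the sign of a root, which no vanishing condition sees. *)
Lemma hurwitz_label_ex r i r' i' :
  0 < r <= n -> 0 < i <= n -> 0 < r' <= n -> 0 < i' <= n ->
  euler r i r' i' = 0%R ->
  exists r'' i'', [/\ 0 < r'' <= n, 0 < i'' <= n & hurwitz_label r i r' i' r'' i''].
Proof.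
move=> rn i_n r'n i'n E0.
have [k [kn kE]] : exists k, 0 < k <= n /\ (k + r = r' \/ k + r = r' + n).
  by case: (leqP r' r) => h; [exists (n - r + r') | exists (r' - r)]; lia.
have E : euler n i k i' = 0%R.
  have := @euler_shift n i k i' r; rewrite addnC euler_add_left; last lia.
  by case: kE => ->; rewrite ?euler_add_right ?E0; lia.
have [r'' [i'' [r''n i''n [D F Z]]]] := hurwitz_label_n i_n kn i'n E.
have [s [sn sE]] : exists s, 0 < s <= n /\ (s = r'' + r \/ s + n = r'' + r).
  by case: (leqP (r'' + r) n) => h; [exists (r'' + r) | exists (r'' + r - n)]; lia.
have dual_s : dual s i'' = dual (r'' + r) i''.
  by case: sE => <- //; rewrite dual_periodic.
have on_s f : antiperiodic f -> on_root f s i'' = 0%R <-> on_root f (r'' + r) i'' = 0%R.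
  by move=> fA; case: sE => <- //; rewrite on_root_add_n //; lia.
have on_r' f : antiperiodic f -> on_root f r' i' = 0%R <-> on_root f (k + r) i' = 0%R.
  by move=> fA; case: kE => -> //; rewrite on_root_add_n //; lia.
have dual_r : dual n i ^ delta ^+ r = dual r i.
  by rewrite -dual_add addnC dual_periodic.
have dual_r' : dual k i' ^ delta ^+ r = dual r' i'.
  by rewrite -dual_add; case: kE => -> //; rewrite dual_periodic.
exists s; exists i''; split=> //; split.
- by rewrite dual_s dual_add -dual_r -dual_r' -!conjMg D.
- move=> f fA f0; rewrite on_r' // on_s // -!on_root_shift; try lia.
  apply: F; first exact: antiperiodic_shift.
  rewrite on_root_shift; last lia.
  by rewrite addnC on_root_add_n ?f0 ?oppr0 //; lia.
have i''0 : 0 < i'' by lia.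
have := @euler_shift r'' i'' n i r i''0 ltac:(lia); rewrite Z.
rewrite (addnC n) euler_add_right; last lia.
by case: sE => <-; rewrite ?euler_add_left //; lia.
Qed.

End EulerForm.

Section HurwitzOrbit.
Variable G : groupType.
Implicit Types (s t u v : seq G) (x g d : G).

Lemma hurwitz_bubble s s1 u x s2 : hurwitz_orbit s (s1 ++ u ++ x :: s2) ->
  hurwitz_orbit s (s1 ++ (\prod_(g <- u) g * x * (\prod_(g <- u) g)^-1) :: u ++ s2).
Proof.
elim/last_ind: u x s2 => [|u y IH] x s2 H.
  by rewrite big_nil mul1g invg1 mulg1.
rewrite cat_rcons in H.
have {}H : hurwitz_orbit s (s1 ++ u ++ (y * x * y^-1) :: y :: s2).
  by apply: HurwitzStep H _; rewrite !catA; apply: HurwitzMove.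
have := IH _ _ H; rewrite cat_rcons prod_rcons invgM !mulgA; apply.
Qed.

Lemma prod_conjV d v : \prod_(g <- v) (d * g * d^-1) = d * \prod_(g <- v) g * d^-1.
Proof.
elim: v => [|y v IH]; first by rewrite !big_nil mulg1 mulgV.
by rewrite !big_cons IH !mulgA mulgVK.
Qed.

(** An entry [x] bubbled to the front is conjugated by the product of all the others, here
    [d * x^-1], which has the same effect on [x] as [d]. *)
Lemma hurwitz_rotate s d u v : \prod_(g <- u) g * \prod_(g <- v) g = d ->
  hurwitz_orbit s ([seq d * g * d^-1 | g <- v] ++ u) ->
  hurwitz_orbit s [seq d * g * d^-1 | g <- u ++ v].
Proof.
elim/last_ind: u v => [|u x IH] v E H; first by rewrite cats0 in H.
rewrite cat_rcons; apply: IH.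
  by rewrite big_cons mulgA -prod_rcons.
have := @hurwitz_bubble s [::] ([seq d * g * d^-1 | g <- v] ++ u) x [::].
rewrite !cats0 -catA /= cats1 => /(_ H); congr (hurwitz_orbit _ (_ :: _)).
rewrite prod_rcons in E; rewrite big_cat /= big_map.
rewrite prod_conjV.
set U := \prod_(g <- u) g in E *; set V := \prod_(g <- v) g in E *.
have -> : d * V * d^-1 * U = d * x^-1 by rewrite -{2}E !invgM !mulgA mulgK mulgVK.
by rewrite invgM invgK !mulgA mulgVK.
Qed.

Lemma hurwitz_rotate_pow s t d m : \prod_(g <- t) g = d -> hurwitz_orbit s t ->
  hurwitz_orbit s [seq d ^+ m * g * d ^- m | g <- t].
Proof.
move=> E H; elim: m => [|m IH].
  by rewrite (eq_map (g := id)) ?map_id // => g; rewrite mul1g invg1 mulg1.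
have -> : [seq d ^+ m.+1 * g * d ^- m.+1 | g <- t] =
    [seq d * g * d^-1 | g <- [seq d ^+ m * g * d ^- m | g <- t] ++ [::]].
  by rewrite cats0 -map_comp; apply: eq_map => g /=; rewrite expgS invgM !mulgA.
apply: hurwitz_rotate => //.
by rewrite big_nil mulg1 big_map prod_conjV E -expgSr expgS mulgK.
Qed.

End HurwitzOrbit.

Lemma prod_cat (G : groupType) (I : Type) (f : I -> G) s t :
  \prod_(i <- s ++ t) f i = \prod_(i <- s) f i * \prod_(i <- t) f i.
Proof. exact: big_cat. Qed.

Lemma map_cat2 (T U : Type) (f : T -> U) (t : seq T) s1 u v s2 :
  s1 ++ u :: v :: s2 = map f t ->
  exists t1 x y t2, [/\ t = t1 ++ x :: y :: t2, s1 = map f t1, u = f x, v = f y & s2 = map f t2].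
Proof.
elim: s1 t => [|a s1 IH] [|b t] //=; first by case: t => // c t [-> -> ->]; exists [::], b, c, t.
by move=> [-> /IH[t1 [x [y [t2 [-> -> -> -> ->]]]]]]; exists (b :: t1), x, y, t2.
Qed.

(** * Cells as dual generators *)

Section Cells.
Variable n : nat.
Hypothesis n_gt1 : 1 < n.
Local Notation delta := (delta n).
Implicit Types (x y z : cell n).

(** The letter of the cell [(a, b)] is [s_(n-a+1)]; a conjugation by [delta ^+ (b - 1)] on the left
    is one by [delta ^+ (n - b + 1)] on the right, [delta ^+ n] being central. *)
Definition dual_cell x : braid n := dual n (n - x.2) (n - x.1).
Definition euler_cell x y : int := euler n (n - x.2) (n - x.1) (n - y.2) (n - y.1).
Definition hurwitz_cell x y z :=
  hurwitz_label n (n - x.2) (n - x.1) (n - y.2) (n - y.1) (n - z.2) (n - z.1).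

Lemma cell_of r i : 0 < r <= n -> 0 < i <= n -> exists x : cell n, n - x.2 = r /\ n - x.1 = i.
Proof.
move=> rn i_n; have h1 : n - i < n by lia.
have h2 : n - r < n by lia.
by exists (Ordinal h1, Ordinal h2) => /=; lia.
Qed.

Lemma cell_range (j : 'I_n) : 0 < n - j <= n.
Proof. by have := ltn_ord j; lia. Qed.

Lemma hurwitz_cell_ex x y : euler_cell x y = 0%R -> exists z, hurwitz_cell x y z.
Proof.
move=> E; have [r [i [rn i_n H]]] := hurwitz_label_ex n_gt1 (cell_range x.2)
  (cell_range x.1) (cell_range y.2) (cell_range y.1) E.
by have [z [zr zi]] := cell_of rn i_n; exists z; rewrite /hurwitz_cell zr zi.
Qed.

Definition cell_prefix x : seq 'I_n :=
  flatten (nseq x.2 (cox_word n)) ++ take x.1 (cox_word n).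

Lemma long_word_split x : exists rest,
  long_word n = cell_prefix x ++ rev_ord x.1 :: rest.
Proof.
exists (drop x.1.+1 (cox_word n) ++ flatten (nseq (n - x.2.+1) (cox_word n))).
have -> : long_word n = flatten (nseq x.2 (cox_word n)) ++ (cox_word n ++ flatten (nseq
  (n - x.2.+1) (cox_word n))).
  rewrite /long_word -[X in nseq X _](subnKC (ltn_ord x.2)) nseqD flatten_cat.
  by rewrite -addn1 nseqD flatten_cat /= cats0 -catA.
rewrite -{2}(cat_take_drop x.1 (cox_word n)) (drop_nth (rev_ord x.1)) ?size_cox_word //.
rewrite /cell_prefix -!catA /=; congr (_ ++ (_ ++ _ :: _)).
rewrite /cox_word nth_rev ?size_enum_ord //; apply: val_inj => /=.
by rewrite nth_enum_ord; have := ltn_ord x.1; lia.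
Qed.

Lemma size_cell_prefix x : size (cell_prefix x) = x.2 * n + x.1.
Proof.
rewrite size_cat size_takel ?size_cox_word; last exact: ltnW.
by rewrite size_flatten /shape map_nseq size_cox_word sumn_nseq mulnC.
Qed.

Lemma prod_take_cox (G : groupType) (f : 'I_n -> G) a : a <= n ->
  \prod_(i <- take a (cox_word n)) f i = dn (letter f) (n - a) n.
Proof.
move=> an; rewrite /dn (_ : iota (n - a).+1 (n - (n - a)) = drop (n - a) (iota 1 n)).
  have -> : iota 1 n = [seq i.+1 | i <- map val (enum 'I_n)].
    by rewrite val_enum_ord -[1%N]/(1 + 0)%N iotaDl.
  rewrite -!map_drop -!map_rev /cox_word take_rev size_enum_ord !big_map.
  by rewrite enumT; apply: eq_bigr => i _; rewrite letterE.
by rewrite drop_iota addnC addn1.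
Qed.

Lemma prod_cell_prefix (G : groupType) (f : 'I_n -> G) x :
  \prod_(i <- cell_prefix x) f i = dn (letter f) 0 n ^+ x.2 * dn (letter f) (n - x.1) n.
Proof.
rewrite big_cat /= prod_take_cox; last exact: ltnW.
congr (_ * _); elim: (nat_of_ord x.2) => [|m IH]; first by rewrite big_nil.
by rewrite big_cat /= IH prod_cox_word expgS.
Qed.

Lemma dual_cellE x : dual_cell x = gen (rev_ord x.1) ^ (\prod_(i <- cell_prefix x) gen i)^-1.
Proof.
rewrite /dual_cell dualE bdE prod_cell_prefix invgM conjgM.
have -> : gen (rev_ord x.1) = bg n (n - x.1).
  by rewrite -(letterE (@gen n)) /= subnSK.
apply: (@conjg_inj _ (delta ^+ x.2)); rewrite conjgKV -conjgM -expgnDr subnK; last exact: ltnW.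
by rewrite (conj_delta_n n_gt1).
Qed.

Lemma cell_indexE x : cell_index x = (size (cell_prefix x)).+1.
Proof. by rewrite size_cell_prefix /cell_index /cell_b /cell_a subn1 addnS. Qed.

Lemma cell_index_inj : injective (@cell_index n).
Proof.
move=> x y; rewrite !cell_indexE !size_cell_prefix => -[E].
have n0 : 0 < n by lia.
case: x y E => [a b] [c d] /= E; congr pair; apply: val_inj => /=.
  by have := congr1 (fun m => m %% n) E; rewrite !modnMDl !modn_small.
by have := congr1 (fun m => m %/ n) E; rewrite !divnMDl // !divn_small // !addn0.
Qed.

Lemma grid_reflectionE x : grid_reflection n (cell_index x) = proj (dual_cell x).
Proof.
have [rest E] := long_word_split x.
rewrite dual_cellE gmulfJ gmulfV /= proj_prod_gen proj_gen conjgE invgK.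
rewrite /grid_reflection cell_indexE /= E -{1}cat_rcons !take_size_cat ?size_rcons //.
rewrite big_cat /= prod_rcons mulgA; congr (_ * _).
rewrite -[X in _ = (\prod_(i <- X) _)^-1]revK -prodgV; apply: eq_bigr => i _.
by rewrite -sg_ord sgV.
Qed.

Lemma cell_prefix_take x y rest : cell_index x < cell_index y ->
  long_word n = cell_prefix x ++ rev_ord x.1 :: rest ->
  exists mid, cell_prefix y = cell_prefix x ++ rev_ord x.1 :: mid.
Proof.
rewrite !cell_indexE ltnS => xy E; have [rest' E'] := long_word_split y.
have : take (size (cell_prefix y)) (long_word n) = cell_prefix y by rewrite E' take_size_cat.
rewrite E take_cat ltnNge (ltnW xy) /= -subnSK // /= => <-.
by exists (take (size (cell_prefix y) - (size (cell_prefix x)).+1) rest).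
Qed.

(** Two equal reflections would give a shorter word for the longest element. *)
Lemma proj_dual_cell_inj x y : proj (dual_cell x) = proj (dual_cell y) -> x = y.
Proof.
wlog xy : x y / cell_index x < cell_index y.
  move=> H E; case: (ltngtP (cell_index x) (cell_index y)) => [xy|yx|/cell_index_inj//].
    exact: H.
  exact/esym/H.
have [rest E] := long_word_split x; have [mid Em] := cell_prefix_take xy E.
have [rest' E'] := long_word_split y.
rewrite !dual_cellE !gmulfJ !gmulfV /= !proj_prod_gen !proj_gen Em.
rewrite (prod_cat _ (cell_prefix x)) big_cons /=; set P := \prod_(i <- cell_prefix x) _.
set Q := \prod_(i <- mid) _; set a := simple _; set b := simple (rev_ord y.1) => D.
(* Equality of the two reflections allows the letters [a] and [b] to be deleted together. *)
have aQ : a * Q * b = Q.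
  have {}D : a = b ^ (a * Q)^-1.
    by apply: (@conjg_inj _ P^-1); rewrite D invgM conjgM.
  have : a * (a * Q) = a * Q * b by rewrite {1}D conjgE invgK (mulgA (a * Q) b) mulgVK.
  by rewrite mulgA simpleK mul1g.
have lw : \prod_(i <- long_word n) simple i = longest n.
  by rewrite prod_long_word -(cox_pow_n n_gt1) cox_dn.
have W : \prod_(i <- cell_prefix x ++ mid ++ rest') simple i = longest n.
  rewrite -lw E' Em -catA !(prod_cat _ (cell_prefix x)) big_cons !prod_cat big_cons -/P -/Q -/a -/b.
  by rewrite -{1}aQ !mulgA.
have := ell_le_size (cell_prefix x ++ mid ++ rest'); rewrite W ell_longest.
by rewrite -size_long_word E' Em !size_cat /=; lia.
Qed.

End Cells.

Section DualLifts.
Variable n : nat.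
Hypothesis n_gt1 : 1 < n.
Local Notation dual_cell := (@dual_cell n).
Local Notation euler_cell := (@euler_cell n).
Local Notation hurwitz_cell := (@hurwitz_cell n).
Implicit Types (x y z w : cell n) (t : seq (cell n)).

Lemma dual_cell_inj : injective dual_cell.
Proof. by move=> x y E; apply: proj_dual_cell_inj => //; rewrite E. Qed.

Lemma hurwitz_cell_mul x y z : hurwitz_cell x y z ->
  dual_cell x * dual_cell y = dual_cell z * dual_cell x.
Proof. by case. Qed.

Lemma euler_swap r i r' i' : euler n r i r' i' =
  on_root (fun e' => on_root (fun e => step_sign n (e - e')%R) r i) r' i'.
Proof. by rewrite /euler /on_root; lia. Qed.

Lemma euler_cell_left w x y z : hurwitz_cell x y z -> euler_cell w x = 0%R ->
  euler_cell w y = 0%R <-> euler_cell w z = 0%R.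
Proof.
case=> _ F _; rewrite /euler_cell !euler_swap; apply: F => e.
rewrite /on_root; have h e0 := step_sign_right n_gt1 e0 e; rewrite /= in h.
by rewrite !h opprD.
Qed.

Lemma euler_cell_right w x y z : hurwitz_cell x y z -> euler_cell x w = 0%R ->
  euler_cell y w = 0%R <-> euler_cell z w = 0%R.
Proof. by case=> _ F _; apply: F; apply: euler_left. Qed.

(** The Hurwitz move is injective on the finitely many pairs with vanishing
    Euler form, hence also surjective. *)
Lemma hurwitz_cell_pre z x : euler_cell z x = 0%R ->
  exists y, euler_cell x y = 0%R /\ hurwitz_cell x y z.
Proof.
move=> E0.
have /choice[f fP] (p : cell n * cell n) :
    exists z, euler_cell p.1 p.2 = 0%R -> hurwitz_cell p.1 p.2 z.
  have [E|E] := eqVneq (euler_cell p.1 p.2) 0%R; last by exists p.1 => E'; rewrite E' eqxx in E.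
  by have [z' H] := hurwitz_cell_ex n_gt1 E; exists z'.
pose S := [set p : cell n * cell n | euler_cell p.1 p.2 == 0%R].
pose g (p : cell n * cell n) := (f p, p.1).
have g_inj : {in S &, injective g}.
  move=> [a b] [c d]; rewrite !inE => /eqP ab /eqP cd [fE ac].
  have [/= D _ _] := fP (a, b) ab; have [/= D' _ _] := fP (c, d) cd.
  rewrite -ac in D' *; congr pair; apply: dual_cell_inj.
  by apply: (mulgI (dual_cell a)); rewrite [LHS]D [RHS]D' fE ac.
have gS : g @: S = S.
  apply/eqP; rewrite eqEcard card_in_imset // leqnn andbT;
    apply/fintype.subsetP => q /imsetP[p pS ->].
  by rewrite inE /=; move: pS; rewrite inE => /eqP pE; have [_ _ /eqP] := fP p pE.
have : (z, x) \in g @: S by rewrite gS inE E0.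
case/imsetP=> -[a b]; rewrite inE /g /= => /eqP ab [zE xE].
by exists b; rewrite xE; split => //; rewrite zE; apply: (fP (a, b)).
Qed.

(** The invariant of the Hurwitz orbit of [(s_n, ..., s_1)]. *)
Definition euler_triangular t := pairwise (fun x y => euler_cell x y == 0%R) t.

(** A linear form zero on the root of [x] vanishes on the root of [y] exactly when it vanishes on
    that of [z], so the conditions against the other entries of the tuple are unchanged. *)
Lemma triangular_swap t1 t2 x y z : hurwitz_cell x y z -> euler_cell x y = 0%R ->
  euler_triangular (t1 ++ x :: y :: t2) = euler_triangular (t1 ++ z :: x :: t2).
Proof.
move=> H xy; have zx : euler_cell z x = 0%R by case: H.
rewrite /euler_triangular !pairwise_cat !pairwise_cons /= !allrel_consr xy zx !eqxx /=.
have L : all (fun w => euler_cell w x == 0%R) t1 ->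
    all (fun w => euler_cell w y == 0%R) t1 = all (fun w => euler_cell w z == 0%R) t1.
  move=> /allP wx; apply: eq_in_all => w /wx /eqP wx'.
  by apply/eqP/eqP => /(euler_cell_left H wx').
have R : all (fun w => euler_cell x w == 0%R) t2 ->
    all (fun w => euler_cell y w == 0%R) t2 = all (fun w => euler_cell z w == 0%R) t2.
  move=> /allP wx; apply: eq_in_all => w /wx /eqP wx'.
  by apply/eqP/eqP => /(euler_cell_right H wx').
case X1 : (all (fun w => euler_cell w x == 0%R) t1) => /=; last by rewrite !andbF.
case X2 : (all (fun w => euler_cell x w == 0%R) t2) => /=; last by rewrite !andbF.
by rewrite (L X1) (R X2).
Qed.

(** For [k > 1], [s_k] is conjugate to [s_n] by [delta ^+ (n - k)], hence starts the column
    [n - k + 1]; [s_1] is the last letter of the last column. *)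
Definition simple_cell (i : 'I_n) : cell n :=
  (if i == 0%N :> nat then rev_ord i else Ordinal (ltn_trans (ltn0Sn 0) n_gt1), rev_ord i).

Lemma dual_simple_cell i : dual_cell (simple_cell i) = gen i.
Proof.
rewrite /dual_cell /= -(letterE (@gen n)) -/(bg n _).
have i_n := ltn_ord i; rewrite subKn //; case: ifP => /= [/eqP i0|i0].
  by rewrite subKn // i0 (dual_bd1 n_gt1) ?bdE ?dn_nil ?invg1 ?conjg1 //; lia.
have -> : n - 0 = i.+1 + (n - i.+1) by lia.
by rewrite (dual_bd n_gt1) ?bdE ?dn_nil ?invg1 ?conjg1 //; lia.
Qed.

Lemma simple_triangular : euler_triangular (map simple_cell (cox_word n)).
Proof.
rewrite /euler_triangular pairwise_map /cox_word.
have P : pairwise (fun i j : 'I_n => j < i) (rev (enum 'I_n)).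
  have : pairwise (fun a b => b < a) (rev (iota 0 n)).
    rewrite -sorted_pairwise; last by move=> a b c ab bc; apply: ltn_trans bc ab.
    by rewrite rev_sorted; apply: iota_ltn_sorted.
  by rewrite -val_enum_ord -map_rev pairwise_map.
apply: sub_pairwise P => i j ji /=; apply/eqP.
have i_n := ltn_ord i; rewrite /euler_cell /simple_cell /=.
rewrite ifF; last lia.
rewrite /euler /on_root !subKn // subn0; case: ifP => j0 /=.
  rewrite subKn // !(step_sign_sub n_gt1); try lia.
  by do !(case: ifP); lia.
rewrite subn0 !(step_sign_sub n_gt1); try lia.
by do !(case: ifP); lia.
Qed.

Lemma hurwitz_orbit_cells s : hurwitz_orbit [seq gen i | i <- cox_word n] s ->
  exists2 t, s = map dual_cell t & euler_triangular t.
Proof.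
elim=> [|u v _ [t Et Tt] uv|u v _ [t Et Tt] vu].
- exists (map simple_cell (cox_word n)); last exact: simple_triangular.
  by rewrite -map_comp; apply: eq_map => i /=; rewrite dual_simple_cell.
- case: uv Et => s1 s2 a b Eu; have [t1 [x [y [t2 [Et -> -> -> ->]]]]] := map_cat2 Eu.
  rewrite Et in Tt.
  have xy : euler_cell x y = 0%R.
    by move: Tt; rewrite /euler_triangular pairwise_cat /= => /and3P[_ _ /andP[/andP[/eqP]]].
  have [z H] := hurwitz_cell_ex n_gt1 xy.
  exists (t1 ++ z :: x :: t2); last by rewrite -(triangular_swap _ _ H xy).
  by rewrite map_cat /=; case: H => D _ _; rewrite [dual_cell x * _]D mulgK.
case: vu Et => s1 s2 a b Eu; have [t1 [z [x [t2 [Et -> Ez Ex ->]]]]] := map_cat2 Eu.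
rewrite Et in Tt.
have zx : euler_cell z x = 0%R.
  by move: Tt; rewrite /euler_triangular pairwise_cat /= => /and3P[_ _ /andP[/andP[/eqP]]].
have [y [xy H]] := hurwitz_cell_pre zx.
exists (t1 ++ x :: y :: t2); last by rewrite (triangular_swap _ _ H xy).
have -> : b = dual_cell y.
  apply: (mulgI (dual_cell x)); rewrite (hurwitz_cell_mul H) -Ez -Ex.
  by rewrite mulgVK.
by rewrite map_cat /= Ex.
Qed.

(** Bubbling the letter to the front conjugates it by the beginning of its column; rotating the
    whole tuple then conjugates it by a power of [delta]. *)
Lemma dual_cell_hurwitz x : exists2 s,
  hurwitz_orbit [seq gen i | i <- cox_word n] s & dual_cell x \in s.
Proof.
set S := [seq gen i | i <- cox_word n].
have prodS : \prod_(g <- S) g = delta n by rewrite big_map prod_cox_word.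
have xn : x.1 < size (cox_word n) by rewrite size_cox_word.
pose u := [seq gen i | i <- take x.1 (cox_word n)].
pose v := [seq gen i | i <- drop x.1.+1 (cox_word n)].
pose g := gen (rev_ord x.1).
have ES : S = u ++ g :: v.
  rewrite /S -{1}(cat_take_drop x.1 (cox_word n)) (drop_nth (rev_ord x.1)) // map_cat /=.
  congr (_ ++ gen _ :: _); rewrite /cox_word nth_rev ?size_enum_ord //; apply: val_inj => /=.
  by rewrite nth_enum_ord; have := ltn_ord x.1; lia.
have H := @hurwitz_bubble _ S [::] u g v; rewrite /= -ES in H.
have {}H := H (HurwitzRefl _).
set A := _ * g * _ in H.
have prodA : \prod_(h <- A :: u ++ v) h = delta n.
  by rewrite -prodS ES big_cons !prod_cat big_cons /A !mulgA mulgVK.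
exists [seq delta n ^+ x.2 * h * delta n ^- x.2 | h <- A :: u ++ v].
  exact: hurwitz_rotate_pow.
apply/mapP; exists A; first exact: mem_head.
rewrite dual_cellE // prod_cell_prefix conjgE invgK -[dn (letter _) 0 n]/(delta n).
rewrite -/g /A big_map -prod_take_cox; last exact: ltnW.
by rewrite invgM !mulgA.
Qed.

Lemma dual_lift_cell x : dual_lift (grid_reflection n (cell_index x)) = dual_cell x.
Proof.
have P : is_dual_lift (grid_reflection n (cell_index x)) (dual_cell x).
  by split; [rewrite /lift_of grid_reflectionE | apply: dual_cell_hurwitz].
rewrite /dual_lift; case: (xgetPex 1 (ex_intro _ _ P)) => pg [s Hs gs].
have [t Et _] := hurwitz_orbit_cells Hs; move: pg gs; rewrite Et /lift_of => pg /mapP[y _ gy].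
by rewrite gy in pg *; congr dual_cell; apply: proj_dual_cell_inj; rewrite ?pg ?grid_reflectionE.
Qed.

End DualLifts.

(** * Products over the grid *)

Section SignedWords.
Variables (G : groupType) (T : eqType) (u D : T -> G) (c : T -> bool).

Definition signed x := if c x then u x else (u x)^-1.

(** A partial product of squares of the reflections of a word is the word times
    its reverse with the unused letters inverted. *)
Lemma prod_squares (l : seq T) :
  (forall p x q, l = p ++ x :: q -> D x = u x ^ (\prod_(y <- p) u y)^-1) ->
  \prod_(x <- rev l | c x) D x ^+ 2 = \prod_(x <- l) u x * \prod_(x <- rev l) signed x.
Proof.
elim/last_ind: l => [|l x IH] H; first by rewrite !big_nil mulg1.
rewrite rev_rcons !big_cons prod_rcons IH; last first.
  by move=> p y q E; apply: (H p y (rcons q x)); rewrite E rcons_cat.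
have Dx := H l x [::]; rewrite cats1 in Dx; have {}Dx := Dx erefl.
rewrite /signed; case: (c x); last by rewrite !mulgA mulgK.
by rewrite Dx -conjXg conjgE invgK expg2 !mulgA mulgVK.
Qed.

End SignedWords.

Section GridProduct.
Variable n : nat.
Hypothesis n_gt1 : 1 < n.
Local Notation B := (@positive_lift n).
Implicit Types (x y : cell n) (I : {set cell n}).

Definition all_cells : seq (cell n) := [seq (a, b) | b <- enum 'I_n, a <- enum 'I_n].

Lemma cox_word_rev_ord : cox_word n = [seq rev_ord i | i <- enum 'I_n].
Proof.
case: n => [|m]; first by rewrite /cox_word (size0nil (size_enum_ord 0)).
apply: (@eq_from_nth _ ord0); first by rewrite size_rev size_map.
move=> i; rewrite size_rev size_enum_ord => im.
rewrite nth_rev ?size_enum_ord // (nth_map ord0) ?size_enum_ord //.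
by apply: val_inj; rewrite /= !nth_enum_ord //; lia.
Qed.

Lemma all_cells_letters : [seq rev_ord x.1 | x <- all_cells] = long_word n.
Proof.
rewrite /all_cells /long_word map_flatten -map_comp; congr flatten.
have E (s : seq 'I_n) :
    [seq [seq rev_ord x.1 | x <- [seq (a, b) | a <- enum 'I_n]] | b <- s] =
    nseq (size s) (cox_word n).
  by elim: s => //= b s ->; rewrite -map_comp cox_word_rev_ord.
by rewrite -[X in nseq X _](size_enum_ord n) -E.
Qed.

Lemma all_cells_index : [seq cell_index x | x <- all_cells] = iota 1 (n * n).
Proof.
have E m s : map val (s : seq 'I_n) = iota m (size s) ->
    [seq cell_index x | x <- [seq (a, b) | b <- s, a <- enum 'I_n]] = iota (m * n).+1 (size s * n).
  elim: s m => [|b s IH] m //= [bm /IH E]; rewrite map_cat E (mulSn (size s)) iotaD; congr (_ ++ _).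
    rewrite -map_comp -addn1 iotaDl -(map_id (iota 1 n)) -[1%N]/(1 + 0)%N iotaDl
      -val_enum_ord -!map_comp.
    by apply: eq_map => a /=; rewrite /cell_index /cell_b /cell_a /= bm subn1.
  by rewrite mulSn addSn addnC.
have := E 0 (enum 'I_n); rewrite size_enum_ord val_enum_ord => -> //.
Qed.

Lemma mem_all_cells x : x \in all_cells.
Proof. by case: x => a b; apply: allpairs_f; rewrite mem_enum. Qed.

Lemma all_cells_uniq : uniq all_cells.
Proof. by apply: (@map_uniq _ _ (@cell_index n)); rewrite all_cells_index iota_uniq. Qed.

Lemma all_cells_prefix p x q : all_cells = p ++ x :: q ->
  [seq rev_ord y.1 | y <- p] = cell_prefix x.
Proof.
move=> E; have sp : size p = size (cell_prefix x).
  have := congr1 (fun s => nth 0 (map (@cell_index n) s) (size p)) E.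
  rewrite /= all_cells_index map_cat nth_cat size_map ltnn subnn /= cell_indexE.
  rewrite nth_iota ?add1n => [[]//|].
  by have := congr1 size all_cells_index; rewrite size_map size_iota E size_cat /=; lia.
have [rest Er] := long_word_split n_gt1 x.
have := congr1 (take (size p)) all_cells_letters.
by rewrite E map_cat take_size_cat ?size_map // Er sp take_size_cat.
Qed.

Lemma decreasing_cellsE I : decreasing_cells I = [seq x <- rev all_cells | x \in I].
Proof.
have tr : transitive (fun x y => cell_index y <= cell_index x).
  by move=> y x z /= xy yz; apply: leq_trans yz xy.
apply: (@sorted_eq _ (fun x y => cell_index y <= cell_index x)) => //.
- by move=> x y /andP[yx xy]; apply: cell_index_inj => //; lia.
- by apply: sort_sorted => x y; apply: leq_total.
- apply: sorted_filter => //; rewrite rev_sorted.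
  rewrite -(sorted_map (f := @cell_index n) (e' := leq)) all_cells_index.
  exact: iota_sorted.
rewrite /decreasing_cells perm_sort; apply: uniq_perm; rewrite ?enum_uniq //.
  by rewrite filter_uniq ?rev_uniq ?all_cells_uniq.
by move=> x; rewrite mem_enum mem_filter mem_rev mem_all_cells andbT.
Qed.

Lemma grid_productE I : grid_product I =
  delta n ^+ n * \prod_(x <- rev all_cells) signed (fun x => gen (rev_ord x.1)) [in I] x.
Proof.
rewrite /grid_product decreasing_cellsE big_filter.
rewrite (eq_bigr (fun x => dual_cell x ^+ 2)); last first.
  by move=> x _; rewrite /pure_gen dual_lift_cell.
rewrite (@prod_squares _ _ (fun x : cell n => gen (rev_ord x.1)) (@dual_cell n) [in I]); last first.
  move=> p x q E; rewrite dual_cellE // -(all_cells_prefix E) big_map //.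
congr (_ * _).
by rewrite -(big_map _ predT (@gen n)) all_cells_letters prod_long_word.
Qed.

(** Each signed letter undoes one letter of the word: [B (y * s) * s = B y] at a descent of [y], and
    [B (y * s) * s^-1 = B y] otherwise. *)
Lemma lift_signed w (l : seq (cell n)) (c : cell n -> bool) :
  (forall p x q, l = p ++ x :: q ->
     c x = desc (w * \prod_(y <- p) simple (rev_ord y.1)) (rev_ord x.1).+1) ->
  B (w * \prod_(y <- l) simple (rev_ord y.1)) *
    \prod_(x <- rev l) signed (fun x => gen (rev_ord x.1)) c x = B w.
Proof.
elim/last_ind: l => [|l x IH] H; first by rewrite !big_nil !mulg1.
rewrite -[RHS]IH; last by move=> p y q E; apply: (H p y (rcons q x)); rewrite E rcons_cat.
have cx := H l x [::]; rewrite cats1 in cx; have {}cx := cx erefl.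
rewrite rev_rcons big_cons prod_rcons !mulgA; congr (_ * _).
set y := w * _ in cx *.
have xn : 0 < (rev_ord x.1).+1 <= n by apply: ltn_ord.
have gE : gen (rev_ord x.1) = bg n (rev_ord x.1).+1 by rewrite /bg letterE.
rewrite /signed cx -sg_ord gE; case: ifP => d; first by rewrite [RHS](lift_desc xn).
by rewrite (lift_asc xn) ?d // mulgK.
Qed.

(** [delta ^+ n] is [B w] times the lift of [w^-1 * longest], which the signed letters bring back to
    [B w^-1]. *)
Lemma grid_product_lift w I :
  (forall x, (x \in I) =
     desc (w^-1 * \prod_(i <- cell_prefix x) simple i) (n - x.1)) ->
  grid_product I = B w * B w^-1.
Proof.
move=> H; rewrite grid_productE.
have E : \prod_(y <- all_cells) simple (rev_ord y.1) = longest n.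
  rewrite -(big_map _ predT (@simple n)) all_cells_letters prod_long_word.
  by rewrite -(cox_pow_n n_gt1) cox_dn.
have := @lift_signed w^-1 all_cells [in I]; rewrite E => L.
rewrite -[X in _ = _ * X]L; last first.
  move=> p x q Epq; rewrite [LHS]H -(all_cells_prefix Epq) big_map /= subnSK //.
by rewrite mulgA lift_mul_longest lift_longest.
Qed.

End GridProduct.

Section GridDescents.
Variable n : nat.
Hypothesis n_gt1 : 1 < n.
Implicit Types (x : cell n) (v : sperm n).

(** The prefix of the cell [(a, b)] takes the simple root of its letter to [e_(n-b+1) - e_(n+1-a-b)]
    if [a + b <= n], and otherwise to the positive root in the direction of
    [e_(n-b+1) + e_(2n+1-a-b)]. *)
Lemma desc_cell v x : desc (v * \prod_(i <- cell_prefix x) simple i) (n - x.1) =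
  if x.1 + x.2 < n.-1 then (act v (Posz (n - x.2)) < act v (Posz (n.-1 - (x.1 + x.2))))%R
  else (act v (Posz (n - x.2)) + act v (Posz (n - x.2 + (n.-1 - x.1))) < 0)%R.
Proof.
have [a_n b_n] := (ltn_ord x.1, ltn_ord x.2).
rewrite prod_cell_prefix -[dn (letter _) 0 n]/(dn (sg n) 0 n) -cox_dn -[letter _]/(sg n).
rewrite /desc !actM; case: ifP => [/eqP i1|i1].
  rewrite act_dn ?i1; try lia.
  rewrite eqxx act_cox_pow // ?b_n; try lia.
  rewrite ifF; last lia.
  by rewrite (_ : n.-1 - x.1 = 0) ?addn0; lia.
rewrite !act_dn; try lia.
rewrite eqxx ifF; last lia.
rewrite ifF; last lia.
rewrite !act_cox_pow ?b_n; try lia.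
case: ifP => ab.
  by rewrite ifT; [congr (_ < act _ (Posz _))%R | ]; lia.
rewrite ifF; last lia.
by rewrite actN (_ : (n - x.1).-1 + n - x.2 = n - x.2 + (n.-1 - x.1)); lia.
Qed.

End GridDescents.

(** * The inversions of [x_(n,p)^-1] are the cells of [J_p] *)

Section SlopeInversions.
Variables n p : nat.
Hypothesis p_gt0 : 0 < p.
Hypothesis p_lt : p < n.
Hypothesis p_odd : odd p.
Hypothesis p_n : coprime p n.
Implicit Types (j k r l v a : nat).

Let pn : 0 < p <= n. Proof. by lia. Qed.
Local Notation w := (x_perm n p).
Local Notation lambda := (lambda n p).
Local Notation free a := (count [predC lambdas n p] (iota 1 a)).

Lemma act_x a : 0 < a <= n -> act w (Posz a) = x_entry n p a.
Proof. by case/ord_of => i ->; rewrite act_ord oneline_x. Qed.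

Lemma lambda_index k : k < p -> lambda k \in lambdas n p /\ index (lambda k) (lambdas n p) = k.
Proof.
move=> kp; have E : nth 0 (lambdas n p) k = lambda k.
  by rewrite (nth_map 0) ?size_iota // nth_iota.
by rewrite -E mem_nth ?index_uniq ?size_lambdas // lambdas_uniq.
Qed.

Lemma act_x_lambda k : k < p -> act w (Posz (lambda k)) = ((-1) ^+ k * Posz (p - k))%R.
Proof.
move=> kp; have [kl ki] := lambda_index kp.
rewrite act_x /x_entry ?kl ?ki //.
by have := lambdas_range pn kl; rewrite mem_iota; lia.
Qed.

Lemma act_x_free a : 0 < a <= n -> a \notin lambdas n p -> act w (Posz a) = Posz (p + free a).
Proof. by move=> an al; rewrite act_x // /x_entry (negPf al). Qed.

Lemma act_xV_small v : 0 < v <= p ->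
  act w^-1 (Posz v) = ((-1) ^+ (~~ odd v) * Posz (lambda (p - v)))%R.
Proof.
move=> vp; have kp : p - v < p by lia.
have E := act_x_lambda kp; rewrite subKn in E; last lia.
have sv : ((-1) ^+ (p - v) = (-1) ^+ (~~ odd v) :> int)%R.
  by rewrite -signr_odd oddB ?p_odd //; lia.
apply: (@act_inj _ w); rewrite actKV act_sign E sv mulrA -signr_addb addbb mul1r //.
Qed.

Lemma free_lambda k : k < p -> free (lambda k) + k.+1 = lambda k.
Proof.
move=> kp; rewrite -[RHS](size_iota 1) -(count_predC [in lambdas n p]) addnC; congr (_ + _).
have -> : count [in lambdas n p] (iota 1 (lambda k)) = count (fun a => a <= lambda k) (lambdas n p).
  rewrite -!size_filter; apply/perm_size/uniq_perm;
    rewrite ?filter_uniq ?iota_uniq ?lambdas_uniq // => a.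
  rewrite !mem_filter mem_iota /=; case: (boolP (a \in _)) => [/(lambdas_range pn)|];
    rewrite ?andbF //.
  rewrite mem_iota; lia.
rewrite /lambdas count_map (@eq_in_count _ _ (fun j => j < k.+1)); last first.
  move=> j _ /=; rewrite ltnS; apply/idP/idP; last first.
    by rewrite leq_eqVlt => /orP[/eqP->//|/(lambda_lt pn)/ltnW].
  by apply: contraTT; rewrite -!ltnNge => /(lambda_lt pn).
rewrite -(subnKC kp) iotaD count_cat add0n.
rewrite (@eq_in_count _ _ predT) ?count_predT ?size_iota; last by move=> j;
  rewrite mem_iota /=; lia.
by rewrite (@eq_in_count _ _ pred0) ?count_pred0 ?addn0 // => j; rewrite mem_iota /=; lia.
Qed.

Lemma act_xV_big v : p < v <= n -> exists a, [/\ 0 < a <= n, a \notin lambdas n p,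
  act w^-1 (Posz v) = Posz a & v = p + free a].
Proof.
move=> vn; have [a an [b E]] : exists2 a, 0 < a <= n & exists b : bool, act w^-1 (Posz
  v) = ((-1) ^+ b * Posz a)%R.
  have := @act_range n w^-1 v; case: (act _ _) => a an.
    by exists a; [lia | exists false; rewrite mul1r].
  by exists a.+1; [lia | exists true; rewrite mulN1r NegzE].
have := actKV w (Posz v); rewrite E act_sign.
have [al|al] := boolP (a \in lambdas n p).
  have /mapP[k] := al; rewrite mem_iota => kp ->; rewrite act_x_lambda; last lia.
  by move/(congr1 absz); rewrite !abszM !abszX !abszN1 !exp1n !mul1n /=; lia.
rewrite act_x_free //; case: b E => E.
  by rewrite mulN1r; lia.
by rewrite mul1r => -[Ev]; exists a; split; rewrite // mul1r.
Qed.

Lemma act_xV_big_lt v k : p < v <= n -> k < p ->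
  (act (w^-1)%g (Posz v) < Posz (lambda k))%R = (v < p - k + lambda k).
Proof.
move=> vn kp; have [a [an al -> vE]] := act_xV_big vn.
have fl := free_lambda kp; have [kl _] := lambda_index kp.
rewrite ltz_nat; case: (ltngtP a (lambda k)) => [alt|agt|E]; last by rewrite E kl in al.
  have : free a <= free (lambda k).
    by rewrite -(subnKC (ltnW alt)) iotaD count_cat leq_addr.
  lia.
have := count_free_lt agt al; lia.
Qed.

Lemma act_xV_big_mono u v : p < u < v -> v <= n ->
  (act (w^-1)%g (Posz u) < act (w^-1)%g (Posz v))%R.
Proof.
move=> uv vn; have [|a [an al -> uE]] := @act_xV_big u; first lia.
have [|b [bn bl -> vE]] := @act_xV_big v; first lia.
rewrite ltz_nat; case: (ltngtP a b) => // [ba|E]; last by rewrite E in uE; lia.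
by have := count_free_lt ba al; lia.
Qed.

Lemma lambda_ge k : k < lambda k.
Proof. by rewrite ltnS leq_divRL // mulnC leq_mul2r; apply/orP; right; lia. Qed.

(** The absolute values of [x^-1] decrease on [1, ..., p]. A negative entry at [l], for [l] even, is
    below all later ones; a positive one is above the later ones up to [p], and [act_xV_big_lt]
    compares it with the others. The bound [l.+1 < p] excludes [l = p], where the entry is
    [lambda_0 = 1]. *)
Lemma act_xV_diff l r : 0 < l < r -> r <= n ->
  (act (w^-1)%g (Posz r) < act (w^-1)%g (Posz l))%R =
  [&& odd l, l.+1 < p & r < l + lambda (p - l)].
Proof.
move=> lr rn; have [pl|lp] := ltnP p l.
  by have := @act_xV_big_mono l r ltac:(lia) rn; lia.
have l0 : 0 < l <= p by lia.
rewrite (act_xV_small l0).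
have [rp|pr] := leqP r p.
  have r0 : 0 < r <= p by lia.
  rewrite (act_xV_small r0).
  have lt : lambda (p - r) < lambda (p - l) by apply: lambda_lt => //; lia.
  have par : l.+1 = p -> ~~ odd l by move=> E; have := p_odd; rewrite -E.
  have := lambda_ge (p - l); move: par.
  by case: (odd l); case: (odd r); rewrite ?expr0 ?expr1 ?mul1r ?mulN1r; lia.
have pos : (0 < act (w^-1)%g (Posz r))%R.
  by have [a [an _ -> _]] := @act_xV_big r ltac:(lia); lia.
case ol: (odd l); last by rewrite expr1 mulN1r; lia.
rewrite expr0 mul1r act_xV_big_lt; try lia.
have [lp1|] := leqP l.+2 p; first by lia.
move=> pl; have -> : l = p.
  have [//|] := eqVneq l p; have := p_odd; have : p = l.+1 \/ p = l by lia.
  by case=> ->; rewrite ?eqxx //= ol.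
by rewrite subnn /Defs.lambda muln0 div0n; lia.
Qed.

Lemma act_xV_sum r v : 0 < r <= v -> v <= n ->
  (act (w^-1)%g (Posz r) + act (w^-1)%g (Posz v) < 0)%R =
  [&& ~~ odd r, r < p & v < r + lambda (p - r)].
Proof.
move=> rv vn; have pos u : p < u <= n -> (0 < act (w^-1)%g (Posz u))%R.
  by move=> un; have [a [an _ -> _]] := act_xV_big un; lia.
have [pr|rp] := ltnP p r.
  by have := pos r ltac:(lia); have := pos v ltac:(lia); lia.
have r0 : 0 < r <= p by lia.
have := lambda_ge (p - r).
rewrite (act_xV_small r0); have [vp|pv] := leqP v p.
  have v0 : 0 < v <= p by lia.
  rewrite (act_xV_small v0).
  have [->|nrv] := eqVneq v r.
    case orr: (odd r); rewrite ?expr0 ?expr1 ?mul1r ?mulN1r; first lia.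
    have : r <> p by move=> E; rewrite E p_odd in orr.
    lia.
  have lt : lambda (p - v) < lambda (p - r) by apply: lambda_lt => //; lia.
  by case: (odd r); case: (odd v); rewrite ?expr0 ?expr1 ?mul1r ?mulN1r; lia.
have := pos v ltac:(lia); case orr: (odd r); rewrite ?expr0 ?expr1 ?mul1r ?mulN1r; first lia.
have rp' : r <> p by move=> E; rewrite E p_odd in orr.
have := @act_xV_big_lt v (p - r); rewrite subKn; last lia.
move=> /(_ ltac:(lia) ltac:(lia)); lia.
Qed.

(** [p] does not divide [n * k], so the integral parts of [n * k / p] and [n * (p - k) / p] add up
    to [n - 1]. *)
Lemma lambda_compl k : 0 < k < p -> lambda k + lambda (p - k) = n.+1.
Proof.
move=> kp; rewrite /Defs.lambda; set q := (n * k) %/ p; set s := (n * k) %% p.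
have E : (n * k = q * p + s)%N := divn_eq _ _.
have sp : s < p by rewrite ltn_mod.
have s0 : 0 < s.
  case: (posnP s) => // s0; have : p %| n * k by rewrite /dvdn -/s s0.
  by rewrite Gauss_dvdr // => /dvdn_leq; lia.
have qn : q < n by rewrite ltn_divLR // ltn_pmul2l; lia.
have -> : (n * (p - k) = (n - q.+1) * p + (p - s))%N.
  rewrite mulnBr E mulnBl mulSn; have : q.+1 * p <= n * p by rewrite leq_mul2r qn orbT.
  rewrite mulSn; lia.
by rewrite divnMDl // divn_small; lia.
Qed.

Lemma mem_bigcup_seq (T : finType) (F : nat -> {set T}) (r : seq nat) (x : T) :
  (x \in (\bigcup_(j <- r) F j)%SET) = has (fun j => x \in F j) r.
Proof.
elim: r => [|j r IH]; first by rewrite big_nil finset.in_set0.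
by rewrite big_cons finset.in_setU IH.
Qed.

(** [I_j^+] consists of the inverted differences with smaller index [p - 2 j], and [I_j^-] of the
    negative sums with smaller index [2 j]. The bounds on [a] agree because
    [eta_j + 1 = lambda_(2j)] and [lambda_(2j) + lambda_(p-2j) = n + 1]. *)
Lemma mem_J_small (x : cell n) : (x \in J_small n p) =
  if x.1 + x.2 < n.-1 then (act (w^-1)%g (Posz (n - x.2)) < act (w^-1)%g (Posz (n.-1 -
    (x.1 + x.2))))%R
  else (act (w^-1)%g (Posz (n - x.2)) + act (w^-1)%g (Posz (n - x.2 + (n.-1 - x.1))) < 0)%R.
Proof.
have [a_n b_n] := (ltn_ord x.1, ltn_ord x.2).
have eta_lt j : 0 < j -> 2 * j < p ->
    (eta_ n p j).+1 = lambda (2 * j) /\ eta_ n p j + lambda (p - 2 * j) = n.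
  move=> j0 jp; have E : (eta_ n p j).+1 = lambda (2 * j) by rewrite /eta_ /Defs.lambda
    (mulnC 2 n) mulnA.
  by split=> //; have := @lambda_compl (2 * j) ltac:(lia); lia.
rewrite /J_small mem_bigcup_seq; apply/hasP/idP => [[j]|].
  rewrite mem_index_iota finset.in_setU !inE /cell_a /cell_b => jp.
  have [e1 e2] := eta_lt j ltac:(lia) ltac:(lia).
  have lg := lambda_ge (2 * j).
  case/orP=> [H|H]; case: ifP => ab.
  - rewrite act_xV_diff; try lia.
    have -> : p - (n.-1 - (x.1 + x.2)) = (2 * j)%N by lia.
    have -> : n.-1 - (x.1 + x.2) = p - 2 * j by lia.
    by rewrite oddB ?p_odd ?oddM /=; lia.
  - lia.
  - lia.
  rewrite act_xV_sum; try lia.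
  have -> : n - x.2 = (2 * j)%N by lia.
  by rewrite oddM /=; lia.
case: ifP => ab.
  rewrite act_xV_diff; try lia.
  case/and3P=> ol lp H; set l := n.-1 - (x.1 + x.2) in ol lp H.
  have [j lE] : exists j, (p - l = 2 * j)%N.
    by exists (p - l)./2; rewrite mul2n -[LHS]odd_double_half oddB ?p_odd ?ol //; lia.
  have [e1 e2] := eta_lt j ltac:(lia) ltac:(lia).
  exists j; first by rewrite mem_index_iota; lia.
  rewrite finset.in_setU !inE /cell_a /cell_b; apply/orP; left.
  by rewrite lE in H; lia.
rewrite act_xV_sum; try lia.
case/and3P=> orr rp H.
have [j rE] : exists j, (n - x.2 = 2 * j)%N.
  by exists (n - x.2)./2; rewrite mul2n -[LHS]odd_double_half (negPf orr).
have [e1 e2] := eta_lt j ltac:(lia) ltac:(lia).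
exists j; first by rewrite mem_index_iota; lia.
rewrite finset.in_setU !inE /cell_a /cell_b; apply/orP; right.
by rewrite rE in H; lia.
Qed.

End SlopeInversions.

(** * The degree and the mirror automorphism *)

Section Degree.
Variable n : nat.

Lemma braid_eq_invariant (T : Type) (F : word n -> T) (op : T -> T -> T) :
  (forall u v, F (u ++ v) = op (F u) (F v)) ->
  (forall b i, F [:: (b, i); (~~ b, i)] = F [::]) ->
  (forall i j, F (alternating (false, i) (false, j) (coxeter_matrix i j)) =
               F (alternating (false, j) (false, i) (coxeter_matrix i j))) ->
  forall u v, braid_eq u v -> F u = F v.
Proof.
by move=> FM FV FB u v; elim=> // [u' v' w' _ -> _ -> // | u1 u2 v1 v2 _ E1 _ E2];
  rewrite !FM E1 E2.
Qed.

Definition degree (g : braid n) : int :=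
  (\sum_(x <- word_of g) (if x.1 then -1 else 1))%R.

Lemma degree_class (u : word n) :
  degree (class_of u) = (\sum_(x <- u) (if x.1 then -1 else 1))%R.
Proof.
apply: (@braid_eq_invariant _ (fun u => \sum_(x <- u) (if x.1 then -1 else 1))%R +%R)
  (word_of_class u).
- by move=> u' v'; rewrite big_cat.
- by move=> b i; rewrite !big_cons big_nil; case: b.
move=> i j; have E (a b : 'I_n) m :
    (\sum_(x <- alternating (false, a) (false, b) m) (if x.1 then -1 else 1) = Posz m)%R.
  elim: m a b => [|m IH] a b; first by rewrite big_nil.
  by rewrite big_cons IH /=; lia.
by rewrite !E.
Qed.

Lemma degreeM (g h : braid n) : degree (g * h) = (degree g + degree h)%R.
Proof.
rewrite -{1}(class_ofK g) -{1}(class_ofK h) -[_ * _]/(braid_mul _ _) braid_mulE.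
by rewrite degree_class big_cat.
Qed.

Lemma degree1 : degree 1 = 0%R.
Proof. by rewrite degree_class big_nil. Qed.

Lemma degreeV (g : braid n) : degree g^-1 = (- degree g)%R.
Proof. by apply/eqP; rewrite -addr_eq0 -degreeM mulVg degree1. Qed.

Lemma degreeX (g : braid n) m : degree (g ^+ m) = (degree g * Posz m)%R.
Proof.
elim: m => [|m IH]; first by rewrite degree1 mulr0.
by rewrite expgS degreeM IH; lia.
Qed.

Lemma degree_conj (g h : braid n) : degree (g ^ h) = degree g.
Proof. by rewrite conjgE !degreeM degreeV; lia. Qed.

Lemma degree_gen (i : 'I_n) : degree (gen i) = 1%R.
Proof. by rewrite degree_class big_seq1. Qed.

Lemma degree_prod (I : Type) (r : seq I) (F : I -> braid n) (d : int) :
  (forall i, degree (F i) = d) -> degree (\prod_(i <- r) F i) = (d * Posz (size r))%R.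
Proof.
move=> H; elim: r => [|i r IH]; first by rewrite big_nil degree1 mulr0.
by rewrite big_cons degreeM H IH /=; lia.
Qed.

Lemma degree_delta : degree (delta n) = Posz n.
Proof.
rewrite /delta -prod_cox_word (degree_prod _ (d := 1%R)) ?mul1r ?size_cox_word //.
exact: degree_gen.
Qed.

End Degree.

Section Mirror.
Variable n : nat.
Local Notation s := (bg n).
Local Notation dn := (dn (bg n)).
Local Notation up := (up (bg n)).

Definition mirror_word (u : word n) : braid n :=
  \prod_(x <- u) (if x.1 then gen x.2 else (gen x.2)^-1).

Definition mirror (g : braid n) : braid n := mirror_word (word_of g).

(** The mirror of a positive word is the inverse of the reversed word, and an alternating word read
    backwards is again one of the two sides of the same relation. *)
Lemma mirror_class (u : word n) : mirror (class_of u) = mirror_word u.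
Proof.
apply: (@braid_eq_invariant _ _ mirror_word *%g) (word_of_class u).
- by move=> u' v'; rewrite /mirror_word big_cat.
- move=> b i; rewrite /mirror_word !big_cons big_nil mulg1.
  by case: b => /=; rewrite ?mulgV ?mulVg.
move=> i j; have E (a b : 'I_n) m : mirror_word (alternating (false, a) (false, b) m) =
    (\prod_(k <- rev (alternating a b m)) gen k)^-1.
  rewrite -prodgV /mirror_word -(map_alternating (fun k => (false, k))) big_map.
  by [].
have rev_alt (a b : 'I_n) m : rev (alternating a b m) = if odd m then alternating a b m
  else alternating b a m.
  elim: m a b => // m IH a b; rewrite alternating_rcons rev_rcons IH /=.
  by case om: (odd m) => //=; have := alternating_rcons a b m; rewrite om => <-.
by rewrite !E !rev_alt; case: ifP => _; rewrite gen_braid.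
Qed.

Lemma mirrorM (g h : braid n) : mirror (g * h) = mirror g * mirror h.
Proof.
rewrite -{1}(class_ofK g) -{1}(class_ofK h) -[class_of _ * _]/(braid_mul _ _) braid_mulE.
by rewrite mirror_class /mirror_word big_cat.
Qed.

Lemma mirror1 : mirror 1 = 1.
Proof. by rewrite mirror_class /mirror_word big_nil. Qed.

Lemma mirrorV (g : braid n) : mirror g^-1 = (mirror g)^-1.
Proof. by apply/esym/mulg1_eq; rewrite -mirrorM mulgV mirror1. Qed.

Lemma mirrorX (g : braid n) m : mirror (g ^+ m) = mirror g ^+ m.
Proof. by elim: m => [|m IH]; rewrite ?mirror1 // !expgS mirrorM IH. Qed.

Lemma mirror_gen (i : 'I_n) : mirror (gen i) = (gen i)^-1.
Proof. by rewrite mirror_class /mirror_word big_seq1. Qed.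

Lemma mirror_prod (I : Type) (r : seq I) (F : I -> braid n) :
  mirror (\prod_(i <- r) F i) = \prod_(i <- r) mirror (F i).
Proof. by elim: r => [|i r IH]; rewrite ?big_nil ?mirror1 // !big_cons mirrorM IH. Qed.

(** Conjugation by [g] turns [s_(m+1) * dn 0 m] into [s_(m+1) * up 0 m], which a further conjugation
    by [up 0 m] rotates. The commutation clause keeps [s_(m+1)] fixed by [g]. *)
Lemma dn_conj_up m : exists2 g, g * dn 0 m * g^-1 = up 0 m &
  forall i, m < i -> commute g (s i).
Proof.
elim: m => [|m [g E C]].
  by exists 1; [rewrite dn_nil // up_nil // invg1 !mulg1 | move=> i _; apply/commute_sym/commute1].
exists (up 0 m * g).
  rewrite dnS // upS // invgM; set U := up 0 m in E *.
  have -> : U * g * (s m.+1 * dn 0 m) * (g^-1 * U^-1) = U * s m.+1 * (g * dn 0 m * g^-1) * U^-1.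
    by rewrite !mulgA -(mulgA U g) (C m.+1) // !mulgA.
  by rewrite E mulgK.
move=> i mi; apply/commute_sym/commuteM; first by apply: commute_s_up; lia.
by apply/commute_sym/C; lia.
Qed.

Lemma mirror_delta : exists g : braid n, mirror (delta n) = g * (delta n)^-1 * g^-1.
Proof.
have [g E _] := dn_conj_up n; exists g.
have -> : mirror (delta n) = (up 0 n)^-1.
  rewrite /delta -prod_cox_word mirror_prod.
  rewrite (eq_bigr (fun i => (gen i)^-1)); last by move=> i _; apply: mirror_gen.
  rewrite prodgV; congr (_^-1); rewrite /up subn0 /cox_word revK.
  have -> : iota 1 n = [seq i.+1 | i <- map val (enum 'I_n)].
    by rewrite val_enum_ord -[1%N]/(1 + 0)%N iotaDl.
  by rewrite !big_map -?enumT; apply: eq_bigr => i _; rewrite /bg letterE.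
by rewrite -E !invgM invgK mulgA.
Qed.

End Mirror.

(** * Conjugators for [p < n] and for [n < p] *)

Section RationalConjugator.
Variables n p : nat.
Hypothesis p_gt0 : 0 < p.
Hypothesis p_lt : p < n.
Hypothesis p_odd : odd p.
Hypothesis p_n : coprime p n.
Local Notation delta := (delta n).
Local Notation lambda := (lambda n p).

Let n_gt1 : 1 < n. Proof. by lia. Qed.

Lemma grid_product_J_small : grid_product (J_small n p) =
  positive_lift (x_perm n p) * positive_lift (x_perm n p)^-1.
Proof.
by apply: grid_product_lift => // x; rewrite mem_J_small // desc_cell.
Qed.

Lemma J_small_conjugator : exists g : braid n,
  g * delta ^+ p * g^-1 = grid_product (J_small n p) * delta.
Proof. by rewrite grid_product_J_small; apply: delta_power_x. Qed.

Lemma lambda_bound k : k < p -> lambda k + (p - k) <= n.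
Proof.
move=> kp; suff E m : m < p -> lambda (p - m.+1) + m.+1 <= n.
  by have := E (p - k.+1); rewrite subnSK // subKn //; [lia | exact: ltnW].
elim: m => [|m IH] mp; first by have := @lambda_lt_n n p p_gt0 p_lt (p - 1); lia.
have := IH (ltnW mp); have : lambda (p - m.+2) < lambda (p - m.+1); last lia.
by apply: lambda_lt; lia.
Qed.

(** A cell of this column has [n] as the larger index of its root, and [lambda_bound] keeps the
    inversions with a smaller index [l] below [l + lambda_(p-l) <= n]. *)
Lemma J_small_first_column x : x \in first_column n -> x \notin J_small n p.
Proof.
rewrite !inE /cell_b eqSS => /eqP x0; rewrite mem_J_small // x0 addn0 subn0.
have a_n := ltn_ord x.1; case: ifP => a1.
  rewrite act_xV_diff //; try lia.
  have := @lambda_bound (p - (n.-1 - x.1)); lia.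
by rewrite act_xV_sum //; lia.
Qed.

(** Outside the first column, complementing the set of cells mirrors the signed
    word of the grid product. *)
Lemma complement_conjugator : exists g : braid n,
  g * delta ^+ (2 * n - p) * g^-1 =
  grid_product (~: (J_small n p :|: first_column n))%SET * delta.
Proof.
have [g Eg] := J_small_conjugator; have [k Ek] := mirror_delta n.
set J := J_small n p in Eg *; set J' := (~: _)%SET.
pose sgn (I : {set cell n}) := signed (fun x : cell n => gen (rev_ord x.1)) [in I].
have n_gt0 : 0 < n := ltnW n_gt1; pose o : 'I_n := Ordinal n_gt0.
have [rest [Er rest0]] : exists rest, enum 'I_n = o :: rest /\ forall b, b \in rest -> 0 < b.
  have iotaE : iota 0 n = 0 :: iota 1 n.-1 by rewrite -{1}(prednK n_gt0).
  have := val_enum_ord n; rewrite iotaE; case: (enum 'I_n) => [|b rest] //= -[b0 E].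
  exists rest; split.
    by congr (_ :: _); apply: val_inj.
  by move=> a /(map_f val); rewrite E mem_iota => /andP[].
pose cells := [seq (a, b) | b <- rest, a <- enum 'I_n].
have Ecells : all_cells n = [seq (a, o) | a <- enum 'I_n] ++ cells.
  by rewrite /all_cells {2}Er.
have out x : x \in cells -> x \notin first_column n.
  case/allpairsP=> -[b a] /= [/rest0 b0 _ ->].
  by rewrite !inE /cell_b /=; lia.
(* The first column closes the reversed word. None of its cells lies in [I], so its letters are all
   inverted and compose [delta^-1]. *)
have col (I : {set cell n}) : (forall x, x \in first_column n -> x \notin I) ->
    \prod_(x <- rev [seq (a, o) | a <- enum 'I_n]) sgn I x = delta^-1.
  move=> H; rewrite -map_rev big_map (eq_bigr (fun a => (gen (rev_ord a))^-1)); last first.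
    by move=> a _; rewrite /sgn /signed ifN // H // !inE.
  rewrite prodgV revK; congr (_^-1).
  transitivity (\prod_(i <- cox_word n) gen i); last exact: prod_cox_word.
  by rewrite cox_word_rev_ord //; apply/esym; exact: big_map.
pose V I := \prod_(x <- rev cells) sgn I x.
have XE (I : {set cell n}) : (forall x, x \in first_column n -> x \notin I) ->
    grid_product I * delta = delta ^+ n * V I.
  move=> H; rewrite grid_productE // Ecells rev_cat prod_cat -/(sgn I) col //.
  by rewrite !mulgA mulgVK.
have MV : mirror (V J) = V J'.
  rewrite mirror_prod; apply: eq_big_seq => x; rewrite mem_rev => /out x_out.
  rewrite /sgn /signed /J' finset.in_setC finset.in_setU (negPf x_out) orbF.
  by case: (x \in J); rewrite /= ?mirrorV mirror_gen ?invgK.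
rewrite XE in Eg; last exact: J_small_first_column.
rewrite XE -?MV; last by move=> x xf; rewrite finset.in_setC finset.in_setU xf orbT.
have -> : V J = delta ^- n * (g * delta ^+ p * g^-1) by rewrite Eg mulKg.
have mirror_delta_pow m : mirror (delta ^+ m) = k * delta ^- m * k^-1.
  have E y : k * y * k^-1 = y ^ k^-1 by rewrite conjgE invgK mulgA.
  by rewrite mirrorX Ek !E -conjXg expVgn.
exists (mirror g * k).
(* One central factor [delta ^+ n] comes from the grid product and another from the mirror of
   [delta ^- n]; with the mirrored [delta ^+ p], conjugate to [delta ^- p], they give the exponent
   [2 * n - p]. *)
rewrite !mirrorM !mirrorV !mirror_delta_pow.
have -> : (k * delta ^- n * k^-1)^-1 = delta ^+ n.
  by rewrite !invgM !invgK mulgA -(delta_nC n_gt1) mulgK.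
rewrite expgnFr; last lia.
rewrite mul2n -addnn expgnDr invgM !mulgA.
have c x : x * delta ^+ n = delta ^+ n * x by apply/esym/delta_nC.
by rewrite c mulgA c !mulgA.
Qed.

End RationalConjugator.

Lemma dual_conjugator_exists n p (J : {set cell n}) (g : braid n) :
  1 < n -> 0 < p -> odd p -> g * delta n ^+ p * g^-1 = grid_product J * delta n ->
  positive_dual_conjugator p g /\
  g * positive_lift (cox n) ^+ p * g^-1 * (positive_lift (cox n))^-1 = grid_product J.
Proof.
move=> n_gt1 p_gt0 p_odd E; rewrite /positive_dual_conjugator lift_cox //.
have EX : g * delta n ^+ p * g^-1 * (delta n)^-1 = grid_product J by rewrite E mulgK.
have XE : grid_product J = \prod_(x <- decreasing_cells J) dual_cell x ^+ 2.
  by apply: eq_bigr => x _; rewrite /pure_gen dual_lift_cell.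
have proj_cell x : proj (dual_cell x : braid n) =
    (proj (\prod_(i <- cell_prefix x) gen i)) * simple (rev_ord x.1) *
    (proj (\prod_(i <- cell_prefix x) gen i))^-1.
  by rewrite dual_cellE // gmulfJ gmulfV /= proj_gen conjgE invgK mulgA.
split=> //; split.
  exists (proj g) => //.
  (* Squares of lifts of reflections project to 1, so the projection of the identity for [g] is
     [w c^p w^-1 = c]. *)
  have projX : proj (grid_product J) = 1.
    rewrite XE gmulf_prod big1 // => x _.
    by rewrite expgS expg1 gmulfM /= proj_cell; set w := proj _;
      rewrite !mulgA mulgVK -(mulgA w) simpleK mulg1 mulgV.
  by move/(congr1 (@proj n)): E; rewrite !gmulfM gmulfV gmulfXn /= projX mul1g proj_delta.
exists [seq grid_reflection n (cell_index x) | x <- decreasing_cells J]; split.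
(* The left side has degree [n * (p - 1)] and every factor on the right has degree 2. *)
- rewrite size_map; have := congr1 (@degree n) EX.
  rewrite XE !degreeM !degreeV degreeX degree_delta (degree_prod _ (d := 2%:Z)).
    by move: p_gt0 p_odd; set m := size _; lia.
  by move=> x; rewrite degreeX dual_cellE // degree_conj degree_gen.
- move=> u /mapP[x _ ->]; rewrite grid_reflectionE // proj_cell.
  by eexists; eexists.
by rewrite EX big_map.
Qed.

Theorem theorem7p17 (n p : nat) :
  (2 <= n)%N -> (1 <= p <= 2 * n - 1)%N -> coprime p (2 * n) ->
  exists g : braid n,
    [/\ positive_dual_conjugator p g,
        g * positive_lift (cox n) ^+ p * g^-1 * (positive_lift (cox n))^-1 =
          grid_product (J_set n p) &
        (p < n)%N ->
          grid_product (J_set n p) =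
            positive_lift (x_perm n p) * positive_lift (x_perm n p)^-1].
Proof.
move=> n_gt1 /andP[p_gt0 p_le]; rewrite coprimeMr coprimen2 => /andP[p_odd p_n].
rewrite /J_set; case: ltnP => [p_lt|].
  have [g /dual_conjugator_exists [] // D E] := J_small_conjugator p_gt0 p_lt p_odd p_n.
  by exists g; split=> // _; apply: grid_product_J_small.
(* [p = n] would give [gcd(p, n) = n > 1]. *)
rewrite leq_eqVlt => /predU1P[n_p|n_lt].
  by move: p_n; rewrite -n_p /coprime gcdnn; lia.
have q_gt0 : 0 < 2 * n - p by lia.
have q_lt : 2 * n - p < n by lia.
have q_odd : odd (2 * n - p) by lia.
have q_n : coprime (2 * n - p) n.
  have [r n_r p_r] : exists2 r, r <= n & p = n + r by exists (p - n); lia.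
  have n_qr : n = 2 * n - p + r by lia.
  by move: p_n; rewrite {1}p_r /coprime gcdnC gcdnDl; move: (2 * n - p) n_qr => q ->;
    rewrite gcdnC gcdnDr gcdnDl gcdnC.
have [g] := complement_conjugator q_gt0 q_lt q_odd q_n.
rewrite subKn; last lia.
by case/dual_conjugator_exists=> // D E; exists g.
Qed.
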